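(* Let $\mathbb X$ be a separated noetherian scheme. Then a product (taken in the category of complexes in $\operatorname{Qcoh}\mathbb X$) of acyclic complexes of injective objects in $\operatorname{Qcoh}\mathbb X$ is acyclic.
   Context: $\operatorname{Qcoh}\mathbb X$ is the category of quasi-coherent sheaves on $\mathbb X$. Complexes are unbounded; products are arbitrary (set-indexed) and are formed in $\operatorname{Qcoh}\mathbb X$ degreewise. *)

(* Defs.v *)
(* Schemes, quasi-coherent sheaves and complexes of them, over MathComp rings
   and MathComp-Analysis topological spaces. *)
From HB Require Import structures.
From mathcomp Require Import all_boot all_algebra.
From mathcomp Require Import all_classical topology.
From mathcomp Require Import ring.

Set Implicit Arguments.
Unset Strict Implicit.
Unset Printing Implicit Defensive.

Import GRing.Theory.
Local Open Scope classical_set_scope.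
Local Open Scope quotient_scope.
Local Open Scope ring_scope.

Identity Coercion fun_of_set : set >-> Funclass.

Record opens (T : topologicalType) := Opens {
  oset :> set T;
  oset_open : open oset }.

Definition is_sheaf (T : topologicalType) (F : opens T -> Type)
    (r : forall U V : opens T, V `<=` U -> F U -> F V) : Prop :=
  forall (U : opens T) (I : Type) (V : I -> opens T)
    (VU : forall i, V i `<=` U),
  (forall x, U x -> exists i, V i x) ->
  forall s : forall i, F (V i),
  (forall i j (W : opens T) (Wi : W `<=` V i) (Wj : W `<=` V j),
     r _ _ Wi (s i) = r _ _ Wj (s j)) ->
  exists! t : F U, forall i, r _ _ (VU i) t = s i.

(* comPzRingType allows the zero ring, as needed for the sections over the
   empty open set. *)
Record ringedSpace := RingedSpace {
  rspace :> topologicalType;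
  osec : opens rspace -> comPzRingType;
  ores : forall U V : opens rspace, V `<=` U -> {rmorphism osec U -> osec V};
  ores_id : forall (U : opens rspace) (UU : U `<=` U) s, ores UU s = s;
  ores_comp : forall (U V W : opens rspace)
    (VU : V `<=` U) (WV : W `<=` V) (WU : W `<=` U) s,
    ores WV (ores VU s) = ores WU s;
  ores_sheaf : is_sheaf (fun U V VU => ores VU : osec U -> osec V) }.

(* The map of sheaves O_X -> f_* O_Y is given as the compatible family of the
   maps O_X(V) -> O_Y(f^-1 V) -> O_Y(U) for U contained in f^-1 V, so that no
   transport along equalities of open sets is ever needed. *)
Record rs_morphism (Y X : ringedSpace) := RsMorphism {
  mfun :> Y -> X;
  mcont : continuous mfun;
  msharp : forall (V : opens X) (U : opens Y),
    U `<=` mfun @^-1` V -> {rmorphism osec V -> osec U};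
  msharp_res : forall (V V' : opens X) (U U' : opens Y)
    (UV : U `<=` mfun @^-1` V) (UV' : U' `<=` mfun @^-1` V')
    (VV : V' `<=` V) (UU : U' `<=` U) s,
    msharp UV' (ores VV s) = ores UU (msharp UV s) }.

Definition mpre (Y X : ringedSpace) (f : rs_morphism Y X) (V : opens X) :
    opens Y :=
  Opens (proj1 (continuousP f) (@mcont _ _ f) V (oset_open V)).

Lemma mpre_sub (Y X : ringedSpace) (f : rs_morphism Y X) (V : opens X) :
  mpre f V `<=` f @^-1` V.
Proof. by []. Qed.

Definition rs_eq (Y X : ringedSpace) (f g : rs_morphism Y X) : Prop :=
  (forall y, f y = g y) /\
  forall (V : opens X) (U : opens Y)
    (Uf : U `<=` f @^-1` V) (Ug : U `<=` g @^-1` V) s,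
    msharp Uf s = msharp Ug s.

Section Identity.
Variable X : ringedSpace.

Lemma rs_id_cont : continuous (@id X).
Proof. by move=> x. Qed.

Definition rs_id : rs_morphism X X :=
  @RsMorphism X X id rs_id_cont (fun V U (UV : U `<=` V) => ores UV)
    (fun V V' U U' UV UV' VV UU s =>
       etrans (ores_comp VV UV' (subset_trans UU UV) s)
              (esym (ores_comp UV UU (subset_trans UU UV) s))).

End Identity.

Section Composition.
Variables (Z Y X : ringedSpace) (f : rs_morphism Y X) (g : rs_morphism Z Y).

Lemma rs_comp_cont : continuous (f \o g).
Proof. by move=> z; apply: continuous_comp; apply: mcont. Qed.

Definition rs_comp_sharp (V : opens X) (U : opens Z)
    (UV : U `<=` (f \o g) @^-1` V) : {rmorphism osec V -> osec U} :=
  @msharp _ _ g (mpre f V) U UV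
    \o msharp (@mpre_sub _ _ f V).

Lemma rs_comp_res (V V' : opens X) (U U' : opens Z)
    (UV : U `<=` (f \o g) @^-1` V) (UV' : U' `<=` (f \o g) @^-1` V')
    (VV : V' `<=` V) (UU : U' `<=` U) s :
  rs_comp_sharp UV' (ores VV s) = ores UU (rs_comp_sharp UV s).
Proof.
have PP : mpre f V' `<=` mpre f V by move=> y; apply: VV.
rewrite /rs_comp_sharp /=.
rewrite (msharp_res (@mpre_sub _ _ f V) _ VV PP).
by rewrite (msharp_res (UV : U `<=` g @^-1` mpre f V) _ PP UU).
Qed.

Definition rs_comp : rs_morphism Z X := RsMorphism rs_comp_cont rs_comp_res.

End Composition.

Section PrimeSpectrum.
Variable A : comPzRingType.

Record primeSpec := PrimeSpec {
  pideal :> set A;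
  pideal0 : pideal 0;
  pidealD : forall a b, pideal a -> pideal b -> pideal (a + b);
  pidealM : forall a b, pideal b -> pideal (a * b);
  pideal1 : ~ pideal 1;
  pideal_prime : forall a b, pideal (a * b) -> pideal a \/ pideal b }.

HB.instance Definition _ := gen_eqMixin primeSpec.
HB.instance Definition _ := gen_choiceMixin primeSpec.

Definition zariski_open : set_system primeSpec :=
  [set U | exists E : set A, U = [set p : primeSpec | ~ E `<=` p]].

Lemma zariski_openT : zariski_open setT.
Proof.
exists setT; apply/seteqP; split=> p _ //= pT.
by apply: (@pideal1 p); apply: pT.
Qed.

Lemma zariski_openI : setI_closed zariski_open.
Proof.
move=> _ _ [E ->] [F ->].
exists [set a | exists2 e, E e & exists2 f, F f & a = e * f].
apply/seteqP; split=> p /=.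
  move=> [nE nF] EF; move: nE; apply=> e Ee; apply: contrapT => pe.
  apply: nF => f Ff; have : p (e * f) by apply: EF; exists e => //; exists f.
  by case/pideal_prime.
move=> nEF; split=> pE; apply: nEF => _ [e Ee [f Ff ->]].
  by rewrite mulrC; apply: pidealM; apply: pE.
by apply: pidealM; apply: pE.
Qed.

Lemma zariski_open_bigU (I : Type) (f : I -> set primeSpec) :
  (forall i, zariski_open (f i)) -> zariski_open (\bigcup_i f i).
Proof.
move=> /choice [E fE]; exists (\bigcup_i E i).
apply/seteqP; split=> p /=.
  move=> [i _]; rewrite fE /= => nE EI.
  by apply: nE => a Ea; apply: EI; exists i.
move=> nE; apply: contrapT => np; apply: nE => a [i _ Ea].
apply: contrapT => pa; apply: np; exists i => //; rewrite fE /= => Ep.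
exact/pa/Ep.
Qed.

HB.instance Definition _ := isOpenTopological.Build primeSpec
  zariski_openT zariski_openI zariski_open_bigU.

End PrimeSpectrum.

Section Localization.
Variables (A : comPzRingType) (p : primeSpec A).

Definition den := {a : A | a \notin (p : set A)}.

Lemma den1_subproof : 1 \notin (p : set A).
Proof. by rewrite notin_setE; apply: pideal1. Qed.

Lemma denM_subproof (s t : den) : sval s * sval t \notin (p : set A).
Proof.
rewrite notin_setE => /pideal_prime.
by move: (valP s) (valP t); rewrite !notin_setE => ns nt [].
Qed.

Definition den1 : den := Sub 1 den1_subproof.
Definition denM (s t : den) : den := Sub (sval s * sval t) (denM_subproof s t).

Section Module.
Variable M : lmodType A.

Definition loc_rel (x y : M * den) : bool :=
  `[< exists u : den,
        sval u *: (sval y.2 *: x.1) = sval u *: (sval x.2 *: y.1) >].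

Lemma loc_rel_refl : reflexive loc_rel.
Proof. by move=> x; apply/asboolP; exists den1. Qed.

Lemma loc_rel_sym : symmetric loc_rel.
Proof. by move=> x y; apply/asboolP/asboolP => -[u e]; exists u. Qed.

Lemma loc_rel_trans : transitive loc_rel.
Proof.
move=> [n t] [m s] [k r] /asboolP[/= u e] /asboolP[/= v e'].
apply/asboolP; exists (denM (denM u v) t) => /=; rewrite !scalerA.
transitivity ((sval v * sval r) *: (sval u *: (sval t *: m))).
  by rewrite !scalerA; congr (_ *: _); ring.
rewrite e; transitivity ((sval u * sval s) *: (sval v *: (sval r *: n))).
  by rewrite !scalerA; congr (_ *: _); ring.
by rewrite e' !scalerA; congr (_ *: _); ring.
Qed.

Canonical loc_rel_equiv :=
  EquivRel loc_rel loc_rel_refl loc_rel_sym loc_rel_trans.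

(* M_p: the fractions m/s with s outside of p, where m/s = n/t when
   u (t m - s n) = 0 for some u outside of p. *)
Definition loc := {eq_quot loc_rel}.

HB.instance Definition _ := Choice.on loc.
HB.instance Definition _ : EqQuotient _ loc_rel loc := EqQuotient.on loc.

Definition frac (m : M) (s : den) : loc := \pi_loc (m, s).

Lemma fracP (m n : M) (s t : den) :
  frac m s = frac n t <->
  exists u : den, sval u *: (sval t *: m) = sval u *: (sval s *: n).
Proof.
split; first by move=> /eqmodP/asboolP.
by move=> e; apply/eqmodP/asboolP.
Qed.

Lemma frac_ind (P : loc -> Prop) : (forall m s, P (frac m s)) -> forall x, P x.
Proof. by move=> h; elim/quotW => -[m s]; apply: h. Qed.

Lemma frac_repr (x : loc) : frac (repr x).1 (repr x).2 = x.
Proof. by rewrite /frac -surjective_pairing reprK. Qed.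

Definition loc0 : loc := frac 0 den1.
Definition loc_opp (x : loc) : loc := frac (- (repr x).1) (repr x).2.
Definition loc_add (x y : loc) : loc :=
  frac (sval (repr y).2 *: (repr x).1 + sval (repr x).2 *: (repr y).1)
       (denM (repr x).2 (repr y).2).

Lemma loc_oppE m s : loc_opp (frac m s) = frac (- m) s.
Proof.
rewrite /loc_opp; have /fracP[u e] := frac_repr (frac m s).
by apply/fracP; exists u; rewrite !scalerN e.
Qed.

Lemma loc_addE m s n t :
  loc_add (frac m s) (frac n t) = frac (sval t *: m + sval s *: n) (denM s t).
Proof.
rewrite /loc_add.
have /fracP[u] := frac_repr (frac m s); have /fracP[v] := frac_repr (frac n t).
move: (repr _) (repr _) => [m' s'] [n' t'] /= e e'.
apply/fracP; exists (denM u v) => /=.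
rewrite !scalerDr !scalerA; congr (_ + _).
  transitivity ((sval v * sval t * sval t') *: (sval u *: (sval s *: m'))).
    by rewrite !scalerA; congr (_ *: _); ring.
  by rewrite e' !scalerA; congr (_ *: _); ring.
transitivity ((sval u * sval s * sval s') *: (sval v *: (sval t *: n'))).
  by rewrite !scalerA; congr (_ *: _); ring.
by rewrite e !scalerA; congr (_ *: _); ring.
Qed.

Lemma frac_eq m s n t : sval t *: m = sval s *: n -> frac m s = frac n t.
Proof. by move=> e; apply/fracP; exists den1; rewrite e. Qed.

Lemma loc_addA : associative loc_add.
Proof.
elim/frac_ind => m s; elim/frac_ind => n t; elim/frac_ind => k r.
rewrite !loc_addE; apply: frac_eq => /=; rewrite !scalerDr !scalerA addrA.
by congr (_ *: _ + _ *: _ + _ *: _); ring.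
Qed.

Lemma loc_addC : commutative loc_add.
Proof.
elim/frac_ind => m s; elim/frac_ind => n t.
by rewrite !loc_addE; apply: frac_eq => /=; rewrite addrC [sval t * _]mulrC.
Qed.

Lemma loc_add0 : left_id loc0 loc_add.
Proof.
elim/frac_ind => m s; rewrite !loc_addE; apply: frac_eq => /=.
by rewrite scaler0 add0r scale1r mul1r.
Qed.

Lemma loc_addN : left_inverse loc0 loc_opp loc_add.
Proof.
elim/frac_ind => m s; rewrite loc_oppE loc_addE; apply: frac_eq => /=.
by rewrite scalerN addNr !scaler0.
Qed.

HB.instance Definition _ :=
  GRing.isZmodule.Build loc loc_addA loc_addC loc_add0 loc_addN.

Lemma fracD m s n t :
  frac m s + frac n t = frac (sval t *: m + sval s *: n) (denM s t).
Proof. exact: loc_addE. Qed.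

Lemma fracN m s : - frac m s = frac (- m) s.
Proof. exact: loc_oppE. Qed.

End Module.

Definition locRing := loc A^o.

HB.instance Definition _ := GRing.Zmodule.on locRing.

Definition rfrac (a : A) (s : den) : locRing := frac (a : A^o) s.

Definition loc1 : locRing := rfrac 1 den1.
Definition loc_mul (x y : locRing) : locRing :=
  rfrac ((repr x).1 * (repr y).1) (denM (repr x).2 (repr y).2).

Lemma rfracP (a b : A) (s t : den) :
  rfrac a s = rfrac b t <->
  exists u : den, sval u * (sval t * a) = sval u * (sval s * b).
Proof. exact: (@fracP A^o). Qed.

Lemma rfrac_repr (x : locRing) : rfrac (repr x).1 (repr x).2 = x.
Proof. exact: (@frac_repr A^o). Qed.

Lemma rfracD a s b t :
  rfrac a s + rfrac b t = rfrac (sval t * a + sval s * b) (denM s t).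
Proof. exact: loc_addE. Qed.

Lemma rfrac_ind (P : locRing -> Prop) :
  (forall a s, P (rfrac a s)) -> forall x, P x.
Proof. exact: (@frac_ind A^o). Qed.

Lemma rfrac_eq (a b : A) s t : sval t * a = sval s * b -> rfrac a s = rfrac b t.
Proof. exact: (@frac_eq A^o). Qed.

Lemma loc_mulE a s b t :
  loc_mul (rfrac a s) (rfrac b t) = rfrac (a * b) (denM s t).
Proof.
rewrite /loc_mul.
have /rfracP[u] := rfrac_repr (rfrac a s).
have /rfracP[v] := rfrac_repr (rfrac b t).
move: (repr _) (repr _) => [a' s'] [b' t'] /= e e'.
apply/rfracP; exists (denM u v) => /=.
transitivity (sval u * (sval s * a') * (sval v * (sval t * b'))); first by ring.
by rewrite e' e; ring.
Qed.

Lemma loc_mulA : associative loc_mul.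
Proof.
elim/rfrac_ind => a s; elim/rfrac_ind => b t; elim/rfrac_ind => c r.
by rewrite !loc_mulE; apply: rfrac_eq => /=; ring.
Qed.

Lemma loc_mulC : commutative loc_mul.
Proof.
elim/rfrac_ind => a s; elim/rfrac_ind => b t.
by rewrite !loc_mulE; apply: rfrac_eq => /=; ring.
Qed.

Lemma loc_mul1 : left_id loc1 loc_mul.
Proof.
elim/rfrac_ind => a s.
by rewrite !loc_mulE; apply: rfrac_eq => /=; ring.
Qed.

Lemma loc_mulD : left_distributive loc_mul +%R.
Proof.
elim/rfrac_ind => a s; elim/rfrac_ind => b t; elim/rfrac_ind => c r.
by rewrite rfracD !loc_mulE rfracD; apply: rfrac_eq => /=; ring.
Qed.

HB.instance Definition _ := GRing.Zmodule_isComPzRing.Build locRing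
  loc_mulA loc_mulC loc_mul1 loc_mulD.

Lemma rfrac1 : rfrac 1 den1 = 1.
Proof. by []. Qed.

Lemma rfracM a s b t : rfrac a s * rfrac b t = rfrac (a * b) (denM s t).
Proof. exact: loc_mulE. Qed.

Section Scaling.
Variable M : lmodType A.

Definition loc_scale (x : locRing) (y : loc M) : loc M :=
  frac ((repr x).1 *: (repr y).1) (denM (repr x).2 (repr y).2).

Lemma loc_scaleE a s (m : M) t :
  loc_scale (rfrac a s) (frac m t) = frac (a *: m) (denM s t).
Proof.
rewrite /loc_scale.
have /rfracP[u] := rfrac_repr (rfrac a s).
have /fracP[v] := frac_repr (frac m t).
move: (repr _) (repr _) => [a' s'] [m' t'] /= e e'.
apply/fracP; exists (denM u v) => /=.
transitivity ((sval u * (sval s * a')) *: (sval v *: (sval t *: m'))).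
  by rewrite !scalerA; congr (_ *: _); ring.
by rewrite e' e !scalerA; congr (_ *: _); ring.
Qed.

Lemma loc_scaleA a b (v : loc M) :
  loc_scale a (loc_scale b v) = loc_scale (a * b) v.
Proof.
elim/rfrac_ind: a => a s; elim/rfrac_ind: b => b t; elim/frac_ind: v => m r.
rewrite rfracM !loc_scaleE; apply: frac_eq => /=.
by rewrite !scalerA; congr (_ *: _); ring.
Qed.

Lemma loc_scale1 : left_id 1 loc_scale.
Proof.
elim/frac_ind => m r; rewrite -rfrac1 loc_scaleE; apply: frac_eq => /=.
by rewrite !scalerA; congr (_ *: _); ring.
Qed.

Lemma loc_scaleDr : right_distributive loc_scale +%R.
Proof.
elim/rfrac_ind => a s; elim/frac_ind => m t; elim/frac_ind => n r.
rewrite fracD !loc_scaleE fracD; apply: frac_eq => /=.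
by rewrite !scalerDr !scalerA; congr (_ *: _ + _ *: _); ring.
Qed.

Lemma loc_scaleDl v : {morph loc_scale^~ v : a b / a + b}.
Proof.
elim/rfrac_ind => a s; elim/rfrac_ind => b t; elim/frac_ind: v => m r.
rewrite rfracD !loc_scaleE fracD; apply: frac_eq => /=.
rewrite scalerDl !scalerDr !scalerA.
by congr (_ *: _ + _ *: _); ring.
Qed.

HB.instance Definition _ := GRing.Zmodule_isLmodule.Build locRing (loc M)
  loc_scaleA loc_scale1 loc_scaleDr loc_scaleDl.

Lemma fracZ a s (m : M) t : rfrac a s *: frac m t = frac (a *: m) (denM s t).
Proof. exact: loc_scaleE. Qed.

End Scaling.
End Localization.

Section Tilde.
Variables (A : comPzRingType) (M : lmodType A).
Implicit Types U V W : opens (primeSpec A).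

(* The sections over U of the sheaf M~ associated to M: the functions s with
   s(p) in M_p which are locally of the form p |-> m/a. *)
Definition locally_frac U
    (s : forall q : {p : primeSpec A | U p}, loc (sval q) M) : Prop :=
  forall p, U p -> exists V : opens (primeSpec A), V p /\
  exists (m : M) (a : A), forall q : {p : primeSpec A | U p}, V (sval q) ->
    exists h : a \notin (sval q : set A), s q = frac m (Sub a h : den (sval q)).

Record tilde_sec U := TildeSec {
  tval :> forall q : {p : primeSpec A | U p}, loc (sval q) M;
  tvalP : locally_frac tval }.

Lemma tilde_ext U (s t : tilde_sec U) : (forall q, s q = t q) -> s = t.
Proof.
case: s t => [s sP] [t tP] /= e.
have st : s = t by apply: functional_extensionality_dep.
by subst t; congr TildeSec; apply: Prop_irrelevance.
Qed.

Lemma tval_irr U (s : tilde_sec U) p (h k : U p) :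
  s (exist _ p h) = s (exist _ p k) :> loc p M.
Proof. by rewrite (Prop_irrelevance h k). Qed.

HB.instance Definition _ U := gen_eqMixin (tilde_sec U).
HB.instance Definition _ U := gen_choiceMixin (tilde_sec U).

Definition opensT : opens (primeSpec A) := Opens openT.
Definition opensI U V : opens (primeSpec A) :=
  Opens (openI (oset_open U) (oset_open V)).

Section Op.
Variable U : opens (primeSpec A).

Lemma tilde0_subproof : locally_frac (fun q : {p | U p} => 0 : loc (sval q) M).
Proof.
move=> p Up; exists opensT; split => //; exists 0, 1 => q _.
by exists (den1_subproof (sval q)); apply: frac_eq => /=; rewrite !scaler0.
Qed.

Lemma tildeN_subproof (s : tilde_sec U) : locally_frac (fun q => - s q).
Proof.
move=> p /(tvalP s)[V [Vp [m [a h]]]]; exists V; split => //.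
exists (- m), a => q /h[aq ->]; exists aq; exact: fracN.
Qed.

Lemma tildeD_subproof (s t : tilde_sec U) : locally_frac (fun q => s q + t q).
Proof.
move=> p Up; have [V [Vp [m [a h]]]] := tvalP s Up.
have [W [Wp [n [b k]]]] := tvalP t Up.
exists (opensI V W); split => //; exists (b *: m + a *: n), (a * b).
move=> q [/h[aq ->] /k[bq ->]].
exists (denM_subproof (Sub a aq : den (sval q)) (Sub b bq)).
exact: fracD.
Qed.

Definition tilde0 := TildeSec tilde0_subproof.
Definition tildeN s := TildeSec (tildeN_subproof s).
Definition tildeD s t := TildeSec (tildeD_subproof s t).

Lemma tildeDA : associative tildeD.
Proof. by move=> s t u; apply: tilde_ext => q /=; rewrite addrA. Qed.
Lemma tildeDC : commutative tildeD.
Proof. by move=> s t; apply: tilde_ext => q /=; rewrite addrC. Qed.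
Lemma tildeD0 : left_id tilde0 tildeD.
Proof. by move=> s; apply: tilde_ext => q /=; rewrite add0r. Qed.
Lemma tildeDN : left_inverse tilde0 tildeN tildeD.
Proof. by move=> s; apply: tilde_ext => q /=; rewrite addNr. Qed.

HB.instance Definition _ :=
  GRing.isZmodule.Build (tilde_sec U) tildeDA tildeDC tildeD0 tildeDN.

End Op.

Section Restriction.
Variables (U V : opens (primeSpec A)) (VU : V `<=` U).

Definition sub_pt (q : {p : primeSpec A | V p}) : {p : primeSpec A | U p} :=
  exist _ (sval q) (VU (proj2_sig q)).

Lemma tilde_res_subproof (s : tilde_sec U) :
  locally_frac (fun q : {p | V p} => s (sub_pt q)).
Proof.
move=> p /VU /(tvalP s)[W [Wp [m [a h]]]]; exists W; split => //.
exists m, a => q /(h (sub_pt q)) //.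
Qed.

Definition tilde_res (s : tilde_sec U) : tilde_sec V :=
  TildeSec (tilde_res_subproof s).

Lemma tilde_res_zmod : zmod_morphism tilde_res.
Proof. by move=> s t; apply: tilde_ext. Qed.

HB.instance Definition _ :=
  GRing.isZmodMorphism.Build (tilde_sec U) (tilde_sec V) tilde_res
    tilde_res_zmod.

End Restriction.

Lemma tilde_res_id U (UU : U `<=` U) s : tilde_res UU s = s.
Proof. by apply: tilde_ext => -[p Up]; exact: (tval_irr s). Qed.

Lemma tilde_res_comp U V W (VU : V `<=` U) (WV : W `<=` V) (WU : W `<=` U) s :
  tilde_res WV (tilde_res VU s) = tilde_res WU s.
Proof. by apply: tilde_ext => -[p Wp]; exact: (tval_irr s). Qed.

Lemma tilde_sheaf : is_sheaf tilde_res.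
Proof.
move=> U I V VU Vcov s scomp.
have /choice[i iP] : forall q : {p | U p}, exists j, V j (sval q).
  by move=> -[p Up]; apply: Vcov.
have key j1 j2 p (p1 : V j1 p) (p2 : V j2 p) :
    s j1 (exist _ p p1) = s j2 (exist _ p p2).
  pose W := opensI (V j1) (V j2).
  have W1 : W `<=` V j1 by move=> ? [].
  have W2 : W `<=` V j2 by move=> ? [].
  have /(congr1 (fun u : tilde_sec W => u (exist _ p (conj p1 p2)))) /= e :=
    scomp _ _ _ W1 W2.
  exact: (etrans (tval_irr (s j1) p1 (W1 _ (conj p1 p2)))
    (etrans e (tval_irr (s j2) (W2 _ (conj p1 p2)) p2))).
pose t (q : {p | U p}) : loc (sval q) M := s (i q) (exist _ (sval q) (iP q)).
have tP : locally_frac t.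
  move=> p Up; have [j jp] := Vcov p Up.
  have [W [Wp [m [a h]]]] := tvalP (s j) jp.
  exists (opensI (V j) W); split => //; exists m, a => -[q Uq] /= [jq Wq].
  by rewrite /t (key _ j _ _ jq); exact: (h (exist _ q jq) Wq).
exists (TildeSec tP); split.
  move=> j; apply: tilde_ext => -[q jq].
  exact: (key _ j q (iP (sub_pt (VU j) (exist _ q jq))) jq).
move=> t' t's; apply: tilde_ext => -[p Up].
by rewrite /= /t -t's; exact: (tval_irr t').
Qed.

End Tilde.

Section Spec.
Variable A : comPzRingType.
Implicit Types U V W : opens (primeSpec A).

Definition spec_sec U := tilde_sec (A^o) U.

HB.instance Definition _ U := GRing.Zmodule.on (spec_sec U).

Definition sval_at U (s : spec_sec U) (q : {p : primeSpec A | U p}) :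
  locRing (sval q) := tval s q.

Section Op.
Variable U : opens (primeSpec A).

Lemma spec1_subproof :
  locally_frac (fun q : {p | U p} => 1 : locRing (sval q)).
Proof.
move=> p Up; exists (opensT A); split => //; exists 1, 1 => q _.
by exists (den1_subproof (sval q)).
Qed.

Lemma specM_subproof (s t : spec_sec U) :
  locally_frac (fun q => sval_at s q * sval_at t q).
Proof.
move=> p Up; have [V [Vp [m [a h]]]] := tvalP s Up.
have [W [Wp [n [b k]]]] := tvalP t Up.
exists (opensI V W); split => //; exists ((m : A) * n), (a * b).
move=> q [/h[aq e] /k[bq e']].
exists (denM_subproof (Sub a aq : den (sval q)) (Sub b bq)).
rewrite /sval_at e e'; exact: rfracM.
Qed.

Definition spec1 : spec_sec U := TildeSec spec1_subproof.
Definition specM (s t : spec_sec U) : spec_sec U :=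
  TildeSec (specM_subproof s t).

Lemma specMA : associative specM.
Proof. by move=> s t u; apply: tilde_ext => q; apply: (@mulrA (locRing _)). Qed.
Lemma specMC : commutative specM.
Proof. by move=> s t; apply: tilde_ext => q; apply: (@mulrC (locRing _)). Qed.
Lemma specM1 : left_id spec1 specM.
Proof. by move=> s; apply: tilde_ext => q; apply: (@mul1r (locRing _)). Qed.
Lemma specMD : left_distributive specM +%R.
Proof.
by move=> s t u; apply: tilde_ext => q; apply: (@mulrDl (locRing _)).
Qed.

HB.instance Definition _ :=
  GRing.Zmodule_isComPzRing.Build (spec_sec U) specMA specMC specM1 specMD.

End Op.

Definition spec_res U V (VU : V `<=` U) : spec_sec U -> spec_sec V :=
  tilde_res VU.

HB.instance Definition _ U V (VU : V `<=` U) :=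
  GRing.isZmodMorphism.Build (spec_sec U) (spec_sec V) (spec_res VU)
    (tilde_res_zmod VU).

Lemma spec_res_monoid U V (VU : V `<=` U) : monoid_morphism (spec_res VU).
Proof. by split => [|s t]; apply: tilde_ext. Qed.

HB.instance Definition _ U V (VU : V `<=` U) :=
  GRing.isMonoidMorphism.Build (spec_sec U) (spec_sec V) (spec_res VU)
    (spec_res_monoid VU).

Definition Spec : ringedSpace :=
  @RingedSpace (primeSpec A) (fun U => spec_sec U : comPzRingType)
    (fun U V VU => spec_res VU : {rmorphism spec_sec U -> spec_sec V})
    (@tilde_res_id A A^o) (@tilde_res_comp A A^o) (@tilde_sheaf A A^o).

End Spec.

Record omod (X : ringedSpace) := OMod {
  msec : forall U : opens X, lmodType (osec U);
  mres : forall U V : opens X, V `<=` U -> {additive msec U -> msec V};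
  mresZ : forall (U V : opens X) (VU : V `<=` U) (a : osec U) (m : msec U),
    mres VU (a *: m) = ores VU a *: mres VU m;
  mres_id : forall (U : opens X) (UU : U `<=` U) m, mres UU m = m;
  mres_comp : forall (U V W : opens X)
    (VU : V `<=` U) (WV : W `<=` V) (WU : W `<=` U) m,
    mres WV (mres VU m) = mres WU m;
  mres_sheaf : is_sheaf (fun U V VU => mres VU : msec U -> msec V) }.

Arguments mres {X o U V} VU.

Record omod_hom (X : ringedSpace) (M N : omod X) := OModHom {
  hsec :> forall U : opens X, {linear msec M U -> msec N U};
  hres : forall (U V : opens X) (VU : V `<=` U) m,
    hsec V (mres VU m) = mres VU (hsec U m) }.

Definition hom_eq (X : ringedSpace) (M N : omod X) (f g : omod_hom M N) :
    Prop :=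
  forall U m, f U m = g U m.

Section HomComp.
Variables (X : ringedSpace) (L M N : omod X).
Variables (g : omod_hom M N) (f : omod_hom L M).

Definition hom_comp_sec (U : opens X) : {linear msec L U -> msec N U} :=
  g U \o f U.

Lemma hom_comp_res (U V : opens X) (VU : V `<=` U) m :
  hom_comp_sec V (mres VU m) = mres VU (hom_comp_sec U m).
Proof. by rewrite /hom_comp_sec /= !hres. Qed.

Definition hom_comp : omod_hom L N := OModHom hom_comp_res.

End HomComp.

Section TildeModule.
Variables (A : comPzRingType) (M : lmodType A).

Section Scale.
Variable U : opens (primeSpec A).

Lemma tildeZ_subproof (a : spec_sec U) (s : tilde_sec M U) :
  locally_frac (fun q => sval_at a q *: s q).
Proof.
move=> p Up; have [V [Vp [b [c h]]]] := tvalP a Up.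
have [W [Wp [m [d k]]]] := tvalP s Up.
exists (opensI V W); split => //; exists ((b : A) *: m), (c * d).
move=> q [/h[cq e] /k[dq ->]].
exists (denM_subproof (Sub c cq : den (sval q)) (Sub d dq)).
rewrite /sval_at e; exact: fracZ.
Qed.

Definition tildeZ (a : spec_sec U) (s : tilde_sec M U) : tilde_sec M U :=
  TildeSec (tildeZ_subproof a s).

Lemma tildeZA a b s : tildeZ a (tildeZ b s) = tildeZ (a * b) s.
Proof. by apply: tilde_ext => q; apply: scalerA. Qed.
Lemma tildeZ1 : left_id 1 tildeZ.
Proof. by move=> s; apply: tilde_ext => q; apply: scale1r. Qed.
Lemma tildeZDr : right_distributive tildeZ +%R.
Proof. by move=> a s t; apply: tilde_ext => q; apply: scalerDr. Qed.
Lemma tildeZDl s : {morph tildeZ^~ s : a b / a + b}.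
Proof.
by move=> a b; apply: tilde_ext => q; apply: (@scalerDl (locRing _)).
Qed.

HB.instance Definition _ :=
  GRing.Zmodule_isLmodule.Build (spec_sec U) (tilde_sec M U)
    tildeZA tildeZ1 tildeZDr tildeZDl.

End Scale.

Lemma tilde_resZ (U V : opens (primeSpec A)) (VU : V `<=` U)
    (a : spec_sec U) (s : tilde_sec M U) :
  tilde_res VU (a *: s) = spec_res VU a *: tilde_res VU s.
Proof. exact: tilde_ext. Qed.

Definition tilde : omod (Spec A) :=
  @OMod (Spec A) (fun U => tilde_sec M U : lmodType (spec_sec U))
    (fun U V VU => tilde_res VU : {additive tilde_sec M U -> tilde_sec M V})
    tilde_resZ (@tilde_res_id A M) (@tilde_res_comp A M) (@tilde_sheaf A M).

End TildeModule.

Record open_immersion (Y X : ringedSpace) (f : rs_morphism Y X) : Prop :=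
  OpenImmersion {
  oi_inj : injective f;
  oi_open : forall U : opens Y, open (f @` U);
  oi_iso : forall (V : opens X) (U : opens Y) (UV : U `<=` f @^-1` V),
    f @` U = V -> bijective (msharp UV) }.

(* Stalks need not be required to be local rings: being isomorphic to an affine
   scheme near each point, X is automatically a locally ringed space, and an
   isomorphism of ringed spaces onto Spec A is one of locally ringed spaces. *)
Definition is_scheme (X : ringedSpace) : Prop :=
  forall x : X, exists (A : comPzRingType) (f : rs_morphism (Spec A) X),
    open_immersion f /\ range f x.

Record scheme := Scheme { sspace :> ringedSpace; schemeP : is_scheme sspace }.

(* The germ at x of the section s is invertible in the stalk. *)
Definition germ_unit (X : ringedSpace) (x : X) (U : opens X) (s : osec U) :
    Prop :=
  exists (V : opens X) (VU : V `<=` U), V x /\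
  exists t : osec V, t * ores VU s = 1.

(* The ring maps induced on stalks are local: they reflect units. *)
Definition is_local (Y X : ringedSpace) (f : rs_morphism Y X) : Prop :=
  forall (V : opens X) (U : opens Y) (UV : U `<=` f @^-1` V) (s : osec V) y,
    U y -> germ_unit y (msharp UV s) -> germ_unit (f y) s.

Definition is_square (X P : scheme) (p1 p2 : rs_morphism P X) : Prop :=
  is_local p1 /\ is_local p2 /\
  forall (T : scheme) (g1 g2 : rs_morphism T X), is_local g1 -> is_local g2 ->
  exists h : rs_morphism T P,
    [/\ is_local h, rs_eq (rs_comp p1 h) g1, rs_eq (rs_comp p2 h) g2 &
     forall k : rs_morphism T P, is_local k ->
       rs_eq (rs_comp p1 k) g1 -> rs_eq (rs_comp p2 k) g2 -> rs_eq k h].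

(* f is a homeomorphism onto a closed subset, and O_X -> f_* O_Y is a
   surjective map of sheaves. *)
Record closed_immersion (Y X : ringedSpace) (f : rs_morphism Y X) : Prop :=
  ClosedImmersion {
  ci_inj : injective f;
  ci_closed : closed (range f);
  ci_homeo : forall U : opens Y, exists V : opens X, oset U = f @^-1` V;
  ci_surj : forall (V : opens X) (s : osec (mpre f V)) x, V x ->
    exists (W : opens X) (WV : mpre f W `<=` mpre f V), W x /\ W `<=` V /\
    exists t : osec W, msharp (@mpre_sub _ _ f W) t = ores WV s }.

(* As Spec Z is terminal, the fibre product of X with itself over Spec Z is its
   product with itself in the category of schemes. *)
Definition is_separated (X : scheme) : Prop :=
  exists (P : scheme) (p1 p2 : rs_morphism P X) (D : rs_morphism X P),
    [/\ is_square p1 p2, is_local D, rs_eq (rs_comp p1 D) (rs_id X),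
        rs_eq (rs_comp p2 D) (rs_id X) & closed_immersion D].

Definition noetherian_ring (A : comPzRingType) : Prop :=
  forall I : set A,
    I 0 -> (forall a b, I a -> I b -> I (a + b)) ->
    (forall a b, I b -> I (a * b)) ->
  exists (n : nat) (g : 'I_n -> A), (forall i, I (g i)) /\
    forall a, I a -> exists c : 'I_n -> A, a = \sum_(i < n) c i * g i.

Definition is_noetherian (X : scheme) : Prop :=
  cover_compact [set: X] /\
  forall x : X, exists (A : comPzRingType) (f : rs_morphism (Spec A) X),
    [/\ noetherian_ring A, open_immersion f & range f x].

Section Qcoh.
Variable X : scheme.

Section Chart.
Variables (A : comPzRingType) (f : rs_morphism (Spec A) X).
Hypothesis fo : open_immersion f.

Definition oi_image (U : opens (Spec A)) : opens X := Opens (oi_open fo U).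

Lemma oi_image_sub (U : opens (Spec A)) : U `<=` f @^-1` oi_image U.
Proof. exact: preimage_image. Qed.

Lemma oi_imageS (U V : opens (Spec A)) :
  V `<=` U -> oi_image V `<=` oi_image U.
Proof. exact: image_subset. Qed.

(* psi is an isomorphism from the restriction of F to Spec A, along f, to M~. *)
Definition restr_iso_tilde (F : omod X) (M : lmodType A) : Prop :=
  exists psi : forall U : opens (Spec A),
    msec F (oi_image U) -> msec (tilde M) U,
  [/\ forall U, bijective (psi U),
      forall U s t, psi U (s + t) = psi U s + psi U t,
      forall U (a : osec (oi_image U)) s,
        psi U (a *: s) = msharp (@oi_image_sub U) a *: psi U s &
      forall (U V : opens (Spec A)) (VU : V `<=` U) s,
        psi V (mres (oi_imageS VU) s) = mres VU (psi U s)].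

End Chart.

Definition is_qcoh (F : omod X) : Prop :=
  forall x : X, exists (A : comPzRingType) (f : rs_morphism (Spec A) X)
    (fo : open_immersion f) (M : lmodType A),
    range f x /\ restr_iso_tilde fo F M.

Record qcoh := Qcoh { qsheaf :> omod X; qcohP : is_qcoh qsheaf }.

Definition is_mono (M N : qcoh) (f : omod_hom M N) : Prop :=
  forall (L : qcoh) (u v : omod_hom L M),
    hom_eq (hom_comp f u) (hom_comp f v) -> hom_eq u v.

Definition is_injective (E : qcoh) : Prop :=
  forall (M N : qcoh) (i : omod_hom M N) (g : omod_hom M E), is_mono i ->
  exists h : omod_hom N E, hom_eq (hom_comp h i) g.

Record complex := Complex {
  cobj :> int -> qcoh;
  cdiff : forall n : int, omod_hom (cobj n) (cobj (n + 1));
  cdiff2 : forall n U m, cdiff (n + 1) U (cdiff n U m) = 0 }.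

Record chain_map (C D : complex) := ChainMap {
  cmap :> forall n : int, omod_hom (C n) (D n);
  cmap_diff : forall n,
    hom_eq (hom_comp (cmap (n + 1)) (cdiff C n))
           (hom_comp (cdiff D n) (cmap n)) }.

(* Kernels and images in Qcoh X are those of sheaves of modules, so exactness
   means that every cocycle is locally a coboundary. *)
Definition acyclic (C : complex) : Prop :=
  forall (n : int) (U : opens X) (s : msec (C (n + 1)) U),
    cdiff C (n + 1) U s = 0 ->
  forall x, U x -> exists (V : opens X) (VU : V `<=` U), V x /\
  exists t : msec (C n) V, cdiff C n V t = mres VU s.

Definition is_product (I : Type) (C : I -> complex) (P : complex)
    (pr : forall i, chain_map P (C i)) : Prop :=
  forall (Q : complex) (q : forall i, chain_map Q (C i)),
  exists u : chain_map Q P,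
    (forall i n, hom_eq (hom_comp (pr i n) (u n)) (q i n)) /\
    forall v : chain_map Q P,
      (forall i n, hom_eq (hom_comp (pr i n) (v n)) (q i n)) ->
      forall n, hom_eq (v n) (u n).

End Qcoh.

(* Main.v *)
Require Import Defs.
From mathcomp Require Import all_boot all_algebra.
From mathcomp Require Import all_classical topology.
From HB Require Import structures.
From mathcomp Require Import ring.
Import Defs.

Set Implicit Arguments.
Unset Strict Implicit.
Unset Printing Implicit Defensive.

Import GRing.Theory.
Local Open Scope classical_set_scope.
Local Open Scope ring_scope.

(** The product of complexes in quasi-coherent sheaves is not computed on
    sections over opens, so exactness of the factors says nothing directly about
    exactness of the product. The argument compares the product with products
    that are computed on sections over a chart.

    Let U_1, ..., U_n be affine opens covering X, let U_S be the intersection of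
    the U_g for g in S (so that U_S = X for S empty), and for a sheaf F let F_S
    be the direct image on X of its restriction to U_S. For each S let Pi_S be
    the degreewise product, in Qcoh X, of the complexes (C_i)_S.

    - For S nonempty, the complex Pi_S is exact over every chart
      (column_exact). Choose g in S; the sheaves (C_i)_S are direct images from
      the affine U_g, and their product in Qcoh X is the direct image of the
      sheaf of the product of their modules of sections over U_g
      (chart_product). So over U_g the sections of Pi_S are the products of the
      sections of the C_i over U_S. These are exact because the intersections of
      charts of a separated scheme are affine (separated_inter_affine_like,
      acyclic_inter).

    - In each degree the restrictions F -> F_g, for F injective, have a common
      retraction: F embeds into the sum of the F_g, hence is a direct summand of
      it (injective_retract). This gives maps rho_g : F_g -> F with
      sum_g rho_g(s|U_g) = s. The products over i of their restrictions to the U_S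
      are maps from Pi_(S + g) to Pi_S in each degree, which need not commute with
      the differential. They make the Cech complex
      Pi_empty -> sum_g Pi_g -> sum_(g,h) Pi_gh -> ... contractible in each degree
      (homot_delta).

    - So the double complex formed by the Pi_S, which is bounded in the
      direction of S, has exact rows, and its columns are exact except possibly
      the one at the empty set; hence this one is exact as well (cube_exact).
      It is the product of the C_i, since a product of complexes is a product in
      each degree: the maps from a sheaf Q to the terms of a complex are the maps
      to the complex from the complex id : Q -> Q (degreewise_product).

    Quasi-coherence is handled through a criterion valid on noetherian schemes:
    F is quasi-coherent iff, for all opens U and functions a on U, the sections
    of F over the locus U_a where a is a unit are the localization of F(U) at a
    (localizing_qcoh, qcoh_localizing). It is visibly inherited by
    restrictions, direct images and finite products. The affineness of the
    intersections of charts is only used to lift sections along a map of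
    quasi-coherent sheaves, and is put in terms of ideals of functions
    (affine_like). *)

(** * Open sets and sheaves of sections *)

Section Opens.
Variable T : topologicalType.

Definition capo (U V : opens T) : opens T :=
  Opens (openI (oset_open U) (oset_open V)).
Definition cupo (U V : opens T) : opens T :=
  Opens (openU (oset_open U) (oset_open V)).
Definition botO : opens T := Opens (@open0 T).
Definition topO : opens T := Opens (@openT T).

Lemma capoL (U V : opens T) : capo U V `<=` U. Proof. by move=> x []. Qed.
Lemma capoR (U V : opens T) : capo U V `<=` V. Proof. by move=> x []. Qed.
Lemma capoS (U V U' V' : opens T) :
  U' `<=` U -> V' `<=` V -> capo U' V' `<=` capo U V.
Proof. by move=> UU VV x [/UU ? /VV ?]. Qed.
Lemma cupoL (U V : opens T) : U `<=` cupo U V. Proof. by move=> x; left. Qed.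
Lemma cupoR (U V : opens T) : V `<=` cupo U V. Proof. by move=> x; right. Qed.

End Opens.

Section SheafLemmas.
Variables (T : topologicalType) (F : opens T -> Type).
Variable r : forall U V : opens T, V `<=` U -> F U -> F V.
Hypothesis r_comp : forall (U V W : opens T)
  (VU : V `<=` U) (WV : W `<=` V) (WU : W `<=` U) s, r WV (r VU s) = r WU s.
Hypothesis sh : is_sheaf r.

Lemma sheaf_sep (U : opens T) (s t : F U) :
  (forall x, U x -> exists (V : opens T) (VU : V `<=` U),
     V x /\ r VU s = r VU t) -> s = t.
Proof.
move=> loc.
have /choice[V hV] : forall x : {x | U x}, exists V : opens T,
    exists VU : V `<=` U, V (sval x) /\ r VU s = r VU t.
  by move=> [x Ux]; apply: loc.
have VU x : V x `<=` U by case: (hV x).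
have e x : r (VU x) s = r (VU x) t.
  by have [VU' [_ e]] := hV x; rewrite (Prop_irrelevance (VU x) VU').
have cov x : U x -> exists i, V i x.
  by move=> Ux; exists (exist _ x Ux); have [? []] := hV (exist _ x Ux).
have [|u [_ uu]] := sh VU cov (s := fun i => r (VU i) s).
  by move=> i j W Wi Wj; rewrite !(r_comp _ _ (subset_trans Wi (VU i))).
by rewrite -(uu s) // -(uu t).
Qed.

(** Gluing along a property Phi instead of an indexed family: any two sections
    with this property agree on overlaps, as it passes to smaller opens and
    determines the section. *)
Lemma sheaf_glue (U : opens T) (Phi : forall V : opens T, F V -> Prop) :
  (forall (V W : opens T) (WV : W `<=` V) t, V `<=` U -> Phi V t ->
     Phi W (r WV t)) ->
  (forall (V : opens T) t t', V `<=` U -> Phi V t -> Phi V t' -> t = t') ->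
  (forall x, U x -> exists V : opens T, [/\ V `<=` U, V x & exists t, Phi V t]) ->
  exists t : F U, forall (V : opens T) (VU : V `<=` U) t', Phi V t' -> r VU t = t'.
Proof.
move=> stab uniq loc.
have /choice[V hV] : forall x : {x | U x}, exists V : opens T,
    [/\ V `<=` U, V (sval x) & exists t, Phi V t].
  by move=> [x Ux]; apply: loc.
have VU x : V x `<=` U by case: (hV x).
have hs x : exists t, Phi (V x) t by case: (hV x).
pose s x := sval (cid (hs x)).
have sP x : Phi (V x) (s x) by rewrite /s; case: (cid (hs x)).
have cov x : U x -> exists i, V i x.
  by move=> Ux; exists (exist _ x Ux); case: (hV (exist _ x Ux)).
have [|t [tE _]] := sh VU cov (s := s).
  move=> i j W Wi Wj; apply: uniq; first exact: subset_trans Wi (VU i).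
    exact: stab.
  exact: stab.
exists t => W WU t' Pt'; apply: sheaf_sep => x Wx.
have [i Vx] := cov x (WU x Wx).
exists (capo W (V i)), (@capoL _ _ _); split => //.
rewrite (r_comp _ _ (subset_trans (@capoL _ W (V i)) WU)).
rewrite -(r_comp (VU i) (@capoR _ W (V i))) tE.
apply: uniq; first exact: subset_trans (@capoR _ _ _) (VU i).
  exact: stab.
exact: stab.
Qed.

End SheafLemmas.

Lemma open_nbhd_cover (T : topologicalType) (A : set T) :
  (forall x, A x -> exists V : opens T, V x /\ V `<=` A) -> open A.
Proof.
move=> h; rewrite openE => x /h[V [Vx VA]].
by apply: (filterS VA); apply: open_nbhs_nbhs; split => //; apply: oset_open.
Qed.

(** * Units and unit loci *)

Section RingedSpaces.
Variable X : ringedSpace.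
Implicit Types (U V W : opens X).

Lemma ores_irr U V (h k : V `<=` U) (s : osec U) : ores h s = ores k s.
Proof. by rewrite (Prop_irrelevance h k). Qed.

Lemma oresE U V W (VU : V `<=` U) (WV : W `<=` V) (s : osec U) :
  ores WV (ores VU s) = ores (subset_trans WV VU) s.
Proof. exact: ores_comp. Qed.

Lemma osec_sep U (s t : osec U) :
  (forall x, U x -> exists V (VU : V `<=` U), V x /\ ores VU s = ores VU t) ->
  s = t.
Proof. exact: (sheaf_sep (@ores_comp X) (@ores_sheaf X)). Qed.

Definition osec_glue := sheaf_glue (@ores_comp X) (@ores_sheaf X).

Lemma germ_unit_res x U V (VU : V `<=` U) (a : osec U) :
  V x -> germ_unit x a -> germ_unit x (ores VU a).
Proof.
move=> Vx [W [WU [Wx [t e]]]].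
exists (capo V W), (@capoL _ _ _); split => //.
exists (ores (@capoR _ V W) t).
rewrite oresE (ores_irr _ (subset_trans (@capoR _ V W) WU)) -oresE.
by rewrite -rmorphM e rmorph1.
Qed.

Lemma germ_unit_res_inv x U V (VU : V `<=` U) (a : osec U) :
  germ_unit x (ores VU a) -> germ_unit x a.
Proof.
move=> [W [WV [Wx [t e]]]]; exists W, (subset_trans WV VU); split => //.
by exists t; rewrite -oresE.
Qed.

Definition uset U (a : osec U) : set X := [set x | U x /\ germ_unit x a].

Lemma uset_open U (a : osec U) : open (uset a).
Proof.
apply: open_nbhd_cover => x [Ux [V [VU [Vx [t e]]]]]; exists V; split => //.
move=> y Vy; split; first exact: (VU y).
by exists V, VU; split => //; exists t.
Qed.

Definition uloc U (a : osec U) : opens X := Opens (@uset_open U a).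

Lemma uloc_sub U (a : osec U) : uloc a `<=` U. Proof. by move=> x []. Qed.

Lemma uset_res U V (VU : V `<=` U) (a : osec U) x :
  uset (ores VU a) x <-> V x /\ uset a x.
Proof.
split => [[Vx g]|[Vx [Ux g]]].
  by split=> //; split; [exact: (VU x)|exact: germ_unit_res_inv g].
by split=> //; exact: germ_unit_res.
Qed.

(** Inverses are unique, so the inverses of the germs glue. *)
Lemma unit_on U V (VU : V `<=` U) (a : osec U) :
  V `<=` uset a -> exists t : osec V, t * ores VU a = 1.
Proof.
move=> Va.
have [||| t tP] := @osec_glue V
  (fun W t => exists WU : W `<=` U, t * ores WU a = 1).
- move=> W W' WW t WV [WU e]; exists (subset_trans WW WU).
  by rewrite -oresE -rmorphM e rmorph1.
- move=> W t t' WV [WU e] [WU' e'].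
  rewrite (ores_irr WU' WU) in e'.
  by rewrite -[t]mulr1 -e' mulrCA e mulr1.
- move=> x Vx; have [Ux [W [WU [Wx [t e]]]]] := Va x Vx.
  exists (capo V W); split => //; first exact: capoL.
  exists (ores (@capoR _ V W) t), (subset_trans (@capoR _ V W) WU).
  by rewrite -oresE -rmorphM e rmorph1.
exists t; apply: osec_sep => x Vx.
have [Ux [W [WU [Wx [u e]]]]] := Va x Vx.
exists (capo V W), (@capoL _ _ _); split => //.
rewrite rmorphM rmorph1 (tP _ (@capoL _ V W) (ores (@capoR _ V W) u)).
  rewrite oresE (ores_irr _ (subset_trans (@capoR _ V W) WU)) -oresE.
  by rewrite -rmorphM e rmorph1.
exists (subset_trans (@capoR _ V W) WU).
by rewrite -oresE -rmorphM e rmorph1.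
Qed.

End RingedSpaces.

Section Omod.
Variables (X : ringedSpace) (F : omod X).
Implicit Types (U V W : opens X).

Lemma mres_irr U V (h k : V `<=` U) (s : msec F U) : mres h s = mres k s.
Proof. by rewrite (Prop_irrelevance h k). Qed.

Lemma mresE U V W (VU : V `<=` U) (WV : W `<=` V) (s : msec F U) :
  mres WV (mres VU s) = mres (subset_trans WV VU) s.
Proof. exact: mres_comp. Qed.

Lemma omod_sep U (s t : msec F U) :
  (forall x, U x -> exists V (VU : V `<=` U), V x /\ mres VU s = mres VU t) ->
  s = t.
Proof. exact: (sheaf_sep (@mres_comp X F) (@mres_sheaf X F)). Qed.

Definition omod_glue := sheaf_glue (@mres_comp X F) (@mres_sheaf X F).

Lemma omod_glue2 U (A B : opens X) (AU : A `<=` U) (BU : B `<=` U) (s : msec F A) (t : msec F B) :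
  U `<=` A `|` B ->
  mres (@capoL _ A B) s = mres (@capoR _ A B) t ->
  exists u : msec F U, mres AU u = s /\ mres BU u = t.
Proof.
move=> cov e.
pose O (b : bool) := if b then A else B.
have OU b : O b `<=` U by case: b.
have [||u [uP _]] := @mres_sheaf X F U bool O OU _
    (fun b => if b return msec F (O b) then s else t) _.
- by move=> x /cov[Ax|Bx]; [exists true|exists false].
- move=> [] [] W Wi Wj; first exact: mres_irr.
  + have WI : W `<=` capo A B by move=> x Wx; split; [exact: Wi|exact: Wj].
    rewrite (mres_irr Wi (subset_trans WI (@capoL _ A B))) -mresE e mresE.
    exact: mres_irr.
  + have WI : W `<=` capo A B by move=> x Wx; split; [exact: Wj|exact: Wi].
    rewrite (mres_irr Wj (subset_trans WI (@capoL _ A B))) -mresE e mresE.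
    exact: mres_irr.
  + exact: mres_irr.
exists u; split.
  by rewrite -(uP true); exact: mres_irr.
by rewrite -(uP false); exact: mres_irr.
Qed.

Lemma unit_scaleI U V (VU : V `<=` U) (a : osec U) (s t : msec F V) :
  V `<=` uset a -> ores VU a *: s = ores VU a *: t -> s = t.
Proof.
move=> /(unit_on VU)[u e] h.
by rewrite -[s]scale1r -[t]scale1r -e -!scalerA h.
Qed.

End Omod.

(** * Noetherian spaces and localization of sections *)

(** All opens are quasi-compact, put as an induction principle: a property of
    opens which is inherited by smaller opens and by unions of two holds as
    soon as it holds locally. *)
Definition noeth_top (Y : topologicalType) : Prop :=
  forall Phi : opens Y -> Prop,
  Phi (botO Y) -> (forall A B, Phi A -> Phi B -> Phi (cupo A B)) ->
  (forall A B : opens Y, A `<=` B -> Phi B -> Phi A) ->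
  forall W : opens Y, (forall x, W x -> exists V : opens Y, V x /\ Phi V) -> Phi W.

Section LocalizationProperty.
Variables (X : ringedSpace) (F : omod X).
Implicit Types (U V W : opens X).

(** Here and below V is the locus where a is a unit, kept as an independent
    variable so that restriction maps can be used with any presentation of this
    open set. *)
Definition torsion_off_uloc : Prop :=
  forall U V (VU : V `<=` U) (a : osec U) (s : msec F U),
  uset a `<=` V -> mres VU s = 0 -> exists k, a ^+ k *: s = 0.

Definition extends_off_uloc : Prop :=
  forall U V (VU : V `<=` U) (a : osec U) (t : msec F V),
  V `<=` uset a -> uset a `<=` V ->
  exists k (s : msec F U), mres VU s = ores VU (a ^+ k) *: t.

(** F(U_a) is the localization of F(U) at a: a section which vanishes on U_a is
    killed by a power of a, and a section over U_a extends to U after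
    multiplication by a power of a. On a noetherian scheme this characterizes
    quasi-coherence. *)
Definition localizing : Prop := torsion_off_uloc /\ extends_off_uloc.

Hypothesis nX : noeth_top X.

(** By quasi-compactness finitely many powers of a suffice, one for each of the
    opens on which the section is known to be killed. *)
Lemma torsion_local :
  (forall U V (VU : V `<=` U) (a : osec U) (s : msec F U),
    uset a `<=` V -> mres VU s = 0 -> forall x, U x ->
    exists W (WU : W `<=` U), W x /\ exists k, ores WU (a ^+ k) *: mres WU s = 0) ->
  torsion_off_uloc.
Proof.
move=> loc U V VU a s aV s0.
pose Phi (B : opens X) := exists k, forall W (WU : W `<=` U), W `<=` B ->
  ores WU (a ^+ k) *: mres WU s = 0.
have : Phi U.
  apply: nX.
  - exists 0%N => W WU W0; apply: omod_sep => x /W0; by [].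
  - move=> A B [k kP] [l lP]; exists (k + l)%N => W WU WAB.
    apply: omod_sep => x Wx.
    have [Ax|Bx] := WAB x Wx.
      exists (capo W A), (@capoL _ _ _); split => //.
      rewrite mresZ raddf0 oresE mresE exprD mulrC rmorphM -scalerA.
      by rewrite (kP _ _ (@capoR _ _ _)) scaler0.
    exists (capo W B), (@capoL _ _ _); split => //.
    rewrite mresZ raddf0 oresE mresE exprD rmorphM -scalerA.
    by rewrite (lP _ _ (@capoR _ _ _)) scaler0.
  - move=> A B AB [k kP]; exists k => W WU WA; apply: kP.
    exact: subset_trans WA AB.
  move=> x Ux; have [W [WU [Wx [k kP]]]] := loc U V VU a s aV s0 x Ux.
  exists W; split => //; exists k => W' W'U W'W.
  rewrite (mres_irr _ (subset_trans W'W WU)) (ores_irr _ (subset_trans W'W WU)).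
  by rewrite -mresE -oresE -mresZ kP raddf0.
move=> [k /(_ U (@subset_refl _ _) (@subset_refl _ _))].
by rewrite ores_id mres_id => ?; exists k.
Qed.

(** Multiples of t by powers of a which extend to A and to B agree on the
    intersection up to a section vanishing where a is a unit, which a further
    power kills; so they glue. *)
Lemma extends_local :
  torsion_off_uloc ->
  (forall U V (VU : V `<=` U) (a : osec U) (t : msec F V),
    V `<=` uset a -> uset a `<=` V -> forall x, U x ->
    exists W (WU : W `<=` U), W x /\ exists k (s : msec F W),
      mres (@capoL _ W V) s =
      ores (subset_trans (@capoL _ W V) WU) (a ^+ k) *: mres (@capoR _ W V) t) ->
  extends_off_uloc.
Proof.
move=> tor loc U V VU a t Va aV.
pose Phi (B : opens X) := exists k (s : msec F (capo U B)),
  mres (@capoL _ (capo U B) V) s =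
  ores (subset_trans (@capoL _ (capo U B) V) (@capoL _ U B)) (a ^+ k)
    *: mres (@capoR _ (capo U B) V) t.
have : Phi U.
  apply: nX.
  - exists 0%N, 0; apply: omod_sep => x [[_ []]].
  - move=> A B [k [s sP]] [l [u uP]].
    pose D := capo (capo U A) (capo U B).
    have DU : D `<=` U by move=> x [[]].
    have DAV : capo D V `<=` capo (capo U A) V by apply: capoS; [exact: capoL|].
    have DBV : capo D V `<=` capo (capo U B) V by apply: capoS; [exact: capoR|].
    pose s' := ores (@capoL _ U A) (a ^+ l) *: s.
    pose u' := ores (@capoL _ U B) (a ^+ k) *: u.
    have s'P : mres (subset_trans DAV (@capoL _ (capo U A) V)) s' =
        ores (subset_trans (@capoL _ D V) DU) (a ^+ (k + l)) *: mres (@capoR _ D V) t.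
      rewrite mresZ -(mresE _ DAV) sP mresZ scalerA oresE !mresE oresE exprD mulrC rmorphM.
      by congr (_ * _ *: _); [exact: ores_irr|exact: ores_irr|exact: mres_irr].
    have u'P : mres (subset_trans DBV (@capoL _ (capo U B) V)) u' =
        ores (subset_trans (@capoL _ D V) DU) (a ^+ (k + l)) *: mres (@capoR _ D V) t.
      rewrite mresZ -(mresE _ DBV) uP mresZ scalerA oresE !mresE oresE exprD rmorphM.
      by congr (_ * _ *: _); [exact: ores_irr|exact: ores_irr|exact: mres_irr].
    have [K KP] : exists K, ores DU a ^+ K *:
        (mres (@capoL _ (capo U A) (capo U B)) s' -
         mres (@capoR _ (capo U A) (capo U B)) u') = 0.
      apply: (tor D (capo D V) (@capoL _ _ _)).
        by move=> x /uset_res[Dx /aV Vx]; split.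
      rewrite raddfB !mresE (mres_irr _ (subset_trans DAV (@capoL _ (capo U A) V))).
      rewrite s'P (mres_irr _ (subset_trans DBV (@capoL _ (capo U B) V))) u'P.
      exact: subrr.
    have AU : capo U A `<=` capo U (cupo A B) by apply: capoS => //; exact: cupoL.
    have BU : capo U B `<=` capo U (cupo A B) by apply: capoS => //; exact: cupoR.
    have [||v [vA vB]] := @omod_glue2 _ F (capo U (cupo A B)) _ _ AU BU
      (ores (@capoL _ U A) (a ^+ K) *: s') (ores (@capoL _ U B) (a ^+ K) *: u').
    + by move=> x [Ux [Ax|Bx]]; [left|right].
    + apply/eqP; rewrite -subr_eq0; apply/eqP.
      rewrite (mresZ _ _ s') (mresZ _ _ u') !oresE -[RHS]KP scalerBr -rmorphXn.
      by congr (_ *: _ - _ *: _); exact: ores_irr.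
    exists (K + (k + l))%N, v; apply: omod_sep => x [[Ux ABx] Vx].
    case: ABx => [Ax|Bx].
      have WA : capo (capo U A) V `<=` capo (capo U (cupo A B)) V by exact: capoS.
      exists (capo (capo U A) V), WA; split => //.
      rewrite mresE (mres_irr _ (subset_trans (@capoL _ (capo U A) V) AU)).
      rewrite -mresE vA (mresZ _ _ s') /s' !mresZ sP !scalerA !oresE !mresE !exprD !rmorphM.
      rewrite -mulrA [X in _ * X]mulrC.
      by congr (_ * (_ * _) *: _); [exact: ores_irr..|exact: mres_irr].
    have WB : capo (capo U B) V `<=` capo (capo U (cupo A B)) V by exact: capoS.
    exists (capo (capo U B) V), WB; split => //.
    rewrite mresE (mres_irr _ (subset_trans (@capoL _ (capo U B) V) BU)).
    rewrite -mresE vB (mresZ _ _ u') /u' !mresZ uP !scalerA !oresE !mresE !exprD !rmorphM.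
    rewrite -mulrA.
    by congr (_ * (_ * _) *: _); [exact: ores_irr..|exact: mres_irr].
  - move=> A B AB [k [s sP]]; exists k.
    have AB' : capo U A `<=` capo U B by exact: capoS.
    exists (mres AB' s).
    have AB2 : capo (capo U A) V `<=` capo (capo U B) V by exact: capoS.
    rewrite mresE (mres_irr _ (subset_trans AB2 (@capoL _ (capo U B) V))) -mresE sP.
    by rewrite mresZ oresE mresE; congr (_ *: _); [exact: ores_irr|exact: mres_irr].
  move=> x Ux; have [W [WU [Wx [k [s sP]]]]] := loc U V VU a t Va aV x Ux.
  exists W; split => //; exists k, (mres (@capoR _ U W) s).
  have WW : capo (capo U W) V `<=` capo W V by apply: capoS => //; exact: capoR.
  rewrite mresE (mres_irr _ (subset_trans WW (@capoL _ W V))) -mresE sP.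
  by rewrite mresZ oresE mresE; congr (_ *: _); [exact: ores_irr|exact: mres_irr].
move=> [k [s sP]].
have UU : U `<=` capo U U by move=> x; split.
have VV : V `<=` capo (capo U U) V by move=> x Vx; split => //; apply: UU; exact: (VU x).
exists k, (mres UU s).
rewrite mresE (mres_irr _ (subset_trans VV (@capoL _ (capo U U) V))) -mresE sP.
rewrite mresZ oresE mresE (mres_irr _ (@subset_refl _ _)) mres_id.
by congr (_ *: _); exact: ores_irr.
Qed.

End LocalizationProperty.

(** * Prime ideals and sections of the sheaf of a module *)

Section PrimeExistence.
Variable A : comPzRingType.

Record is_ideal (J : set A) : Prop := IsIdeal {
  ideal0 : J 0;
  idealD : forall a b, J a -> J b -> J (a + b);
  idealM : forall a b, J b -> J (a * b) }.

(** Krull: an ideal which is maximal among those that contain J and no power of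
    g is prime. *)
Lemma prime_avoiding (J : set A) (g : A) : is_ideal J ->
  (forall k, ~ J (g ^+ k)) -> exists p : primeSpec A, J `<=` p /\ ~ p g.
Proof.
move=> iJ Jg.
(* The union with J makes the empty chain harmless. *)
pose P (S : set A) := is_ideal (S `|` J) /\ forall k, ~ (S `|` J) (g ^+ k).
have [|S [[iS Sg] Smax]] := @Zorn_bigcup A P.
  move=> C CP Ctot; split; last first.
    by move=> k [[S CS Sk]|]; [have [_ /(_ k)] := CP S CS; apply; left|exact: Jg].
  split.
  - by right; exact: (ideal0 iJ).
  - move=> a b [[S CS Sa]|Ja] [[S' CS' Sb]|Jb].
    + have [SS|SS] := Ctot S S' CS CS'.
        have [iS _] := CP S' CS'.
        have [] := idealD iS (or_introl (SS a Sa)) (or_introl Sb).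
          by left; exists S'.
        by right.
      have [iS _] := CP S CS.
      have [] := idealD iS (or_introl Sa) (or_introl (SS b Sb)).
        by left; exists S.
      by right.
    + have [iS _] := CP S CS.
      by have [] := idealD iS (or_introl Sa) (or_intror Jb); [left; exists S|right].
    + have [iS _] := CP S' CS'.
      by have [] := idealD iS (or_intror Ja) (or_introl Sb); [left; exists S'|right].
    + by right; exact: idealD.
  - move=> a b [[S CS Sb]|Jb]; last by right; exact: idealM.
    have [iS _] := CP S CS.
    by have [] := idealM iS a (or_introl Sb); [left; exists S|right].
pose K := S `|` J.
have K1 : ~ K 1 by rewrite -(expr0 g); exact: Sg.
pose Kx (a : A) : set A := [set x | exists2 y, K y & exists r, x = y + r * a].
have KKx a : K `<=` Kx a by move=> x Kxx; exists x => //; exists 0; ring.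
have iKx a : is_ideal (Kx a).
  split.
  - by apply: KKx; exact: (ideal0 iS).
  - move=> _ _ [x Sx [r ->]] [y Sy [t ->]]; exists (x + y); first exact: (idealD iS Sx Sy).
    by exists (r + t); ring.
  - move=> b _ [x Sx [r ->]]; exists (b * x); first exact: (idealM iS _ Sx).
    by exists (b * r); ring.
have pow a : ~ K a -> exists k, Kx a (g ^+ k).
  move=> nKa; apply: contrapT => /forallNP nk.
  have JKx : Kx a `|` J = Kx a.
    by apply/setUidl => x Jx; apply: KKx; right.
  apply: (Smax (Kx a)); last by split; rewrite JKx.
  split; first by move=> x Sx; apply: KKx; left.
  move=> sub; apply: nKa; left; apply: sub; exists 0; first exact: (ideal0 iS).
  by exists 1; ring.
have prime a b : K (a * b) -> K a \/ K b.
  move=> Kab; apply: contrapT => /not_orP[/pow[k [x Kx1 [r e1]]] /pow[l [y Ky [t e2]]]].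
  apply: (Sg (k + l)%N); rewrite exprD e1 e2.
  have -> : (x + r * a) * (y + t * b) = (y + t * b) * x + r * a * y + r * t * (a * b).
    by ring.
  apply: (idealD iS); last exact: (idealM iS _ Kab).
  by apply: (idealD iS); apply: (idealM iS).
exists (PrimeSpec (ideal0 iS) (idealD iS) (idealM iS) K1 prime).
split; first by move=> x Jx; right.
by rewrite -(expr1 g); exact: Sg.
Qed.

Definition basic_set (g : A) : set (primeSpec A) := [set p : primeSpec A | ~ p g].

Lemma basic_open (g : A) : open (basic_set g).
Proof.
have -> : basic_set g = [set p : primeSpec A | ~ [set g] `<=` p].
  apply/seteqP; split => p /= h.
    by move=> gp; apply: h; exact: (gp g).
  by move=> pg; apply: h => _ ->.
by exists [set g].
Qed.

Definition basic (g : A) : opens (primeSpec A) := Opens (@basic_open g).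

Lemma basic_nbhd (U : opens (primeSpec A)) p : U p ->
  exists g, ~ p g /\ basic g `<=` U.
Proof.
have [E UE] := oset_open U; rewrite UE /= => /existsNP[g /not_implyP[Eg pg]].
by exists g; split => // q /= qg; apply: contra_not qg; apply.
Qed.

Lemma basicM (g h : A) p : basic (g * h) p <-> basic g p /\ basic h p.
Proof.
split => /=.
  move=> gh; split; apply: contra_not gh => ?; last exact: pidealM.
  by rewrite mulrC; exact: pidealM.
by move=> [pg ph] /pideal_prime[].
Qed.

Lemma basicX (g : A) k p : basic g p -> basic (g ^+ k) p.
Proof.
move=> pg; elim: k => [|k IH]; first by rewrite expr0; exact: pideal1.
by rewrite exprS; apply/basicM.
Qed.

Lemma basic_denP (p : primeSpec A) (g : A) : basic g p -> g \notin (p : set A).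
Proof. by rewrite notin_setE. Qed.

Lemma den_basic (p : primeSpec A) (u : den p) : basic (sval u) p.
Proof. by have := valP u; rewrite notin_setE. Qed.

(** The a such that Phi holds on D(a) form an ideal. If g_1, ..., g_n generate
    it, W lies in the union of the D(g_i). *)
Lemma noetherian_spec : noetherian_ring A -> noeth_top (primeSpec A).
Proof.
move=> nA Phi P0 PU PS W loc.
pose J := [set a | Phi (basic a)].
have [||| n [g [Jg gen]]] := nA J.
- apply: PS P0 => p /=; apply; exact: pideal0.
- move=> a b Ja Jb; apply: PS (PU _ _ Ja Jb) => p /= pab.
  apply: contrapT => /not_orP[/contrapT pa /contrapT pb].
  by apply: pab; exact: pidealD.
- by move=> a b; apply: PS => p /basicM[].
have fin m (h : 'I_m -> A) : (forall i, J (h i)) ->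
    exists B, Phi B /\ forall i, basic (h i) `<=` B.
  elim: m h => [|m IH] h Jh; first by exists (botO _); split => // -[].
  have [|B [PB hB]] := IH (fun i => h (lift ord0 i)); first by [].
  exists (cupo (basic (h ord0)) B); split; first exact: (PU _ _ (Jh _) PB).
  move=> i; case: (unliftP ord0 i) => [j ->|->]; last by left.
  by move=> p /hB ?; right.
have [B [PB gB]] := fin n g Jg.
apply: (PS _ _ _ PB) => p Wp; have [V [Vp PV]] := loc p Wp.
have [e [pe eV]] := basic_nbhd Vp.
have [c ec] := gen e (PS _ _ eV PV).
apply: contrapT => nB; apply: pe; rewrite ec.
apply: (big_ind (fun x => (p : set A) x)) => [||i _]; first exact: pideal0.
  exact: pidealD.
by apply: pidealM; apply: contrapT => /gB.
Qed.

End PrimeExistence.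

Arguments den_basic {A p} u.

Section Fractions.
Variables (A : comPzRingType) (M : lmodType A).
Implicit Types (U V W : opens (primeSpec A)) (p : primeSpec A).

Lemma frac_eq0 p (m : M) (s : den p) :
  frac m s = 0 <-> exists u : den p, sval u *: m = 0.
Proof.
split.
  by move=> /fracP[u /= e]; exists u; move: e; rewrite scale1r !scaler0.
by move=> [u e]; apply/fracP; exists u; rewrite /= scale1r !scaler0.
Qed.

Definition denX p (s : den p) k : den p :=
  Sub (sval s ^+ k) (basic_denP (@basicX A _ k p (den_basic s))).

Lemma rfracX p (a : A) (s : den p) k :
  rfrac a s ^+ k = rfrac (a ^+ k) (denX s k).
Proof.
elim: k => [|k IH]; first by apply: rfrac_eq; rewrite /= !expr0.
by rewrite exprS IH rfracM; apply: rfrac_eq => /=; rewrite !exprS; ring.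
Qed.

(** The fractions c/1 with c outside of p are invertible, hence cancel. *)
Lemma loc_scaleI p (c : den p) (x y : loc p M) :
  rfrac (sval c) (den1 p) *: x = rfrac (sval c) (den1 p) *: y -> x = y.
Proof.
move=> e; rewrite -[x]scale1r -[y]scale1r.
have -> : 1 = rfrac 1 c * rfrac (sval c) (den1 p) :> locRing p.
  by rewrite rfracM -rfrac1; apply: rfrac_eq => /=; ring.
by rewrite -!scalerA e.
Qed.

(** Otherwise the annihilator of m contains no power of g, hence lies in a prime
    not containing g, and m does not vanish in the localization there. *)
Lemma vanish_on_basic (g : A) (m : M) :
  (forall p, basic g p -> exists u : den p, sval u *: m = 0) ->
  exists k, g ^+ k *: m = 0.
Proof.
move=> h; apply: contrapT => /forallNP nk.
have [|p [ap pg]] := @prime_avoiding A [set a | a *: m = 0] g _ nk.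
  split => /=; first by rewrite scale0r.
    by move=> a b ea eb; rewrite scalerDl ea eb addr0.
  by move=> a b e; rewrite -scalerA e scaler0.
by have [u /ap pu] := h p pg; have := den_basic u; apply.
Qed.

Definition fracsec_subproof U (m : M) (b : A) (Ub : U `<=` basic b) :
  locally_frac (fun q : {p | U p} =>
    frac m (Sub b (basic_denP (Ub _ (proj2_sig q))) : den (sval q))).
Proof.
move=> p Up; exists (basic b); split; first exact: (Ub p).
exists m, b => q bq; exists (basic_denP (Ub _ (proj2_sig q))); by [].
Qed.

Definition fracsec U (m : M) (b : A) (Ub : U `<=` basic b) : tilde_sec M U :=
  TildeSec (@fracsec_subproof U m b Ub).

Lemma basic1 U : U `<=` basic (1 : A).
Proof. by move=> p _; exact: pideal1. Qed.

(** The basic opens D(h) inside U suffice as neighbourhoods. *)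
Lemma sec_near U (s : tilde_sec M U) p : U p -> exists m c h,
  [/\ basic h p, basic h `<=` U & forall q : {p | U p}, basic h (sval q) ->
     exists hc : c \notin (sval q : set A), s q = frac m (Sub c hc : den (sval q))].
Proof.
move=> Up; have [V [Vp [m [c e]]]] := tvalP s Up.
have [h [hp hV]] := basic_nbhd (conj Vp Up : opensI V U p).
exists m, c, h; split => // q hq; first by case: (hV q hq).
by apply: e; case: (hV _ hq).
Qed.

(** Expanding a fraction m/c on D(h) by h makes its denominator define the
    open set where it is valid. *)
Lemma sec_near1 U (s : tilde_sec M U) p : U p -> exists m h,
  [/\ basic h p, basic h `<=` U & forall q : {p | U p}, basic h (sval q) ->
     exists hc : h \notin (sval q : set A), s q = frac m (Sub h hc : den (sval q))].
Proof.
move=> Up; have [m [c [h [hp hU e]]]] := sec_near s Up.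
exists (h *: m), (h * c); split.
- by apply/basicM; split => //; have [hc _] := e (exist _ p Up) hp; rewrite notin_setE in hc.
- by move=> q /basicM[/hU].
move=> q hcq; have [hq _] := (basicM _ _ _).1 hcq.
have [hc ->] := e q hq; exists (basic_denP hcq).
by apply: frac_eq; rewrite /= scalerA mulrC.
Qed.

End Fractions.

Lemma common_exponent (T : eqType) (P : T -> nat -> Prop) (l : seq T) :
  (forall x k j, P x k -> P x (k + j)%N) -> (forall x, x \in l -> exists k, P x k) ->
  exists k, forall x, x \in l -> P x k.
Proof.
move=> mono; elim: l => [|x l IH] h; first by exists 0%N.
have [k Pk] := h x (mem_head _ _).
have [|K PK] := IH; first by move=> y yl; apply: h; rewrite inE yl orbT.
exists (k + K)%N => y; rewrite inE => /orP[/eqP->|yl]; first exact: mono.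
by rewrite addnC; apply: mono; exact: PK.
Qed.

Section BasicSections.
Variables (A : comPzRingType) (M : lmodType A).
Implicit Types (U V W : opens (primeSpec A)) (p : primeSpec A).
Hypothesis nA : noeth_top (primeSpec A).

(** Cover D(g) by D(h_i) on
    which the section is m_i/h_i; enlarging the h_i to powers makes the m_i/h_i
    compatible on the nose, h_j m_i = h_i m_j, and a combination g^k of the h_i
    then gives the numerator. *)
Lemma section_on_basic (g : A) (U : opens (primeSpec A)) (t : tilde_sec M U) :
  basic g `<=` U ->
  exists k (m : M), forall q : {p | U p}, basic g (sval q) ->
    exists hg : g ^+ k \notin (sval q : set A),
      t q = frac m (Sub (g ^+ k) hg : den (sval q)).
Proof.
move=> gU.
pose good (x : A * M) := basic x.1 `<=` U /\ forall q : {p | U p}, basic x.1 (sval q) ->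
  exists hc : x.1 \notin (sval q : set A), t q = frac x.2 (Sub x.1 hc : den (sval q)).
have [l [lgood lcov]] : exists l : seq (A * M), (forall x, x \in l -> good x) /\
    forall p, basic g p -> exists2 x, x \in l & basic x.1 p.
  pose Phi (B : opens (primeSpec A)) := exists l : seq (A * M),
    (forall x, x \in l -> good x) /\ forall p, B p -> exists2 x, x \in l & basic x.1 p.
  apply: (nA (Phi := Phi)).
  - by exists [::]; split => // p [].
  - move=> B C [l [lg lB]] [l' [lg' lC]]; exists (l ++ l'); split.
      by move=> x; rewrite mem_cat => /orP[/lg|/lg'].
    move=> p [/lB|/lC] [x xl px]; exists x => //; by rewrite mem_cat xl ?orbT.
  - by move=> B C BC [l [lg lC]]; exists l; split => // p /BC/lC.
  move=> p /gU Up; have [m [h [hp hU e]]] := sec_near1 t Up.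
  exists (basic h); split => //; exists [:: (h, m)]; split.
    by move=> x; rewrite inE => /eqP->.
  by move=> q hq; exists (h, m) => //; rewrite inE.
(* The fractions x.2/x.1 and y.2/y.1 agree on D(x.1 y.1), so their cross
   difference is killed by a power of x.1 y.1. *)
have [K KP] : exists K, forall xy, xy \in [seq (x, y) | x <- l, y <- l] ->
    (xy.1.1 * xy.2.1) ^+ K *: (xy.2.1 *: xy.1.2 - xy.1.1 *: xy.2.2) = 0.
  apply: common_exponent => [x k j e|[x y]].
    by rewrite addnC exprD -scalerA e scaler0.
  move=> /allpairsP[[x' y'] /= [xl yl [-> ->]]].
  have [xU ex] := lgood _ xl; have [yU ey] := lgood _ yl.
  apply: vanish_on_basic => p /basicM[px py].
  have [hx] := ex (exist _ p (xU p px)) px.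
  have [hy ->] := ey (exist _ p (xU p px)) py.
  move=> /esym/fracP[u /= e]; exists u.
  by rewrite scalerBr e subrr.
have {}KP x y : x \in l -> y \in l ->
    y.1 ^+ K.+1 *: (x.1 ^+ K *: x.2) = x.1 ^+ K.+1 *: (y.1 ^+ K *: y.2).
  move=> xl yl; have /KP/= : (x, y) \in [seq (x, y) | x <- l, y <- l].
    by apply/allpairsP; exists (x, y).
  rewrite scalerBr => /eqP; rewrite subr_eq0 => /eqP e.
  transitivity ((x.1 * y.1) ^+ K *: (y.1 *: x.2)).
    by rewrite !scalerA exprMn exprS; congr (_ *: _); ring.
  by rewrite e !scalerA exprMn exprS; congr (_ *: _); ring.
pose x i := tnth (in_tuple l) i.
have xl i : x i \in l by exact: mem_tnth.
(* The D(x.1) cover D(g), so some power of g is in the ideal generated by the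
   powers of the x.1. *)
have [k [c ec]] : exists k (c : 'I_(size l) -> A), g ^+ k = \sum_i c i * (x i).1 ^+ K.+1.
  apply: contrapT => nk.
  have [||p [Jp pg]] := @prime_avoiding A
      [set a | exists c : 'I_(size l) -> A, a = \sum_i c i * (x i).1 ^+ K.+1] g.
  - split.
    + by exists (fun=> 0); rewrite big1 // => i _; rewrite mul0r.
    + move=> _ _ [c ->] [d ->]; exists (fun i => c i + d i).
      by rewrite -big_split; apply: eq_bigr => i _; rewrite mulrDl.
    + move=> a _ [c ->]; exists (fun i => a * c i).
      by rewrite big_distrr; apply: eq_bigr => i _; rewrite /= mulrA.
  - by move=> k [c ec]; apply: nk; exists k, c.
  have [y yl py] := lcov p pg.
  have [i ei] : exists i, y = x i by apply/tnthP.
  apply: (@basicX A _ K.+1 p py); apply: Jp; exists (fun j => (j == i)%:R).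
  rewrite (bigD1 i) //= eqxx mul1r -ei big1 ?addr0 // => j /negPf->.
  by rewrite mul0r.
exists k, (\sum_i c i *: ((x i).1 ^+ K *: (x i).2)) => q gq.
exists (basic_denP (@basicX A _ k _ gq)).
have [y yl py] := lcov _ gq; have [yU ey] := lgood _ yl.
have [hy ->] := ey q py; apply/fracP; exists (denX (Sub y.1 hy) K) => /=.
rewrite [RHS]scalerA -exprSr scaler_sumr ec scaler_suml scaler_sumr.
apply: eq_bigr => i _.
transitivity (c i *: ((x i).1 ^+ K.+1 *: (y.1 ^+ K *: y.2))).
  by rewrite !scalerA; congr (_ *: _); ring.
by rewrite (KP y (x i) yl (xl i)) !scalerA; congr (_ *: _); ring.
Qed.

End BasicSections.

Section SpecUnits.
Variables (A : comPzRingType).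
Implicit Types (U V W : opens (primeSpec A)) (p : primeSpec A).

Lemma rfrac_unit p (a : A) (s : den p) (x : locRing p) :
  x * rfrac a s = 1 -> basic a p.
Proof.
elim/rfrac_ind: x => b t; rewrite rfracM -rfrac1 => /rfracP[u /= e] pa.
apply: (den_basic (denM u (denM t s))) => /=.
move: e; rewrite mul1r mulr1 => <-.
by apply: pidealM; apply: pidealM.
Qed.

Lemma spec_sec_near U (a : spec_sec U) p : U p -> exists b d h : A,
  [/\ basic h p, basic h `<=` U & forall q : {p | U p}, basic h (sval q) ->
     exists hd : d \notin (sval q : set A),
       sval_at a q = rfrac b (Sub d hd : den (sval q))].
Proof. exact: (@sec_near A A^o U a p). Qed.

(** The stalk at q is the localization at q, whose units are the fractions with
    numerator outside of q; a numerator is then invertible on a neighbourhood. *)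
Lemma spec_germ_unit U (a : @osec (Spec A) U) (q : {p | U p}) (b : A) (c : den (sval q)) :
  sval_at a q = rfrac b c -> (germ_unit (X := Spec A) (sval q) a <-> basic b (sval q)).
Proof.
move=> e; split.
  move=> [V [VU [Vq [t et]]]].
  have := congr1 (fun z : spec_sec V => sval_at z (exist _ (sval q) Vq)) et.
  rewrite /sval_at /=.
  set y := tval a _ => ey.
  apply: (@rfrac_unit _ b c (tval t (exist _ (sval q) Vq))); rewrite -e.
  have -> : sval_at a q = y.
    rewrite /y; case: (q) Vq {e ey y} => p Up Vp; exact: (tval_irr (a : spec_sec U)).
  exact: ey.
move=> bq; have [m [d [h [hq hU ed]]]] := sec_near (a : tilde_sec A^o U) (proj2_sig q).
have mq : basic (m : A) (sval q).
  have [hd] := ed q hq; rewrite -/(sval_at a q) e => /rfracP[u /= eu] pm.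
  apply: (den_basic u); case: (@pideal_prime _ (sval q) (sval u) (d * b)) => //.
    by rewrite eu; apply: pidealM; apply: pidealM.
  move=> /pideal_prime[] //; by rewrite notin_setE in hd.
have VU : basic (h * (m : A)) `<=` U by move=> p /basicM[/hU].
have Vm : basic (h * (m : A)) `<=` basic (m : A) by move=> p /basicM[].
exists (basic (h * (m : A))), VU; split; first exact/basicM.
exists (fracsec (d : A^o) Vm); apply: tilde_ext => -[p Vp] /=.
rewrite /sval_at /=.
have hp : basic h p by case/basicM: (Vp).
have [hd ->] := ed (exist _ p (VU p Vp)) hp.
by rewrite [LHS]rfracM -rfrac1; apply: rfrac_eq => /=; ring.
Qed.

End SpecUnits.

Section TildeLocalizing.
Variables (A : comPzRingType) (M : lmodType A).
Implicit Types (U V W : opens (primeSpec A)) (p : primeSpec A).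
Hypothesis nA : noeth_top (primeSpec A).

Lemma sval_atX U (a : spec_sec U) k q : sval_at (a ^+ k) q = sval_at a q ^+ k.
Proof. by elim: k => [|k IH] //; rewrite !exprS -IH. Qed.

Lemma sec_near2 U (a : spec_sec U) (s : tilde_sec M U) p : U p -> exists b d m c h,
  [/\ basic h p, basic h `<=` U & forall q : {p | U p}, basic h (sval q) ->
     exists (hd : d \notin (sval q : set A)) (hc : c \notin (sval q : set A)),
     sval_at a q = rfrac b (Sub d hd : den (sval q)) /\
     s q = frac m (Sub c hc : den (sval q))].
Proof.
move=> Up; have [b [d [h [hp hU e]]]] := spec_sec_near a Up.
have [m [c [h' [hp' hU' e']]]] := sec_near s Up.
exists b, d, m, c, (h * h'); split; first exact/basicM.
  by move=> q /basicM[/hU].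
move=> q /basicM[/e[hd ed] /e'[hc ec]]; exists hd, hc; split => //.
Qed.

(** Near p the function a is b/d and the section s is m/c on some D(h), so that
    a is a unit on D(hb) inside D(h): vanishing on D(hb) means being killed by a
    power of hb, and the sections over D(hb) are fractions m/(hb)^k. *)
Theorem tilde_localizing : localizing (tilde M).
Proof.
have tor : torsion_off_uloc (tilde M).
  apply: torsion_local => // U V VU a s aV s0 p Up.
  have [b [d [m [c [h [hp hU e]]]]]] := sec_near2 a s Up.
  have [k ek] : exists k, (h * b) ^+ k *: m = 0.
    apply: vanish_on_basic => q /basicM[hq bq].
    have [hd [hc [ea es]]] := e (exist _ q (hU q hq)) hq.
    have Vq : V q.
      by apply: aV; split; [exact: (hU q hq)|exact/(spec_germ_unit ea)].
    have := congr1 (fun z : tilde_sec M V => z (exist _ q Vq)) s0.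
    rewrite /= (tval_irr s _ (hU q hq)) es => /frac_eq0[u eu].
    by exists u.
  exists (basic h), hU; split => //; exists k; apply: tilde_ext => -[q hq] /=.
  have [hd [hc [ea es]]] := e (exist _ q (hU q hq)) hq.
  change (sval_at ((a : spec_sec U) ^+ k) (exist _ q (hU q hq)) *:
    (s : tilde_sec M U) (exist _ q (hU q hq)) = 0).
  rewrite sval_atX es ea rfracX fracZ; apply/frac_eq0.
  exists (denX (Sub h (basic_denP hq)) k) => /=.
  by rewrite scalerA -exprMn.
split => //; apply: extends_local => // U V VU a t Va aV p Up.
have [b [d [h [hp hU e]]]] := spec_sec_near a Up.
have hbV : basic (h * b) `<=` V.
  move=> q /basicM[hq bq]; apply: aV; have [hd ea] := e (exist _ q (hU q hq)) hq.
  by split; [exact: (hU q hq)|exact/(spec_germ_unit (ea : sval_at a _ = _))].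
have [k [m et]] := section_on_basic nA t hbV.
have hdh : basic h `<=` basic ((d * h) ^+ k).
  move=> q hq; apply: basicX; apply/basicM; split => //.
  by have [hd _] := e (exist _ q (hU q hq)) hq; rewrite notin_setE in hd.
exists (basic h), hU; split => //; exists k, (fracsec m hdh).
apply: tilde_ext => -[q [hq Vq]].
have [hd ea] := e (exist _ q (hU q hq)) hq.
have bq : basic b q.
  by have [Uq /(spec_germ_unit (ea : sval_at a _ = _))] := Va q Vq.
have [hk et'] := et (exist _ q Vq) ((basicM _ _ _).2 (conj hq bq)).
rewrite [RHS]/= (tval_irr t _ Vq) et' [LHS]/=.
rewrite /sub_pt /= (tval_irr (a ^+ k : spec_sec U) _ (hU q hq)).
rewrite -[X in _ = X *: _]/(sval_at ((a : spec_sec U) ^+ k) (exist _ q (hU q hq))).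
rewrite sval_atX [sval_at a _]ea rfracX fracZ; apply: frac_eq => /=.
by rewrite !scalerA; congr (_ *: _); rewrite !exprMn; ring.
Qed.

End TildeLocalizing.

(** * Homomorphisms of sheaves of modules *)

Section MakeHom.
Variables (X : ringedSpace) (M N : omod X).
Variable u : forall U : opens X, msec M U -> msec N U.
Hypothesis uL : forall U a s t, u (a *: s + t) = a *: u s + u t :> msec N U.
Hypothesis ur : forall (U V : opens X) (VU : V `<=` U) s, u (mres VU s) = mres VU (u s).

Definition homfun_of U : msec M U -> msec N U := @u U.

Lemma homfun_linear U : linear (@homfun_of U).
Proof. exact: uL. Qed.

HB.instance Definition _ U := GRing.isLinear.Build (osec U) (msec M U) (msec N U)
  *:%R (@homfun_of U) (@homfun_linear U).

Definition mkhom : omod_hom M N :=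
  @OModHom X M N (fun U => @homfun_of U : {linear msec M U -> msec N U}) ur.

End MakeHom.

(** * Restriction, direct image and products of sheaves of modules *)

(** M with scalars restricted along phi. *)
Definition rscal (R S : comPzRingType) (phi : {rmorphism R -> S})
  (M : lmodType S) : Type := M.

Section RestrictScalars.
Variables (R S : comPzRingType) (phi : {rmorphism R -> S}) (M : lmodType S).
Local Notation rscal := (rscal phi M).

HB.instance Definition _ := GRing.Zmodule.on rscal.

Definition rscal_scale (a : R) (m : rscal) : rscal := phi a *: (m : M).

Lemma rscalA a b m : rscal_scale a (rscal_scale b m) = rscal_scale (a * b) m.
Proof. by rewrite /rscal_scale scalerA rmorphM. Qed.
Lemma rscal1 : left_id 1 rscal_scale.
Proof. by move=> m; rewrite /rscal_scale rmorph1 scale1r. Qed.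
Lemma rscalDr : right_distributive rscal_scale +%R.
Proof. by move=> a m n; rewrite /rscal_scale scalerDr. Qed.
Lemma rscalDl m : {morph rscal_scale^~ m : a b / a + b}.
Proof. by move=> a b; rewrite /rscal_scale rmorphD scalerDl. Qed.

HB.instance Definition _ :=
  GRing.Zmodule_isLmodule.Build R rscal rscalA rscal1 rscalDr rscalDl.

Lemma rscalE (a : R) (m : rscal) : a *: m = phi a *: (m : M).
Proof. by []. Qed.

End RestrictScalars.

Section DependentProduct.
Variables (R : comPzRingType) (I : Type) (M : I -> lmodType R).

Definition dprodm : Type := forall i, M i.
HB.instance Definition _ := gen_eqMixin dprodm.
HB.instance Definition _ := gen_choiceMixin dprodm.

Lemma dprodm_ext (x y : dprodm) : (forall i, x i = y i) -> x = y.
Proof. by move=> e; apply: functional_extensionality_dep. Qed.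

Definition dprodm_add (x y : dprodm) : dprodm := fun i => x i + y i.
Definition dprodm_opp (x : dprodm) : dprodm := fun i => - x i.
Definition dprodm_scale (a : R) (x : dprodm) : dprodm := fun i => a *: x i.

Lemma dprodm_addA : associative dprodm_add.
Proof. by move=> x y z; apply: dprodm_ext => i; apply: addrA. Qed.
Lemma dprodm_addC : commutative dprodm_add.
Proof. by move=> x y; apply: dprodm_ext => i; apply: addrC. Qed.
Lemma dprodm_add0 : left_id (fun i => 0 : M i) dprodm_add.
Proof. by move=> x; apply: dprodm_ext => i; apply: add0r. Qed.
Lemma dprodm_addN : left_inverse (fun i => 0 : M i) dprodm_opp dprodm_add.
Proof. by move=> x; apply: dprodm_ext => i; apply: addNr. Qed.

HB.instance Definition _ :=
  GRing.isZmodule.Build dprodm dprodm_addA dprodm_addC dprodm_add0 dprodm_addN.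

Lemma dprodm_scaleA a b x : dprodm_scale a (dprodm_scale b x) = dprodm_scale (a * b) x.
Proof. by apply: dprodm_ext => i; apply: scalerA. Qed.
Lemma dprodm_scale1 : left_id 1 dprodm_scale.
Proof. by move=> x; apply: dprodm_ext => i; apply: scale1r. Qed.
Lemma dprodm_scaleDr : right_distributive dprodm_scale +%R.
Proof. by move=> a x y; apply: dprodm_ext => i; apply: scalerDr. Qed.
Lemma dprodm_scaleDl x : {morph dprodm_scale^~ x : a b / a + b}.
Proof. by move=> a b; apply: dprodm_ext => i; apply: scalerDl. Qed.

HB.instance Definition _ := GRing.Zmodule_isLmodule.Build R dprodm
  dprodm_scaleA dprodm_scale1 dprodm_scaleDr dprodm_scaleDl.

End DependentProduct.

Section DirectImage.
Variables (Y X : ringedSpace) (f : rs_morphism Y X) (G : omod Y).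
Implicit Types U V W : opens X.

Definition push_sec (V : opens X) : lmodType (osec V) :=
  rscal (msharp (@mpre_sub _ _ f V)) (msec G (mpre f V)).

Lemma mpreS (U V : opens X) : V `<=` U -> mpre f V `<=` mpre f U.
Proof. by move=> VU y; exact: (VU (f y)). Qed.

Definition push_res (U V : opens X) (VU : V `<=` U) :
  {additive push_sec U -> push_sec V} := mres (mpreS VU).

Lemma push_resZ U V (VU : V `<=` U) (a : osec U) (m : push_sec U) :
  push_res VU (a *: m) = ores VU a *: push_res VU m.
Proof.
rewrite /push_res !rscalE mresZ.
by rewrite (msharp_res (@mpre_sub _ _ f U) (@mpre_sub _ _ f V) VU (mpreS VU)).
Qed.

Lemma push_res_id U (UU : U `<=` U) (m : push_sec U) : push_res UU m = m.
Proof. exact: mres_id. Qed.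

Lemma push_res_comp U V W (VU : V `<=` U) (WV : W `<=` V) (WU : W `<=` U)
  (m : push_sec U) : push_res WV (push_res VU m) = push_res WU m.
Proof. exact: mres_comp. Qed.

Lemma push_sheaf : is_sheaf (fun U V VU => push_res VU : push_sec U -> push_sec V).
Proof.
move=> U I V VU cov s scomp.
have [||t [tP tu]] := @mres_sheaf Y G (mpre f U) I (fun i => mpre f (V i))
    (fun i => mpreS (VU i)) _ s.
- by move=> y /cov.
- move=> i j W Wi Wj.
  have WI : W `<=` mpre f (capo (V i) (V j)) by move=> y Wy; split; [exact: (Wi y)|exact: (Wj y)].
  have := scomp i j (capo (V i) (V j)) (@capoL _ _ _) (@capoR _ _ _).
  move=> /(congr1 (mres WI)); rewrite /push_res !mresE => e.
  by rewrite (mres_irr Wi (subset_trans WI (mpreS (@capoL _ (V i) (V j))))) e; exact: mres_irr.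
by exists t; split => // t' t'P; apply: tu.
Qed.

Definition push : omod X :=
  @OMod X push_sec push_res push_resZ push_res_id push_res_comp push_sheaf.

(** Since f is local, f^-1 maps the unit locus of a to the unit locus of its
    pullback. *)
Lemma push_localizing : is_local f -> localizing G -> localizing push.
Proof.
move=> fl [tor ext].
have uP U (a : osec U) : uset (msharp (@mpre_sub _ _ f U) a) = f @^-1` uset a.
  apply/seteqP; split => y [Uy g]; split => //.
    exact: fl g.
  have [V [VU [Vy [t e]]]] := g.
  exists (mpre f V), (mpreS VU); split => //.
  exists (msharp (@mpre_sub _ _ f V) t).
  rewrite -(msharp_res (@mpre_sub _ _ f U) (@mpre_sub _ _ f V) VU).
  by rewrite -rmorphM e rmorph1.
split=> U V VU a s.
  move=> aV s0.
  have [|k ek] := tor _ _ (mpreS VU) (msharp (@mpre_sub _ _ f U) a) s _ s0.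
    by rewrite uP => y; exact: (aV (f y)).
  by exists k; rewrite rscalE rmorphXn.
move=> Va aV.
have [||k [t et]] := ext _ _ (mpreS VU) (msharp (@mpre_sub _ _ f U) a) s.
- by rewrite uP => y; exact: (Va (f y)).
- by rewrite uP => y; exact: (aV (f y)).
exists k, t; rewrite /= /push_res et rscalE -rmorphXn.
by rewrite (msharp_res (@mpre_sub _ _ f U) (@mpre_sub _ _ f V) VU (mpreS VU)).
Qed.

End DirectImage.

Section Restriction.
Variables (X : ringedSpace) (W : opens X) (F : omod X).
Implicit Types U V : opens X.

Definition rest_sec U : lmodType (osec U) :=
  rscal (ores (@capoL _ U W)) (msec F (capo U W)).

Lemma capSl U V : V `<=` U -> capo V W `<=` capo U W.
Proof. by move=> VU; apply: capoS. Qed.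

Definition rest_res U V (VU : V `<=` U) :
  {additive rest_sec U -> rest_sec V} := mres (capSl VU).

Lemma rest_resZ U V (VU : V `<=` U) (a : osec U) (m : rest_sec U) :
  rest_res VU (a *: m) = ores VU a *: rest_res VU m.
Proof.
rewrite /rest_res !rscalE mresZ !oresE.
by rewrite (ores_irr _ (subset_trans (capSl VU) (@capoL _ U W))).
Qed.

Lemma rest_res_id U (UU : U `<=` U) (m : rest_sec U) : rest_res UU m = m.
Proof. exact: mres_id. Qed.

Lemma rest_res_comp U V V' (VU : V `<=` U) (WV : V' `<=` V) (WU : V' `<=` U)
  (m : rest_sec U) : rest_res WV (rest_res VU m) = rest_res WU m.
Proof. exact: mres_comp. Qed.

Lemma rest_sheaf : is_sheaf (fun U V VU => rest_res VU : rest_sec U -> rest_sec V).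
Proof.
move=> U I V VU cov s scomp.
have [||t [tP tu]] := @mres_sheaf X F (capo U W) I (fun i => capo (V i) W)
    (fun i => capSl (VU i)) _ s.
- by move=> y [/cov[i Vy] Wy]; exists i.
- move=> i j W' Wi Wj.
  have WI : W' `<=` capo (capo (V i) (V j)) W.
    by move=> y W'y; have [? ?] := Wi y W'y; have [? _] := Wj y W'y.
  have := scomp i j (capo (V i) (V j)) (@capoL _ _ _) (@capoR _ _ _).
  move=> /(congr1 (mres WI)); rewrite /rest_res !mresE => e.
  by rewrite (mres_irr Wi (subset_trans WI (capSl (@capoL _ (V i) (V j))))) e; exact: mres_irr.
by exists t; split => // t' t'P; apply: tu.
Qed.

(** The direct image on X of the restriction of F to W. *)
Definition rest : omod X :=
  @OMod X rest_sec rest_res rest_resZ rest_res_id rest_res_comp rest_sheaf.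

Lemma rest_localizing : localizing F -> localizing rest.
Proof.
move=> [tor ext]; split=> U V VU a s.
  move=> aV s0.
  have [|k ek] := tor _ _ (capSl VU) (ores (@capoL _ U W) a) s _ s0.
    by move=> x /uset_res[[Ux Wx] /aV Vx].
  by exists k; rewrite rscalE rmorphXn.
move=> Va aV.
have [||k [t et]] := ext _ _ (capSl VU) (ores (@capoL _ U W) a) s.
- by move=> x [Vx Wx]; apply/uset_res; split; [split => //; exact: (VU x)|exact: (Va x)].
- by move=> x /uset_res[[Ux Wx] /aV Vx].
exists k, t; rewrite /= /rest_res et rscalE -rmorphXn !oresE.
by rewrite (ores_irr (subset_trans (@capoL _ V W) VU) (subset_trans (capSl VU) (@capoL _ U W))).
Qed.

End Restriction.

Section ProductSheaf.
Variables (X : ringedSpace) (I : Type) (G : I -> omod X).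
Implicit Types U V W : opens X.

Definition prod_sec U : lmodType (osec U) := dprodm (fun i => msec (G i) U).

Definition prod_res_fun U V (VU : V `<=` U) (s : prod_sec U) : prod_sec V :=
  fun i => mres VU (s i).

Lemma prod_res_zmod U V (VU : V `<=` U) : zmod_morphism (prod_res_fun VU).
Proof. by move=> s t; apply: dprodm_ext => i; apply: raddfB. Qed.

HB.instance Definition _ U V (VU : V `<=` U) :=
  GRing.isZmodMorphism.Build (prod_sec U) (prod_sec V) (prod_res_fun VU)
    (prod_res_zmod VU).

Definition prod_res U V (VU : V `<=` U) : {additive prod_sec U -> prod_sec V} :=
  prod_res_fun VU.

Lemma prod_resZ U V (VU : V `<=` U) (a : osec U) (m : prod_sec U) :
  prod_res VU (a *: m) = ores VU a *: prod_res VU m.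
Proof. by apply: dprodm_ext => i; apply: mresZ. Qed.

Lemma prod_res_id U (UU : U `<=` U) (m : prod_sec U) : prod_res UU m = m.
Proof. by apply: dprodm_ext => i; apply: mres_id. Qed.

Lemma prod_res_comp U V W (VU : V `<=` U) (WV : W `<=` V) (WU : W `<=` U)
  (m : prod_sec U) : prod_res WV (prod_res VU m) = prod_res WU m.
Proof. by apply: dprodm_ext => i; apply: mres_comp. Qed.

Lemma prod_sheaf : is_sheaf (fun U V VU => prod_res VU : prod_sec U -> prod_sec V).
Proof.
move=> U J V VU cov s scomp.
have h i : exists t : msec (G i) U, forall j, mres (VU j) t = s j i.
  have [|t [tP _]] := @mres_sheaf X (G i) U J V VU cov (fun j => s j i).
    move=> j k W Wj Wk.
    exact: (congr1 (fun z : prod_sec W => z i) (scomp j k W Wj Wk)).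
  by exists t.
exists (fun i => sval (cid (h i)) : msec (G i) U); split.
  by move=> j; apply: dprodm_ext => i; rewrite /prod_res /= /prod_res_fun; case: (cid (h i)) => t /= tP; exact: tP.
move=> t' t'P; apply: dprodm_ext => i /=; case: (cid (h i)) => t /= tP.
apply: omod_sep => x /cov[j Vx]; exists (V j), (VU j); split => //.
by rewrite tP -t'P.
Qed.

Definition prodsh : omod X :=
  @OMod X prod_sec prod_res prod_resZ prod_res_id prod_res_comp prod_sheaf.

End ProductSheaf.

(** Finitely many exponents have a common bound. For infinite products this
    fails, and in general they are not quasi-coherent. *)
Lemma finite_prod_localizing (X : ringedSpace) (I : finType) (G : I -> omod X) :
  (forall i, localizing (G i)) -> localizing (prodsh G).
Proof.
move=> loc; split=> U V VU a s.
  move=> aV s0.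
  have [k kP] : exists k, forall i, i \in enum I -> a ^+ k *: s i = 0.
    apply: common_exponent => [i k j e|i _].
      by rewrite addnC exprD -scalerA e scaler0.
    have [tor _] := loc i; apply: (tor U V VU a (s i) aV).
    exact: (congr1 (fun z : prod_sec G V => z i) s0).
  exists k; apply: dprodm_ext => i; apply: (kP i); exact: mem_enum.
move=> Va aV.
have [k kP] : exists k, forall i, i \in enum I ->
    exists t : msec (G i) U, mres VU t = ores VU (a ^+ k) *: s i.
  apply: common_exponent => [i k j [t e]|i _].
    exists (a ^+ j *: t); rewrite mresZ e scalerA -rmorphM -exprD.
    by rewrite addnC.
  have [_ ext] := loc i; exact: ext.
have {}kP i : exists t : msec (G i) U, mres VU t = ores VU (a ^+ k) *: s i.
  by apply: kP; rewrite mem_enum.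
exists k, (fun i => sval (cid (kP i)) : msec (G i) U); apply: dprodm_ext => i.
by rewrite /= /prod_res /= /prod_res_fun; case: (cid (kP i)) => t /= tP; exact: tP.
Qed.

(** * Affine charts *)

Section OpenImmersions.
Variables (Y X : ringedSpace) (f : rs_morphism Y X).
Hypothesis fo : open_immersion f.

Definition oim (U : opens Y) : opens X := Opens (oi_open fo U).

Lemma oim_sub (U : opens Y) : U `<=` f @^-1` oim U.
Proof. exact: preimage_image. Qed.

Lemma oimS (U V : opens Y) : V `<=` U -> oim V `<=` oim U.
Proof. exact: image_subset. Qed.

Lemma oim_pre (U : opens Y) y : oim U (f y) -> U y.
Proof. by move=> [z Uz /(oi_inj fo) <-]. Qed.

Lemma msharp_bij (U : opens Y) : bijective (msharp (@oim_sub U)).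
Proof. exact: (oi_iso fo). Qed.

Lemma msharp_inj (O : opens X) (U : opens Y) (UO : U `<=` f @^-1` O) :
  O `<=` oim U -> injective (msharp UO).
Proof.
move=> OU; apply: bij_inj; apply: (oi_iso fo); apply/seteqP; split => x; last exact: (OU x).
by move=> [y Uy <-]; exact: (UO y).
Qed.

(** An inverse on U' of the pullback of s is the pullback of an inverse on the
    image of U'. *)
Lemma open_immersion_local : is_local f.
Proof.
move=> V U UV s y Uy [U' [UU [Uy' [t e]]]].
have VV : oim U' `<=` V by move=> _ [z U'z <-]; exact: (UV z (UU z U'z)).
exists (oim U'), VV; split; first by exists y.
have [g gK Kg] := msharp_bij U'.
exists (g t); apply: (can_inj gK).
by rewrite rmorphM rmorph1 Kg (msharp_res UV (@oim_sub U') VV UU).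
Qed.

End OpenImmersions.

Lemma local_germ_unit (Y X : ringedSpace) (f : rs_morphism Y X) (V : opens X)
    (U : opens Y) (UV : U `<=` f @^-1` V) (s : osec V) y : is_local f ->
  U y -> germ_unit y (msharp UV s) <-> germ_unit (f y) s.
Proof.
move=> fl Uy; split; first exact: fl.
move=> [W [WV [Wy [t e]]]].
have UW : capo U (mpre f W) `<=` f @^-1` W by move=> z [].
exists (capo U (mpre f W)), (@capoL _ _ _); split => //.
exists (msharp UW t).
by rewrite -(msharp_res UV UW WV) -rmorphM e rmorph1.
Qed.

Section Chart.
Variables (X : scheme) (A : comPzRingType) (f : rs_morphism (Spec A) X).
Hypothesis fo : open_immersion f.
Implicit Types (U V W : opens (Spec A)) (O : opens X).

Definition cimg : opens X := oim fo (topO (Spec A)).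

Lemma cimgP x : cimg x <-> exists q, f q = x.
Proof. by split => [[q _ <-]|[q <-]]; exists q. Qed.

Lemma cimg_f q : cimg (f q). Proof. by exists q. Qed.

Definition csec U (a : A) : spec_sec U := fracsec (a : A^o) (@basic1 A U).

Lemma csec_at U a q : sval_at (csec U a) q = rfrac a (den1 (sval q)).
Proof. by apply: rfrac_eq. Qed.

Lemma csec_res U V (VU : V `<=` U) a : spec_res VU (csec U a) = csec V a.
Proof. by apply: tilde_ext => q; apply: frac_eq. Qed.

Lemma csec_zmod U : zmod_morphism (csec U).
Proof.
move=> a b; apply: tilde_ext => q.
rewrite -[LHS]/(sval_at _ _) csec_at.
rewrite -[RHS]/(sval_at (csec U a) q - sval_at (csec U b) q) !csec_at.
have -> : - rfrac b (den1 (sval q)) = rfrac (- b) (den1 (sval q)) by exact: (@fracN _ _ A^o).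
by rewrite rfracD; apply: rfrac_eq => /=; ring.
Qed.

Lemma csec_monoid U : monoid_morphism (csec U).
Proof.
split=> [|a b]; apply: tilde_ext => q.
  by rewrite -[LHS]/(sval_at _ _) csec_at; exact: rfrac1.
rewrite -[LHS]/(sval_at _ _) csec_at.
rewrite -[RHS]/(sval_at (csec U a) q * sval_at (csec U b) q) !csec_at.
by rewrite rfracM; apply: rfrac_eq; rewrite /= mul1r.
Qed.

HB.instance Definition _ U := GRing.isZmodMorphism.Build A (spec_sec U) (csec U) (@csec_zmod U).
HB.instance Definition _ U := GRing.isMonoidMorphism.Build A (spec_sec U) (csec U) (@csec_monoid U).

Definition gl_fun (a : A) : osec cimg :=
  sval (cid (let: Bijective g _ gK := msharp_bij fo (topO (Spec A)) in
    ex_intro (fun s => msharp (@oim_sub _ _ f fo (topO (Spec A))) s = csec _ a) _ (gK (csec _ a)))).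

Lemma gl_funE a : msharp (@oim_sub _ _ f fo (topO (Spec A))) (gl_fun a) = csec _ a.
Proof. by rewrite /gl_fun; case: cid. Qed.

Let gl_inj := bij_inj (msharp_bij fo (topO (Spec A))).

Lemma gl_zmod : zmod_morphism gl_fun.
Proof. by move=> a b; apply: gl_inj; rewrite rmorphB !gl_funE raddfB. Qed.

Lemma gl_monoid : monoid_morphism gl_fun.
Proof.
by split=> [|a b]; apply: gl_inj; rewrite ?rmorphM !gl_funE ?rmorph1 ?rmorphM.
Qed.

HB.instance Definition _ := GRing.isZmodMorphism.Build A (osec cimg) gl_fun gl_zmod.
HB.instance Definition _ := GRing.isMonoidMorphism.Build A (osec cimg) gl_fun gl_monoid.

(** The identification of A with functions on the chart, through which A acts on
    the sections over it. *)
Definition gl : {rmorphism A -> osec cimg} := gl_fun.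

Lemma glE U (UU : U `<=` f @^-1` cimg) a : msharp UU (gl a) = csec U a.
Proof.
have UT : U `<=` topO (Spec A) by [].
have := msharp_res (@oim_sub _ _ f fo (topO (Spec A))) UU (@subset_refl _ _) UT (gl a).
by rewrite ores_id gl_funE => ->; exact: csec_res.
Qed.

Lemma gl_unit a q : germ_unit (f q) (gl a) <-> basic a q.
Proof.
have UU : topO (Spec A) `<=` f @^-1` cimg by move=> ? _; exact: cimg_f.
rewrite -(local_germ_unit UU (gl a) (open_immersion_local fo) (y := q)) // glE.
have := @spec_germ_unit A (topO (Spec A)) (csec _ a) (exist _ q I) a (den1 q) (csec_at _ _).
by apply.
Qed.

Lemma uset_gl a x : uset (gl a) x <-> exists2 q, basic a q & f q = x.
Proof.
split=> [[/cimgP[q <-] /gl_unit aq]|[q aq <-]]; first by exists q.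
by split; [exact: cimg_f|exact/gl_unit].
Qed.

Lemma uset_gl_f a q : uset (gl a) (f q) <-> basic a q.
Proof.
split; first by case=> _ /gl_unit.
by move=> aq; split; [exact: cimg_f|exact/gl_unit].
Qed.

Lemma gl_basis O q : O (f q) -> exists a, basic a q /\ uset (gl a) `<=` O.
Proof.
move=> Oq; have [a [aq aO]] := @basic_nbhd A (mpre f O) q Oq.
by exists a; split => // _ /uset_gl[q' /aO ? <-].
Qed.

Definition culoc a : opens X := uloc (gl a).
Lemma culoc_sub a : culoc a `<=` cimg. Proof. exact: uloc_sub. Qed.

(** The pullback of a to Spec A is b/d on some D(h), by definition of the
    structure sheaf of Spec A, and f is an isomorphism onto the chart. *)
Lemma gl_frac O (a : osec O) V (VO : V `<=` f @^-1` O) q (Vq : V q) :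
  exists (b : A) (d : den q) h (hO : culoc h `<=` O),
    [/\ basic h q, ores (@culoc_sub h) (gl (sval d)) * ores hO a =
        ores (@culoc_sub h) (gl b) &
      sval_at (msharp VO a) (exist _ q Vq) = rfrac b d].
Proof.
have [b [d [h [hq hV e]]]] := spec_sec_near (msharp VO a) Vq.
have [dq eq] := e (exist _ q Vq) hq.
have hO : culoc h `<=` O by move=> _ /uset_gl[q' /hV /VO ? <-].
exists b, (Sub d dq), h, hO; split => //.
pose B : opens (Spec A) := basic h.
have hh : B `<=` f @^-1` culoc h by move=> q' h'; apply/uset_gl_f.
have hi : culoc h `<=` oim fo B by move=> _ /uset_gl[q' hq' <-]; exists q'.
have hc : B `<=` f @^-1` cimg by move=> q' _; exact: cimg_f.
apply: (@msharp_inj _ _ f fo _ _ hh hi).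
rewrite rmorphM (msharp_res hc hh (@culoc_sub h) (@subset_refl _ B)) ores_id glE.
rewrite (msharp_res hc hh (@culoc_sub h) (@subset_refl _ B)) ores_id glE.
rewrite (msharp_res VO hh hO (hV : B `<=` V)); apply: tilde_ext => -[q' hq'].
have [dq' e'] := e (exist _ q' (hV q' hq')) hq'.
change (sval_at (csec B d) (exist _ q' hq') *
  sval_at (msharp VO a) (exist _ q' (hV q' hq')) =
  sval_at (csec B b) (exist _ q' hq')).
by rewrite !csec_at e' rfracM; apply: rfrac_eq => /=; ring.
Qed.

End Chart.

Arguments gl_basis {X A f} fo {O q}.

(** * From sections over a chart to fractions *)

Lemma inj_surj_bij (S T : Type) (u : S -> T) :
  injective u -> (forall y, exists x, u x = y) -> bijective u.
Proof.
move=> ui us; exists (fun y => sval (cid (us y))) => [x|y]; last by case: cid.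
by apply: ui; case: cid.
Qed.

Section ChartMaps.
Variables (X : scheme) (A : comPzRingType) (f : rs_morphism (Spec A) X).
Hypothesis fo : open_immersion f.
Variables (G : omod X) (M : lmodType A).
Hypothesis Gloc : localizing G.
Variable lam : {linear rscal (gl fo) (msec G (cimg fo)) -> M}.
Implicit Types (U V W : opens (Spec A)) (O : opens X).
Local Notation cimg := (cimg fo).
Local Notation gl := (gl fo).

Let lamZ (a : A) (m : msec G cimg) : lam (gl a *: m) = a *: lam m.
Proof. by rewrite -[RHS](linearZZ lam a (m : rscal gl (msec G cimg))). Qed.

Let lamD (m m' : msec G cimg) : lam (m + m') = lam m + lam m'.
Proof. exact: (raddfD lam (m : rscal gl (msec G cimg))). Qed.

(** Near f q the section s is the quotient of m by gl c; this is how it defines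
    a fraction. *)
Definition quotient_at O (s : msec G O) (q : Spec A) (m : msec G cimg) (c : den q) :=
  exists (W : opens X) (WO : W `<=` O) (WU : W `<=` cimg),
    W (f q) /\ ores WU (gl (sval c)) *: mres WO s = mres WU m.

Lemma quotient_exists O (s : msec G O) q : O (f q) -> exists m (c : den q), quotient_at s m c.
Proof.
move=> Oq; have [a [aq aO]] := gl_basis fo Oq.
have [_ ext] := Gloc.
have [||k [m em]] := ext cimg (uloc (gl a)) (@uloc_sub _ _ _) (gl a)
  (mres (aO : uloc (gl a) `<=` O) s) => //.
exists m, (denX (Sub a (basic_denP aq)) k).
exists (uloc (gl a)), aO, (@uloc_sub _ _ _); split; first exact/uset_gl_f.
by rewrite em -[sval _]/(a ^+ k) rmorphXn.
Qed.

Lemma quotient_unique O (s : msec G O) q m (c : den q) m' (c' : den q) :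
  quotient_at s m c -> quotient_at s m' c' ->
  frac (lam m) c = frac (lam m') c'.
Proof.
move=> [W [WO [WU [Wq e]]]] [W' [WO' [WU' [Wq' e']]]].
have [a [aq aW]] := gl_basis fo (conj Wq Wq' : capo W W' (f q)).
have aW1 : uloc (gl a) `<=` W by move=> x /aW[].
have aW2 : uloc (gl a) `<=` W' by move=> x /aW[].
have [tor _] := Gloc.
have [||k ek] := tor cimg (uloc (gl a)) (@uloc_sub _ _ _) (gl a)
  (gl (sval c') *: m - gl (sval c) *: m') => //.
  rewrite raddfB !mresZ.
  rewrite (mres_irr _ (subset_trans aW1 WU)) -mresE -e mresZ.
  rewrite [X in _ - _ *: X](mres_irr _ (subset_trans aW2 WU')) -mresE -e' mresZ.
  rewrite !mresE !oresE (mres_irr (subset_trans aW2 WO') (subset_trans aW1 WO)).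
  rewrite (ores_irr (subset_trans aW2 WU') (@uloc_sub _ _ _)).
  rewrite (ores_irr (subset_trans aW1 WU) (@uloc_sub _ _ _)).
  by rewrite !scalerA mulrC subrr.
apply/fracP; exists (denX (Sub a (basic_denP aq)) k) => /=.
apply/eqP; rewrite -subr_eq0 -scalerBr -!lamZ -raddfB; apply/eqP.
by rewrite -lamZ rmorphXn ek raddf0.
Qed.

Definition chart_val O (s : msec G O) (q : Spec A) (Oq : O (f q)) : loc q M :=
  let: m := sval (cid (quotient_exists s Oq)) in
  let: c := sval (cid (svalP (cid (quotient_exists s Oq)))) in
  frac (lam m) c.

Lemma chart_valE O (s : msec G O) (q : Spec A) (Oq : O (f q)) m (c : den q) :
  quotient_at s m c -> chart_val s Oq = frac (lam m) c.
Proof.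
rewrite /chart_val; case: cid => m' /= h; case: cid => c' /= q'.
by move=> qc; apply: quotient_unique q' qc.
Qed.

Lemma chart_frac_subproof O V (VO : V `<=` f @^-1` O) (s : msec G O) :
  locally_frac (fun q : {q | V q} => chart_val s (VO _ (proj2_sig q))).
Proof.
move=> q Vq; have [m [c [W [WO [WU [Wq e]]]]]] := quotient_exists s (VO q Vq).
exists (opensI (mpre f W) (basic (sval c))); split.
  by split => //; exact: den_basic.
exists (lam m), (sval c) => -[q' Vq'] [/= Wq' cq'].
exists (basic_denP cq'); apply: chart_valE.
by exists W, WO, WU.
Qed.

Definition chart_frac O V (VO : V `<=` f @^-1` O) (s : msec G O) : tilde_sec M V :=
  TildeSec (chart_frac_subproof VO s).

Lemma chart_fracE O V (VO : V `<=` f @^-1` O) (s : msec G O) q (Vq : V q) m (c : den q) :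
  quotient_at s m c -> chart_frac VO s (exist _ q Vq) = frac (lam m) c.
Proof. exact: chart_valE. Qed.

Lemma chart_frac_global V (VO : V `<=` f @^-1` cimg) (m : msec G cimg) q (Vq : V q) :
  chart_frac VO m (exist _ q Vq) = frac (lam m) (den1 q).
Proof.
apply: chart_fracE; exists cimg, (@subset_refl _ _), (@subset_refl _ _).
by split; [exact: cimg_f|rewrite rmorph1 rmorph1 scale1r].
Qed.

Lemma quotient_res O O' (OO : O' `<=` O) (s : msec G O) q m (c : den q) :
  O' (f q) -> quotient_at s m c -> quotient_at (mres OO s) m c.
Proof.
move=> Oq [W [WO [WU [Wq e]]]].
exists (capo W O'), (@capoR _ _ _), (subset_trans (@capoL _ W O') WU); split => //.
rewrite -(oresE WU) -(mresE WU) -e mresZ !mresE.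
by rewrite (mres_irr _ (subset_trans (@capoL _ W O') WO)).
Qed.

Lemma quotient_res_inv O O' (OO : O' `<=` O) (s : msec G O) q m (c : den q) :
  quotient_at (mres OO s) m c -> quotient_at s m c.
Proof.
move=> [W [WO [WU [Wq e]]]]; exists W, (subset_trans WO OO), WU.
by rewrite -mresE.
Qed.

Lemma quotientD O (s s' : msec G O) q m (c : den q) m' (c' : den q) :
  quotient_at s m c -> quotient_at s' m' c' ->
  quotient_at (s + s') (gl (sval c') *: m + gl (sval c) *: m') (denM c c').
Proof.
move=> [W [WO [WU [Wq e]]]] [W' [WO' [WU' [Wq' e']]]].
exists (capo W W'), (subset_trans (@capoL _ W W') WO), (subset_trans (@capoL _ W W') WU).
split => //; rewrite -[sval (denM c c')]/(sval c * sval c') !raddfD !mresZ rmorphM rmorphM.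
rewrite -(mresE WU) -e (mres_irr (subset_trans (@capoL _ W W') WU) (subset_trans (@capoR _ W W') WU')).
rewrite -(mresE WU') -e' !mresZ !mresE !oresE.
rewrite (mres_irr (subset_trans (@capoR _ W W') WO') (subset_trans (@capoL _ W W') WO)).
rewrite (ores_irr (subset_trans (@capoR _ W W') WU') (subset_trans (@capoL _ W W') WU)).
by rewrite !scalerA; congr (_ *: _ + _); rewrite mulrC.
Qed.

Lemma chart_fracD O V (VO : V `<=` f @^-1` O) (s s' : msec G O) :
  chart_frac VO (s + s') = chart_frac VO s + chart_frac VO s'.
Proof.
apply: tilde_ext => -[q Vq].
have [m [c qs]] := quotient_exists s (VO q Vq).
have [m' [c' qs']] := quotient_exists s' (VO q Vq).
rewrite (chart_fracE VO Vq (quotientD qs qs')).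
change (frac (lam (gl (sval c') *: m + gl (sval c) *: m')) (denM c c') =
  chart_frac VO s (exist _ q Vq) + chart_frac VO s' (exist _ q Vq)).
rewrite (chart_fracE VO Vq qs) (chart_fracE VO Vq qs') fracD.
by rewrite lamD !lamZ.
Qed.

Lemma quotientZ O (a : osec O) (s : msec G O) q m (c : den q) (b : A) (d : den q)
    h (hO : culoc fo h `<=` O) : basic h q ->
  ores (@culoc_sub _ _ _ fo h) (gl (sval d)) * ores hO a = ores (@culoc_sub _ _ _ fo h) (gl b) ->
  quotient_at s m c -> quotient_at (a *: s) (gl b *: m) (denM d c).
Proof.
move=> hq ea [W [WO [WU [Wq e]]]].
exists (capo (culoc fo h) W), (subset_trans (@capoL _ _ W) hO),
  (subset_trans (@capoL _ _ W) (@culoc_sub _ _ _ fo h)).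
split; first by split => //; exact/uset_gl_f.
rewrite rmorphM rmorphM !mresZ -!(oresE (@culoc_sub _ _ _ fo h)) -ea rmorphM.
rewrite (mres_irr (subset_trans _ (@culoc_sub _ _ _ fo h)) (subset_trans (@capoR _ (culoc fo h) W) WU)).
rewrite -(mresE WU) -e mresZ !mresE !oresE scalerA scalerA.
rewrite (mres_irr (subset_trans (@capoR _ _ W) WO) (subset_trans (@capoL _ _ W) hO)).
rewrite (ores_irr (subset_trans (@capoR _ _ W) WU) (subset_trans (@capoL _ _ W) (@culoc_sub _ _ _ fo h))).
by congr (_ *: _); ring.
Qed.

Lemma chart_fracZ O V (VO : V `<=` f @^-1` O) (a : osec O) (s : msec G O) :
  chart_frac VO (a *: s) = (msharp VO a : spec_sec V) *: chart_frac VO s.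
Proof.
apply: tilde_ext => -[q Vq].
have [m [c qs]] := quotient_exists s (VO q Vq).
have [b [d [h [hO [hq ea eb]]]]] := gl_frac fo a VO Vq.
rewrite (chart_fracE VO Vq (quotientZ hq ea qs)).
change (frac (lam (gl b *: m)) (denM d c) =
  sval_at (msharp VO a) (exist _ q Vq) *: chart_frac VO s (exist _ q Vq)).
by rewrite eb (chart_fracE VO Vq qs) fracZ lamZ.
Qed.

Lemma chart_frac_res O O' V V' (VO : V `<=` f @^-1` O) (VO' : V' `<=` f @^-1` O')
    (OO : O' `<=` O) (VV : V' `<=` V) (s : msec G O) :
  chart_frac VO' (mres OO s) = tilde_res VV (chart_frac VO s).
Proof.
apply: tilde_ext => -[q Vq].
have [m [c qs]] := quotient_exists s (VO q (VV q Vq)).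
rewrite (chart_fracE VO' Vq (quotient_res OO (VO' q Vq) qs)).
by rewrite -(chart_fracE VO (VV q Vq) qs).
Qed.

(** If m/c = 0 with m a section over the chart, then m is killed by some u outside
    of the prime, and the section vanishes where u and c are units. *)
Lemma chart_frac_inj O V (VO : V `<=` f @^-1` O) :
  injective lam -> O `<=` oim fo V -> injective (chart_frac VO).
Proof.
move=> lamI OV; suff ker s : chart_frac VO s = 0 -> s = 0.
  move=> s t est; apply/eqP; rewrite -subr_eq0; apply/eqP; apply: ker.
  have := chart_fracD VO (s - t) t; rewrite subrK est => e.
  by apply: (addIr (chart_frac VO t)); rewrite add0r -e.
move=> s0; apply: omod_sep => _ /OV[q Vq <-].
have [m [c qs]] := quotient_exists s (VO q Vq).
have := chart_fracE VO Vq qs; rewrite s0 /= => /esym/frac_eq0[u eu].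
have um : gl (sval u) *: m = 0 by apply: lamI; rewrite lamZ eu raddf0.
have [W [WO [WU [Wq e]]]] := qs.
have uc : basic (sval u * sval c) q by apply/basicM; split; exact: den_basic.
pose N := capo W (culoc fo (sval u * sval c)).
exists N, (subset_trans (@capoL _ _ _) WO); split.
  by split => //; exact/uset_gl_f.
apply: (unit_scaleI (a := gl (sval u * sval c)) (VU := subset_trans (@capoL _ _ _) WU)).
  exact: capoR.
rewrite -mresE raddf0 scaler0 rmorphM rmorphM -scalerA -[ores _ (gl (sval c))]oresE.
by rewrite -mresZ e mresE -mresZ um raddf0.
Qed.

(** Where the target is a fraction m/c, it comes from c^-1 times a global
    section; these local preimages are unique, hence glue. *)
Lemma chart_frac_surj O V (VO : V `<=` f @^-1` O) :
  bijective lam -> O `<=` oim fo V -> forall t, exists s, chart_frac VO s = t.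
Proof.
move=> lamB OV t.
have [g gK Kg] := lamB.
pose Phi (O' : opens X) (s : msec G O') :=
  exists (O'O : O' `<=` O), forall q (Vq : V q) (Oq : O' (f q)),
    chart_val s Oq = t (exist _ q Vq).
have loc x : O x -> exists O' : opens X, [/\ O' `<=` O, O' x & exists s, Phi O' s].
  move=> Ox; have [q Vq <-{x Ox}] := OV x Ox.
  have [m [c [h [hq hV e]]]] := sec_near t Vq.
  have cq : basic c q by have [hc _] := e (exist _ q Vq) hq; rewrite notin_setE in hc.
  have NO : culoc fo (h * c) `<=` O.
    by move=> _ /uset_gl[q' /basicM[/hV Vq' _] <-]; exact: VO.
  have NU := @culoc_sub _ _ _ fo (h * c).
  have [|u eu] := @unit_on X cimg (culoc fo (h * c)) NU (gl c).
    by move=> _ /uset_gl[q' /basicM[_ cq'] <-]; exact/uset_gl_f.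
  exists (culoc fo (h * c)); split => //.
    by apply/uset_gl_f; apply/basicM.
  exists (u *: mres NU (g m)), NO => q' Vq' Nq'.
  have [hq' cq'] : basic h q' /\ basic c q'.
    by apply/basicM; apply/(uset_gl_f fo).
  have [hc ->] := e (exist _ q' Vq') hq'.
  rewrite (@chart_valE _ _ _ _ (g m) (Sub c hc)) ?Kg //.
  exists (culoc fo (h * c)), (@subset_refl _ _), NU; split => //.
  by rewrite mres_id scalerA [_ * u]mulrC eu scale1r.
have [|||s sP] := @omod_glue X G O Phi => //.
- move=> O1 O2 O21 s O1O [_ h]; exists (subset_trans O21 O1O) => q Vq Oq.
  rewrite -(h q Vq (O21 _ Oq)).
  have [m [c qs]] := quotient_exists s (O21 _ Oq).
  by rewrite (chart_valE (O21 _ Oq) qs) (chart_valE Oq (quotient_res O21 Oq qs)).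
- move=> O' s s' _ [O'O h] [_ h'].
  pose V' : opens (Spec A) := capo V (mpre f O').
  have VO' : V' `<=` f @^-1` O' by move=> q [].
  apply: (chart_frac_inj (VO := VO') (bij_inj lamB)).
    by move=> x O'x; have [q Vq eq] := OV x (O'O x O'x); exists q => //; split=> //=; rewrite eq.
  by apply: tilde_ext => -[q [Vq Oq]]; rewrite /= (h q Vq) (h' q Vq).
exists s; apply: tilde_ext => -[q Vq].
have [O' [O'O Oq [s' Phis']]] := loc (f q) (VO q Vq).
have [_ /(_ q Vq Oq) <-] := Phis'.
have [m [c qs]] := quotient_exists s' Oq.
rewrite (chart_valE Oq qs); apply: chart_fracE; apply: (quotient_res_inv (OO := O'O)).
by rewrite (sP _ O'O _ Phis').
Qed.

(** The map G -> f_* M~ which on sections over the image of f is lam: this is the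
    inverse of the bijection Hom(G, f_* M~) -> Hom_A(G(U), M), for U the image
    of f. *)
Definition chart_hom_fun (O : opens X) (s : msec G O) : msec (push f (tilde M)) O :=
  chart_frac (@mpre_sub _ _ f O) s.

Lemma chart_hom_linear O (a : osec O) (s t : msec G O) :
  chart_hom_fun (a *: s + t) = a *: chart_hom_fun s + chart_hom_fun t.
Proof. by rewrite /chart_hom_fun chart_fracD chart_fracZ. Qed.

Lemma chart_hom_res (U V : opens X) (VU : V `<=` U) (s : msec G U) :
  chart_hom_fun (mres VU s) = mres VU (chart_hom_fun s).
Proof. exact: chart_frac_res. Qed.

Definition chart_hom : omod_hom G (push f (tilde M)) :=
  mkhom chart_hom_linear chart_hom_res.

Lemma chart_homE O (s : msec G O) q (Oq : O (f q)) m (c : den q) :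
  quotient_at s m c ->
  (chart_hom O s : tilde_sec M (mpre f O)) (exist _ q Oq) = frac (lam m) c.
Proof. exact: (chart_fracE (@mpre_sub _ _ f O)). Qed.

End ChartMaps.

Section Quasicoherence.
Variable X : scheme.
Hypothesis nX : noeth_top X.

(** On a chart U the identity of G(U) induces an isomorphism from G to the sheaf
    of the module G(U), whose injectivity and surjectivity are the two parts of
    the localization property. *)
Theorem localizing_qcoh (G : omod X) : localizing G -> is_qcoh G.
Proof.
move=> Gloc x; have [A [f [fo xf]]] := schemeP x.
pose M : lmodType A := rscal (gl fo) (msec G (cimg fo)).
pose lam : {linear M -> M} := idfun.
have lamB : bijective lam by exists id.
exists A, f, fo, M; split => //.
exists (fun U => chart_frac Gloc lam (@oi_image_sub _ _ _ fo U)); split.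
- move=> U; apply: inj_surj_bij.
    by apply: chart_frac_inj; [exact: bij_inj|].
  by move=> t; apply: chart_frac_surj.
- by move=> U s t; exact: chart_fracD.
- by move=> U a s; exact: chart_fracZ.
- by move=> U V VU s; exact: chart_frac_res.
Qed.

(** The opens of the chart are opens of X. *)
Lemma noeth_spec (A : comPzRingType) (f : rs_morphism (Spec A) X) :
  open_immersion f -> noeth_top (primeSpec A).
Proof.
move=> fo Phi P0 PU PS W loc.
pose Psi (B : opens X) := Phi (mpre f B).
have : Psi (oim fo W).
  apply: nX.
  - exact: PS P0.
  - by move=> B C PB PC; apply: PS (PU _ _ PB PC).
  - by move=> B C BC; apply: PS => q; exact: (BC (f q)).
  move=> _ [q Wq <-]; have [V [Vq PV]] := loc q Wq.
  exists (oim fo V); split; first by exists q.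
  by apply: PS PV => q'; exact: oim_pre.
by apply: PS => q Wq; exists q.
Qed.

(** The localization property is local, and near each point G is the sheaf of a
    module. *)
Theorem qcoh_localizing (G : omod X) : is_qcoh G -> localizing G.
Proof.
move=> qG.
have tor : torsion_off_uloc G.
  apply: torsion_local => // O O' OO a s aO s0 x Ox.
  have [A [f [fo [M [[q _ qx] [psi [psiB psiD psiZ psiR]]]]]]] := qG x.
  have [torM _] := tilde_localizing M (noeth_spec fo).
  pose V := mpre f O; pose V' := mpre f O'.
  have NO : oi_image fo V `<=` O by move=> _ [y Vy <-].
  have psi0 U : psi U 0 = 0.
    by apply: (addIr (psi U 0)); rewrite -psiD !add0r.
  have psiX U (b : osec (oi_image fo U)) k z :
      psi U (b ^+ k *: z) = msharp (@oi_image_sub _ _ _ fo U) b ^+ k *: psi U z.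
    by rewrite psiZ rmorphXn.
  pose b := ores NO a.
  have [||k ek] := torM V V' (mpreS OO) (msharp (@oi_image_sub _ _ _ fo V) b) (psi V (mres NO s)).
  - move=> y [Vy /(local_germ_unit _ _ (open_immersion_local fo) Vy)].
    by move=> g; apply: aO; split => //; exact: germ_unit_res_inv g.
  - rewrite -psiR mresE.
    have NO' : oi_image fo V' `<=` O' by move=> _ [y Vy <-].
    by rewrite (mres_irr _ (subset_trans NO' OO)) -mresE s0 raddf0 psi0.
  exists (oi_image fo V), NO; split; first by exists q => //; rewrite /= qx.
  exists k; rewrite rmorphXn; apply: (bij_inj (psiB V)).
  by rewrite psiX psi0.
split=> //; apply: extends_local => // O O' OO a t O'a aO x Ox.
have [A [f [fo [M [[q _ qx] [psi [psiB psiD psiZ psiR]]]]]]] := qG x.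
have [_ extM] := tilde_localizing M (noeth_spec fo).
pose V := mpre f O; pose V' := mpre f O'.
have NO : oi_image fo V `<=` O by move=> _ [y Vy <-].
have NO' : oi_image fo V' `<=` O' by move=> _ [y Vy <-].
pose b := ores NO a.
have [||k [s es]] := extM V V' (mpreS OO) (msharp (@oi_image_sub _ _ _ fo V) b) (psi V' (mres NO' t)).
- move=> y V'y; split; first exact: (OO _ V'y).
  apply/(local_germ_unit _ _ (open_immersion_local fo)); first exact: (OO _ V'y).
  apply: germ_unit_res; first by exists y => //; exact: (OO _ V'y).
  by case: (O'a _ V'y).
- move=> y [Vy /(local_germ_unit _ _ (open_immersion_local fo) Vy) g].
  by apply: aO; split => //; exact: germ_unit_res_inv g.
exists (oi_image fo V), NO; split; first by exists q => //; rewrite /= qx.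
have [psi' psiK Kpsi] := psiB V.
exists k, (psi' s).
have VO' : capo (oi_image fo V) O' `<=` oi_image fo V'.
  by move=> _ [[y Vy <-] O'y]; exists y.
rewrite (mres_irr _ (subset_trans VO' (oi_imageS (mpreS OO)))) -mresE.
have -> : mres (oi_imageS (mpreS OO)) (psi' s) =
    ores (oi_imageS (mpreS OO)) (b ^+ k) *: mres NO' t.
  apply: (bij_inj (psiB V')); rewrite psiR Kpsi es psiZ -rmorphXn.
  by rewrite (msharp_res (@oi_image_sub _ _ _ fo V) (@oi_image_sub _ _ _ fo V')
    (oi_imageS (mpreS OO)) (mpreS OO)).
rewrite mresZ !mresE /b -rmorphXn !oresE.
rewrite (mres_irr (subset_trans VO' NO') (@capoR _ _ _)).
by rewrite (ores_irr (subset_trans _ _) (subset_trans (@capoL _ _ _) NO)).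
Qed.

End Quasicoherence.

(** * Noetherian schemes *)

Record chart (X : scheme) := Chart {
  cring : comPzRingType;
  cmor : rs_morphism (Spec cring) X;
  cimm : open_immersion cmor }.

Definition copen (X : scheme) (c : chart X) : opens X := cimg (cimm c).

Section NoetherianSchemes.
Variable X : scheme.
Hypothesis hX : is_noetherian X.

(** Quasi-compactness reduces the induction principle to finitely many charts,
    which are noetherian spectra. *)
Lemma noetherian_scheme : noeth_top X.
Proof.
move=> Phi P0 PU PS W loc; have [Xc Xn] := hX.
have h x : exists N : opens X, N x /\ Phi (capo W N).
  have [A [f [nA fo [q _ qx]]]] := Xn x.
  exists (cimg fo); split; first by rewrite -qx; exact: cimg_f.
  suff : Phi (oim fo (mpre f W)).
    by apply: PS => y [Wy /cimgP[q' qy]]; exists q' => //; rewrite /= qy.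
  apply: (noetherian_spec nA (Phi := fun B => Phi (oim fo B))).
  - by apply: PS P0 => y [q' []].
  - move=> B C PB PC; apply: PS (PU _ _ PB PC).
    by move=> y [q' [Bq|Cq] <-]; [left|right]; exists q'.
  - by move=> B C BC; apply: PS; exact: oimS.
  move=> q' Wq'; have [V [Vq' PV]] := loc (f q') Wq'.
  exists (mpre f V); split => //; apply: PS PV.
  by move=> _ [y Vy <-].
have /choice[N hN] := h.
have [||D _ Dcov] := Xc X setT (fun x => N x).
- by move=> x _; exact: oset_open.
- by move=> x _; exists x => //; case: (hN x).
have fin (l : seq X) : exists B : opens X, Phi (capo W B) /\ forall x, x \in l -> N x `<=` B.
  elim: l => [|x l [B [PB lB]]]; first by exists (botO X); split => //; apply: PS P0 => y [].
  exists (cupo (N x) B); split.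
    have [_ Px] := hN x; apply: PS (PU _ _ Px PB) => y [Wy [Ny|By]]; by [left|right].
  by move=> y; rewrite inE => /orP[/eqP->|/lB yB]; [left|move=> z /yB; right].
have [B [PB DB]] := fin (finmap.enum_fset D).
apply: PS PB => y Wy; split => //.
by have [x xD Ny] := Dcov y I; exact: (DB x xD).
Qed.

(** Being covered by finitely many charts is a property of opens to which
    the induction principle applies. *)
Lemma finite_charts : exists n (c : 'I_n -> chart X), forall x, exists i, copen (c i) x.
Proof.
pose Phi (B : opens X) := exists n (c : 'I_n -> chart X), forall x, B x ->
  exists i, copen (c i) x.
have [|||| n [c cP]] := @noetherian_scheme Phi _ _ _ (topO X).
- have c0 : 'I_0 -> chart X by case.
  by exists 0%N, c0 => x [].
- move=> A B [n [c cA]] [m [d dB]].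
  exists (n + m)%N, (fun i => match fintype.split i with inl j => c j | inr j => d j end).
  move=> x [/cA[i xi]|/dB[i xi]].
    by exists (lshift m i); rewrite (unsplitK (inl i)).
  by exists (rshift n i); rewrite (unsplitK (inr i)).
- by move=> A B AB [n [c cB]]; exists n, c => x /AB/cB.
- move=> x _; have [A [f [fo [q _ qx]]]] := schemeP x.
  exists (cimg fo); split; first by rewrite -qx; exact: cimg_f.
  by exists 1%N, (fun=> Chart fo) => y Uy; exists ord0.
by exists n, c => x; exact: cP.
Qed.

End NoetherianSchemes.

(** * Opens with exact sections *)

Section ExactSections.
Variable X : ringedSpace.

(** The part of affineness that is needed, in terms of ideals of functions: an
    ideal is everything as soon as it locally contains powers of all functions
    with small unit locus. For W = Spec A, an ideal J other than A lies in a
    prime p, and a function outside of p has no power in J, however small its unit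
    locus is around p. *)
Definition affine_like (W : opens X) : Prop :=
  forall J : set (osec W), is_ideal J ->
  (forall x, W x -> exists V : opens X, V x /\
     forall r : osec W, uset r `<=` V -> exists k, J (r ^+ k)) ->
  J 1.

(** The functions a such that a s lifts along phi form an ideal. Near each point
    a lift t of s exists on some V, and for r with unit locus in V a multiple of t
    by a power of r extends and lifts r^k s up to torsion. *)
Lemma affine_like_lift (F G : omod X) (phi : omod_hom F G) (W : opens X) (s : msec G W) :
  affine_like W -> extends_off_uloc F -> torsion_off_uloc G ->
  (forall x, W x -> exists (V : opens X) (VW : V `<=` W) (t : msec F V),
     V x /\ phi V t = mres VW s) ->
  exists t, phi W t = s.
Proof.
move=> aW extF torG loc.
suff [t et] : [set a | exists t, phi W t = a *: s] 1 by exists t; rewrite et scale1r.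
apply: aW.
  split.
  - by exists 0; rewrite raddf0 scale0r.
  - by move=> a b [t et] [t' et']; exists (t + t'); rewrite linearD et et' scalerDl.
  - by move=> a b [t et]; exists (a *: t); rewrite linearZZ et scalerA.
move=> x Wx; have [V [VW [t [Vx et]]]] := loc x Wx.
exists V; split => // r rV.
have [||k [t' et']] := extF W (uloc r) (@uloc_sub _ _ _) r (mres (rV : uloc r `<=` V) t) => //.
have [||j ej] := torG W (uloc r) (@uloc_sub _ _ _) r (phi W t' - r ^+ k *: s) => //.
  rewrite raddfB -hres et' linearZZ hres et mresE mresZ.
  by rewrite (mres_irr _ (@uloc_sub _ _ r)) subrr.
exists (j + k)%N; exists (r ^+ j *: t'); rewrite linearZZ.
by apply/eqP; rewrite exprD -scalerA -subr_eq0 -scalerBr ej.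
Qed.

End ExactSections.

Lemma chart_affine_like (X : scheme) (c : chart X) : affine_like (copen c).
Proof.
case: c => A f fo J iJ loc; rewrite /copen /= in J iJ loc *.
apply: contrapT => J1.
have [||p [Jp _]] := @prime_avoiding A [set a | J (gl fo a)] 1.
- split => /=; first by rewrite rmorph0; exact: (ideal0 iJ).
    by move=> a b Ja Jb; rewrite rmorphD; exact: (idealD iJ).
  by move=> a b Jb; rewrite rmorphM; exact: (idealM iJ).
- by move=> k /=; rewrite expr1n rmorph1.
have [V [Vp JV]] := loc (f p) (cimg_f fo p).
have [a [ap aV]] := gl_basis fo Vp.
have [k Jk] := JV (gl fo a) aV.
by apply: (@basicX A a k p ap); apply: Jp; rewrite /= rmorphXn.
Qed.

(** * Products of quasi-coherent sheaves *)

Section StalkMap.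
Variables (A : comPzRingType) (M N : lmodType A) (u : {linear M -> N}).

Definition loc_map (p : primeSpec A) (x : loc p M) : loc p N :=
  frac (u (repr x).1) (repr x).2.

Lemma loc_mapE p (m : M) (s : den p) : loc_map (frac m s) = frac (u m) s.
Proof.
rewrite /loc_map; have /fracP[v] := frac_repr (frac m s).
move: (repr _) => [m' s'] /= e; apply/fracP; exists v.
by have := congr1 u e; rewrite !(linearZZ u).
Qed.

Lemma loc_mapD p (x y : loc p M) : loc_map (x + y) = loc_map x + loc_map y.
Proof.
elim/frac_ind: x => m s; elim/frac_ind: y => n t.
by rewrite fracD !loc_mapE fracD linearD !linearZZ.
Qed.

Lemma loc_mapZ p (a : locRing p) (x : loc p M) : loc_map (a *: x) = a *: loc_map x.
Proof.
elim/rfrac_ind: a => a s; elim/frac_ind: x => m t.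
by rewrite fracZ !loc_mapE fracZ linearZZ.
Qed.

Lemma tilde_map_subproof (U : opens (primeSpec A)) (s : tilde_sec M U) :
  locally_frac (fun q : {p | U p} => loc_map (s q)).
Proof.
move=> p /(tvalP s)[V [Vp [m [c e]]]]; exists V; split => //.
by exists (u m), c => q /e[hc ->]; exists hc; exact: loc_mapE.
Qed.

Definition tilde_map_fun (U : opens (Spec A)) (s : msec (tilde M) U) : msec (tilde N) U :=
  TildeSec (tilde_map_subproof s).

Lemma tilde_map_linear U (a : osec U) (s t : msec (tilde M) U) :
  tilde_map_fun (a *: s + t) = a *: tilde_map_fun s + tilde_map_fun t.
Proof.
apply: tilde_ext => q; apply: (etrans (loc_mapD _ _)).
by rewrite [loc_map _]loc_mapZ.
Qed.

Definition tilde_map : omod_hom (tilde M) (tilde N).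
Proof. by apply: (mkhom tilde_map_linear) => U V VU s; apply: tilde_ext. Defined.

End StalkMap.

Section PushHom.
Variables (Y X : ringedSpace) (f : rs_morphism Y X) (G H : omod Y) (u : omod_hom G H).

Definition push_hom_fun (U : opens X) (s : msec (push f G) U) : msec (push f H) U :=
  u (mpre f U) s.

Lemma push_hom_linear U (a : osec U) (s t : msec (push f G) U) :
  push_hom_fun (a *: s + t) = a *: push_hom_fun s + push_hom_fun t.
Proof. exact: linearP. Qed.

Definition push_hom : omod_hom (push f G) (push f H).
Proof. by apply: (mkhom push_hom_linear) => U V VU s; exact: (hres u (mpreS VU)). Defined.

End PushHom.

Section HomInverse.
Variables (X : ringedSpace) (M N : omod X) (u : omod_hom M N).
Hypothesis ub : forall U, bijective (u U).

Definition hom_inv_fun U (y : msec N U) : msec M U :=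
  sval (cid (let: Bijective g _ gK := ub U in ex_intro (fun x => u U x = y) (g y) (gK y))).

Lemma hom_inv_funK U (y : msec N U) : u U (hom_inv_fun y) = y.
Proof. by rewrite /hom_inv_fun; case: cid. Qed.

Lemma hom_inv_linear U (a : osec U) (s t : msec N U) :
  hom_inv_fun (a *: s + t) = a *: hom_inv_fun s + hom_inv_fun t.
Proof. by apply: (bij_inj (ub U)); rewrite linearP !hom_inv_funK. Qed.

Definition hom_inv : omod_hom N M.
Proof.
apply: (mkhom hom_inv_linear) => U V VU s.
by apply: (bij_inj (ub V)); rewrite hres !hom_inv_funK.
Defined.

Lemma hom_invK U (y : msec N U) : u U (hom_inv U y) = y.
Proof. exact: hom_inv_funK. Qed.

End HomInverse.

Section QcohProduct.
Variables (X : scheme) (I : Type).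

(** The universal property of the product in the category of quasi-coherent
    sheaves: only quasi-coherent test objects Q are allowed. *)
Record is_qprod (G : I -> omod X) (Pi : omod X) (pi : forall i, omod_hom Pi (G i)) : Prop :=
  IsQprod {
  qprod_ex : forall (Q : qcoh X) (q : forall i, omod_hom Q (G i)),
    exists u : omod_hom Q Pi, forall i U s, pi i U (u U s) = q i U s;
  qprod_uniq : forall (Q : qcoh X) (u v : omod_hom Q Pi),
    (forall i U s, pi i U (u U s) = pi i U (v U s)) -> forall U s, u U s = v U s }.

(** F is the direct image of its restriction to U. *)
Definition local_on (U : opens X) (F : omod X) : Prop :=
  forall V, bijective (mres (@capoL _ V U) : msec F V -> msec F (capo V U)).

Hypothesis nX : noeth_top X.
Variables (A : comPzRingType) (f : rs_morphism (Spec A) X) (fo : open_immersion f).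
Variable G : I -> omod X.
Hypothesis Gloc : forall i, localizing (G i).
Hypothesis Gon : forall i, local_on (cimg fo) (G i).
Local Notation cimg := (cimg fo).

Let Mi i : lmodType A := rscal (gl fo) (msec (G i) cimg).
Let M : lmodType A := dprodm Mi.
Let Pi : omod X := push f (tilde M).

Let proj_fun i (m : M) : Mi i := m i.
Let proj_linear i : linear (@proj_fun i). Proof. by []. Qed.
HB.instance Definition _ i := GRing.isLinear.Build A M (Mi i) *:%R (@proj_fun i) (@proj_linear i).

Let psi i : omod_hom (G i) (push f (tilde (Mi i))) :=
  chart_hom (Gloc i) (idfun : {linear Mi i -> Mi i}).

Let psi_bij i V : bijective (psi i V).
Proof.
have lamB : bijective (idfun : {linear Mi i -> Mi i}) by exists id.
have VO : mpre f V `<=` f @^-1` capo V cimg by move=> q Vq; split => //; exact: cimg_f.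
have OV : capo V cimg `<=` oim fo (mpre f V).
  by move=> x [Vx /cimgP[q qx]]; exists q => //; rewrite /= qx.
have e s : psi i V s = chart_frac (Gloc i) idfun VO (mres (@capoL _ V cimg) s).
  rewrite (chart_frac_res (Gloc i) idfun (@mpre_sub _ _ f V) VO (@capoL _ V cimg) (@subset_refl _ _)).
  by rewrite tilde_res_id.
have [g gK Kg] := Gon i V.
apply: inj_surj_bij => [s t|t].
  rewrite !e => /(chart_frac_inj (bij_inj lamB) OV) est.
  exact: (can_inj gK).
have [s es] := chart_frac_surj (Gloc i) VO lamB OV t.
by exists (g s); rewrite e Kg.
Qed.

Let tl i : omod_hom Pi (push f (tilde (Mi i))) :=
  push_hom f (tilde_map (@proj_fun i : {linear M -> Mi i})).

Let pi i : omod_hom Pi (G i) := hom_comp (hom_inv (psi_bij i)) (tl i).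

Let psi_pi i V s : psi i V (pi i V s) = tl i V s.
Proof. exact: hom_invK. Qed.

Let nA := noeth_spec nX fo.

Let global_sec (z : msec Pi cimg) : exists n : M, forall q : {q | mpre f cimg q},
  (z : tilde_sec M (mpre f cimg)) q = frac n (den1 (sval q)).
Proof.
have T : basic 1 `<=` mpre f cimg by move=> q _; exact: cimg_f.
have [k [n e]] := section_on_basic nA (z : tilde_sec M (mpre f cimg)) T.
exists n => q; have [|h ->] := e q; first exact: pideal1.
by apply: frac_eq; rewrite /= expr1n.
Qed.

Let joint_inj (z z' : msec Pi cimg) : (forall i, tl i cimg z = tl i cimg z') -> z = z'.
Proof.
have [n en] := global_sec z; have [n' en'] := global_sec z'.
move=> e; apply: tilde_ext => q; rewrite en en'; congr (frac _ _).
apply: dprodm_ext => i.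
have [|k] := @vanish_on_basic A (Mi i) 1 (n i - n' i).
  move=> p _.
  have := congr1 (fun s : tilde_sec (Mi i) (mpre f cimg) => s (exist _ p (cimg_f fo p))) (e i).
  rewrite /= en en' !loc_mapE => /fracP[v /= ev]; exists v.
  by move: ev; rewrite !scale1r scalerBr => ->; rewrite subrr.
by rewrite expr1n scale1r => /eqP; rewrite subr_eq0 => /eqP.
Qed.

Let quotient_hom (Q : omod X) (Qloc : localizing Q) (H : omod X) (u : omod_hom Q H) O
    (s : msec Q O) q (m : msec Q cimg) (c : den q) : quotient_at s m c -> quotient_at (u O s) (u cimg m) c.
Proof.
move=> [W [WO [WU [Wq e]]]]; exists W, WO, WU; split => //.
by rewrite -!hres -linearZZ e.
Qed.

(** The product is the direct image of the sheaf associated to the product of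
    the modules G_i(U), for U the image of f: the maps from Q to this direct image
    are the linear maps from Q(U) to the product of modules, hence the families of
    linear maps Q(U) -> G_i(U), and these are the families of maps Q -> G_i. *)
Theorem chart_product : exists (Pi : qcoh X) (pi : forall i, omod_hom Pi (G i)),
  [/\ is_qprod pi, local_on cimg Pi,
      forall z z' : msec Pi cimg, (forall i, pi i cimg z = pi i cimg z') -> z = z' &
      forall n : forall i, msec (G i) cimg, exists z, forall i, pi i cimg z = n i].
Proof.
have Pq : is_qcoh Pi.
  apply: localizing_qcoh; apply: push_localizing.
    exact: open_immersion_local.
  exact: tilde_localizing.
exists (Qcoh Pq), pi; split.
- split.
  + move=> Q q; have Qloc := qcoh_localizing nX (qcohP Q).
    pose lamf (m : rscal (gl fo) (msec Q cimg)) : M := fun i => q i cimg m.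
    have lamL : linear lamf.
      by move=> a s t; apply: dprodm_ext => i; rewrite /lamf linearD linearZZ.
    pose lamH := GRing.isLinear.Build _ _ _ _ lamf lamL.
    pose lam : {linear rscal (gl fo) (msec Q cimg) -> M} := HB.pack lamf lamH.
    exists (chart_hom Qloc lam) => i U s.
    apply: (bij_inj (psi_bij i U)); rewrite psi_pi.
    apply: tilde_ext => -[p Up].
    have [m [c qs]] := quotient_exists fo Qloc s Up.
    have e1 := chart_homE Qloc lam Up qs.
    have e2 := chart_homE (Gloc i) (idfun : {linear Mi i -> Mi i}) Up (quotient_hom Qloc (q i) qs).
    rewrite [RHS]e2; rewrite /= in e1 *.
    by rewrite e1 loc_mapE.
  + move=> Q u v uv U s; have Qloc := qcoh_localizing nX (qcohP Q).
    have tluv i V t : tl i V (u V t) = tl i V (v V t) by rewrite -!psi_pi uv.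
    apply: tilde_ext => -[p Up].
    have [m [c [W [WU [Wc [Wp e]]]]]] := quotient_exists fo Qloc s Up.
    have h (w : omod_hom Q Pi) : rfrac (sval c) (den1 p) *: (w U s : tilde_sec M (mpre f U)) (exist _ p Up) =
        (w cimg m : tilde_sec M (mpre f cimg)) (exist _ p (cimg_f fo p)).
      have := congr1 (w W) e; rewrite linearZZ !hres rscalE (msharp_res (@mpre_sub _ _ f cimg) (@mpre_sub _ _ f W) Wc (mpreS Wc)).
      rewrite glE => /(congr1 (fun z : tilde_sec M (mpre f W) => z (exist _ p Wp))) ew.
      have Wp1 : mpre f cimg p := @mpreS _ _ f _ _ Wc p Wp.
      have Wp2 : mpre f U p := @mpreS _ _ f _ _ WU p Wp.
      rewrite (tval_irr (w cimg m : tilde_sec M (mpre f cimg)) _ (@mpreS _ _ f _ _ Wc p Wp)).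
      rewrite (tval_irr (w U s : tilde_sec M (mpre f U)) _ (@mpreS _ _ f _ _ WU p Wp)).
      rewrite -[RHS]ew.
      change (rfrac (sval c) (den1 p) *:
          (w U s : tilde_sec M (mpre f U)) (exist _ p (@mpreS _ _ f _ _ WU p Wp)) =
        sval_at (csec (mpre f cimg) (sval c)) (exist _ p (@mpreS _ _ f _ _ Wc p Wp)) *:
          (w U s : tilde_sec M (mpre f U)) (exist _ p (@mpreS _ _ f _ _ WU p Wp))).
      by rewrite csec_at.
    apply: (@loc_scaleI _ _ p c); rewrite !h.
    have -> // : u cimg m = v cimg m by apply: joint_inj.
- move=> V; have VV : mpre f V `<=` mpre f (capo V cimg) by move=> q Vq; split => //; exact: cimg_f.
  exists (fun s : msec Pi (capo V cimg) => tilde_res VV s) => s; apply: tilde_ext => -[p h];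
    exact: (tval_irr (s : tilde_sec M _)).
- by move=> z z' e; apply: joint_inj => i; rewrite -!psi_pi e.
- move=> n; pose nM : M := n.
  exists (fracsec nM (@basic1 A (mpre f cimg))) => i.
  apply: (bij_inj (psi_bij i cimg)); rewrite psi_pi; apply: tilde_ext => -[p Up].
  rewrite /= loc_mapE.
  have := chart_frac_global (Gloc i) (idfun : {linear Mi i -> Mi i}) (@mpre_sub _ _ f cimg) (n i) Up.
  by move=> /= ->; apply: frac_eq.
Qed.

End QcohProduct.

(** * Morphisms of affine schemes *)

Lemma primeSpec_ext (A : comPzRingType) (p q : primeSpec A) :
  (forall a, p a <-> q a) -> p = q.
Proof.
case: p => p p0 pD pM p1 pp; case: q => q q0 qD qM q1 qp /= e.
have pq : p = q by apply/seteqP; split => a /e.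
by subst q; f_equal; exact: Prop_irrelevance.
Qed.

Lemma ores_bij (X : ringedSpace) (U V : opens X) (VU : V `<=` U) :
  U `<=` V -> bijective (ores VU).
Proof.
move=> UV; exists (ores UV) => s; rewrite oresE.
  by rewrite (ores_irr _ (@subset_refl _ _)) ores_id.
by rewrite (ores_irr _ (@subset_refl _ _)) ores_id.
Qed.

Section SpecScheme.
Variable A : comPzRingType.

Lemma spec_id_immersion : open_immersion (rs_id (Spec A)).
Proof.
split=> //.
- by move=> U; rewrite image_id; exact: oset_open.
- by move=> V U UV; rewrite image_id => e; apply: ores_bij; rewrite e.
Qed.

Lemma spec_is_scheme : is_scheme (Spec A).
Proof. by move=> x; exists A, (rs_id (Spec A)); split; [exact: spec_id_immersion|exists x]. Qed.

Definition SpecS : scheme := Scheme spec_is_scheme.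

End SpecScheme.

Section SpecMap.
Variables (A B : comPzRingType) (phi : {rmorphism A -> B}).

Definition spec_pt (q : primeSpec B) : primeSpec A.
Proof.
apply: (@PrimeSpec A [set a | q (phi a)]) => /=.
- by rewrite rmorph0; exact: pideal0.
- by move=> a b qa qb; rewrite rmorphD; exact: pidealD.
- by move=> a b qb; rewrite rmorphM; exact: pidealM.
- by rewrite rmorph1; exact: pideal1.
- by move=> a b; rewrite rmorphM; exact: pideal_prime.
Defined.

Lemma spec_pt_cont : continuous (spec_pt : Spec B -> Spec A).
Proof.
apply/continuousP => U [E ->]; exists (phi @` E); apply/seteqP; split=> q /=.
  by move=> nE Eq; apply: nE => a Ea; apply: Eq; exists a.
by move=> nE Eq; apply: nE => _ [a /Eq qa <-].
Qed.

Definition den_map (q : primeSpec B) (s : den (spec_pt q)) : den q :=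
  Sub (phi (sval s)) (basic_denP (den_basic s : basic (phi (sval s)) q)).

Definition rloc (q : primeSpec B) (x : locRing (spec_pt q)) : locRing q :=
  rfrac (phi (repr x).1) (den_map (repr x).2).

Lemma rlocE (q : primeSpec B) a (s : den (spec_pt q)) :
  rloc (rfrac a s) = rfrac (phi a) (den_map s).
Proof.
rewrite /rloc; have /rfracP[v] := rfrac_repr (rfrac a s).
move: (repr _) => [a' s'] /= e; apply/rfracP; exists (den_map v) => /=.
by rewrite -!rmorphM e.
Qed.

Lemma rlocB (q : primeSpec B) : zmod_morphism (@rloc q).
Proof.
elim/rfrac_ind => a s; elim/rfrac_ind => b t.
have -> : - rfrac b t = rfrac (- b) t by exact: (@fracN _ _ A^o).
rewrite rfracD !rlocE.
have -> : - rfrac (phi b) (den_map t) = rfrac (- phi b) (den_map t) by exact: (@fracN _ _ B^o).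
by rewrite rfracD; apply: rfrac_eq; rewrite /= rmorphD !rmorphM rmorphN.
Qed.

Lemma rlocM (q : primeSpec B) : monoid_morphism (@rloc q).
Proof.
split; first by rewrite -rfrac1 rlocE -rfrac1; apply: rfrac_eq; rewrite /= rmorph1.
elim/rfrac_ind => a s; elim/rfrac_ind => b t.
by rewrite rfracM !rlocE rfracM; apply: rfrac_eq; rewrite /= !rmorphM.
Qed.

Section Sharp.
Variables (V : opens (Spec A)) (U : opens (Spec B)) (UV : U `<=` spec_pt @^-1` V).

Lemma spec_sharp_subproof (s : spec_sec V) :
  locally_frac (M := B^o) (fun q : {q | U q} =>
    rloc (sval_at s (exist _ (spec_pt (sval q)) (UV (proj2_sig q))))).
Proof.
move=> q Uq; have [b [d [h [hq hV e]]]] := spec_sec_near s (UV Uq).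
exists (basic (phi h)); split => //; exists (phi b), (phi d) => -[q' Uq'] /= hq'.
have [hd ed] := e (exist _ (spec_pt q') (UV Uq')) hq'.
by rewrite ed rlocE; exists (valP (den_map (Sub d hd : den (spec_pt q')))); apply: rfrac_eq.
Qed.

Definition spec_sharp_fun (s : @osec (Spec A) V) : @osec (Spec B) U :=
  TildeSec (spec_sharp_subproof s).

Lemma spec_sharp_zmod : zmod_morphism spec_sharp_fun.
Proof. by move=> s t; apply: tilde_ext => q; apply: (rlocB (q := sval q)). Qed.

Lemma spec_sharp_monoid : monoid_morphism spec_sharp_fun.
Proof.
split=> [|s t]; apply: tilde_ext => q; first exact: (rlocM (sval q)).1.
exact: (rlocM (sval q)).2.
Qed.

HB.instance Definition _ := GRing.isZmodMorphism.Build _ _ spec_sharp_fun spec_sharp_zmod.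
HB.instance Definition _ := GRing.isMonoidMorphism.Build _ _ spec_sharp_fun spec_sharp_monoid.

Definition spec_sharp : {rmorphism @osec (Spec A) V -> @osec (Spec B) U} := spec_sharp_fun.

End Sharp.

Lemma spec_sharp_res (V V' : opens (Spec A)) (U U' : opens (Spec B))
    (UV : U `<=` spec_pt @^-1` V) (UV' : U' `<=` spec_pt @^-1` V')
    (VV : V' `<=` V) (UU : U' `<=` U) s :
  spec_sharp UV' (ores VV s) = ores UU (spec_sharp UV s).
Proof.
apply: tilde_ext => -[q Uq] /=; congr (rloc _).
exact: (tval_irr (s : spec_sec V)).
Qed.

Definition spec_map : rs_morphism (Spec B) (Spec A) :=
  RsMorphism spec_pt_cont spec_sharp_res.

Lemma spec_map_at (V : opens (Spec A)) (U : opens (Spec B)) (UV : U `<=` spec_map @^-1` V)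
    (s : spec_sec V) q (Uq : U q) :
  sval_at (msharp UV s) (exist _ q Uq) = rloc (sval_at s (exist _ (spec_pt q) (UV q Uq))).
Proof. by rewrite /sval_at /=; congr (rloc _); exact: (tval_irr s). Qed.

Lemma spec_map_csec (V : opens (Spec A)) (U : opens (Spec B)) (UV : U `<=` spec_map @^-1` V) a :
  msharp UV (csec V a) = csec U (phi a).
Proof.
apply: tilde_ext => -[q Uq].
change (sval_at (msharp UV (csec V a)) (exist _ q Uq) = sval_at (csec U (phi a)) (exist _ q Uq)).
by rewrite spec_map_at !csec_at rlocE; apply: rfrac_eq; rewrite /= rmorph1.
Qed.

Lemma spec_map_local : is_local spec_map.
Proof.
move=> V U UV s q Uq g.
have [b [d [h [hq hV e]]]] := spec_sec_near (s : spec_sec V) (UV q Uq).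
have [hd ed] := e (exist _ (spec_pt q) (UV q Uq)) hq.
apply/(spec_germ_unit ed); move: g.
have e' := spec_map_at UV s Uq; rewrite ed rlocE in e'.
by move=> /(spec_germ_unit e').
Qed.

End SpecMap.

Lemma rs_comp_local (Z Y X : ringedSpace) (f : rs_morphism Y X) (g : rs_morphism Z Y) :
  is_local f -> is_local g -> is_local (rs_comp f g).
Proof.
move=> fl gl V U UV s z Uz /(gl _ _ _ _ _ Uz) gs.
exact: (fl V (mpre f V) (@mpre_sub _ _ f V) s (g z) (UV z Uz) gs).
Qed.

Lemma rs_compE (Z Y X : ringedSpace) (f : rs_morphism Y X) (g : rs_morphism Z Y)
    (V : opens X) (U : opens Z) (UV : U `<=` rs_comp f g @^-1` V)
    (UV' : U `<=` g @^-1` mpre f V) (s : osec V) :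
  msharp UV s = msharp UV' (msharp (@mpre_sub _ _ f V) s).
Proof. by rewrite (Prop_irrelevance UV (UV' : U `<=` rs_comp f g @^-1` V)). Qed.

Lemma rs_eq_refl (Y X : ringedSpace) (f : rs_morphism Y X) : rs_eq f f.
Proof. by split=> // V U Uf Uf' s; rewrite (Prop_irrelevance Uf Uf'). Qed.

Lemma rs_eq_sym (Y X : ringedSpace) (f g : rs_morphism Y X) : rs_eq f g -> rs_eq g f.
Proof. by move=> [e e']; split=> [y|V U Uf Ug s]; [rewrite e|rewrite (e' V U Ug Uf)]. Qed.

Lemma rs_eq_trans (Y X : ringedSpace) (f g h : rs_morphism Y X) :
  rs_eq f g -> rs_eq g h -> rs_eq f h.
Proof.
move=> [e1 e1'] [e2 e2']; split=> [y|V U Uf Uh s]; first by rewrite e1.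
have Ug : U `<=` g @^-1` V by move=> y /Uf; rewrite /= e1.
by rewrite (e1' V U Uf Ug) e2'.
Qed.

Section MapsToChart.
Variables (X : scheme) (A B : comPzRingType) (f : rs_morphism (Spec A) X).
Hypothesis fo : open_immersion f.
Variables (u : rs_morphism (Spec B) X) (phi : {rmorphism A -> B}).
Hypothesis ul : is_local u.
Hypothesis uU : forall z, cimg fo (u z).
Hypothesis uphi : forall (W : opens (Spec B)) (WU : W `<=` u @^-1` cimg fo) a,
  msharp WU (gl fo a) = csec W (phi a).

Let pt z : u z = f (spec_pt phi z).
Proof.
have /cimgP[q qe] := uU z; rewrite -qe; congr (f _); apply: primeSpec_ext => a.
suff : basic a q <-> basic a (spec_pt phi z).
  by rewrite /basic /= /basic_set /= => e; split => /= h; apply: contrapT => /e.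
rewrite -(gl_unit fo) qe.
have WU : topO (Spec B) `<=` u @^-1` cimg fo by move=> ? _; exact: uU.
rewrite -(local_germ_unit WU (gl fo a) ul (y := z)) // uphi.
exact: (@spec_germ_unit B (topO (Spec B)) (csec _ (phi a)) (exist _ z I) (phi a) (den1 z) (csec_at _ _)).
Qed.

(** A local morphism into a chart is determined by its effect on the functions
    on the chart: z is mapped to the prime of the functions which are not units at
    z, and a section near this point is a quotient of such functions. *)
Lemma map_to_chart : rs_eq u (rs_comp f (spec_map phi)).
Proof.
split; first exact: pt.
move=> O W Wu Wf s; apply: tilde_ext => -[z Wz].
have qO : mpre f O (spec_pt phi z) by rewrite /= -pt; exact: (Wu z Wz).
have [b [d [h [hO [hq es eq]]]]] := gl_frac fo s (@mpre_sub _ _ f O) qO.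
pose W' : opens (Spec B) := capo W (mpre u (culoc fo h)).
have W'z : W' z by split => //=; rewrite pt; apply/uset_gl_f.
have W'N : W' `<=` u @^-1` culoc fo h by move=> ? [].
have W'U : W' `<=` u @^-1` cimg fo by move=> ? _; exact: uU.
have := congr1 (msharp W'N) es.
rewrite rmorphM (msharp_res W'U W'N (@culoc_sub _ _ _ fo h) (@subset_refl _ W')) ores_id uphi.
rewrite (msharp_res W'U W'N (@culoc_sub _ _ _ fo h) (@subset_refl _ W')) ores_id uphi.
rewrite (msharp_res Wu W'N hO (@capoL _ W (mpre u (culoc fo h)))).
move=> /(congr1 (fun r : spec_sec W' => sval_at r (exist _ z W'z))) ez.
change (sval_at (msharp Wu s) (exist _ z Wz) =
  sval_at (msharp (Wf : W `<=` spec_map phi @^-1` mpre f O) (msharp (@mpre_sub _ _ f O) s)) (exist _ z Wz)).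
have eq' : sval_at (msharp (@mpre_sub _ _ f O) s)
    (exist (mpre f O) (spec_pt phi z) (Wf z Wz)) = rfrac b d.
  by rewrite -eq; exact: (tval_irr (msharp (@mpre_sub _ _ f O) s : spec_sec _)).
rewrite spec_map_at eq' rlocE.
have {}ez : rfrac (phi (sval d)) (den1 z) * sval_at (msharp Wu s) (exist _ z Wz) =
    rfrac (phi b) (den1 z).
  rewrite -(@csec_at B W' (phi b) (exist _ z W'z)) -(@csec_at B W' (phi (sval d)) (exist _ z W'z)) -ez.
  rewrite -[RHS]/(sval_at (csec W' (phi (sval d))) (exist _ z W'z) *
    sval_at (ores (@capoL _ W (mpre u (culoc fo h))) (msharp Wu s)) (exist _ z W'z)).
  by congr (_ * _); exact: (tval_irr (msharp Wu s : spec_sec W)).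
apply: (@loc_scaleI _ B^o z (den_map d)); apply: (etrans ez).
by rewrite [RHS]rfracM; apply: rfrac_eq => /=; ring.
Qed.

End MapsToChart.

(** * Local rings as test schemes *)

Section LocalSpec.
Variables (D : comPzRingType) (q0 : primeSpec D).

Definition to_loc (d : D) : locRing q0 := rfrac d (den1 q0).

Lemma to_locB : zmod_morphism to_loc.
Proof.
move=> a b; have -> : - to_loc b = rfrac (- b) (den1 q0) by exact: (@fracN _ _ D^o).
by rewrite /to_loc rfracD; apply: rfrac_eq => /=; ring.
Qed.

Lemma to_locM : monoid_morphism to_loc.
Proof. by split=> // a b; rewrite /to_loc rfracM; apply: rfrac_eq => /=; ring. Qed.

HB.instance Definition _ := GRing.isZmodMorphism.Build D (locRing q0) to_loc to_locB.
HB.instance Definition _ := GRing.isMonoidMorphism.Build D (locRing q0) to_loc to_locM.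

(** The canonical morphism Spec D_q -> Spec D. *)
Definition loc_pt := spec_map (to_loc : {rmorphism D -> locRing q0}).

(** The points of Spec D_q are generizations of q, hence lie in every open
    neighbourhood of q. *)
Lemma loc_pt_sub (O : opens (Spec D)) : O q0 -> forall z, O (loc_pt z).
Proof.
move=> Oq z; have [a [aq aO]] := basic_nbhd Oq; apply: aO => za.
apply: (@pideal1 _ z).
have -> : 1 = rfrac 1 (Sub a (basic_denP aq)) * to_loc a :> locRing q0.
  by rewrite rfracM -rfrac1; apply: rfrac_eq => /=; ring.
exact: pidealM.
Qed.

(** So pulling back to Spec D_q is taking the germ at q. *)
Lemma loc_pt_csec (O : opens (Spec D)) (Oq : O q0) (W : opens (Spec (locRing q0)))
    (WO : W `<=` loc_pt @^-1` O) (s : spec_sec O) :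
  msharp WO s = csec W (sval_at s (exist _ q0 Oq)).
Proof.
have [b [d [h [hq hO e]]]] := spec_sec_near s Oq.
apply: tilde_ext => -[z Wz].
change (sval_at (msharp WO s) (exist _ z Wz) = sval_at (csec W (sval_at s (exist _ q0 Oq))) (exist _ z Wz)).
rewrite spec_map_at csec_at.
have hz : basic h (loc_pt z) by apply: loc_pt_sub.
have [hd ->] := e (exist _ (loc_pt z) (WO z Wz)) hz.
have [hd' ->] := e (exist _ q0 Oq) hq.
rewrite rlocE; apply: rfrac_eq => /=.
rewrite mul1r /to_loc rfracM.
by apply: rfrac_eq => /=; ring.
Qed.

(** The maximal ideal of the local ring. *)
Definition closed_pt : primeSpec (locRing q0).
Proof.
apply: (@PrimeSpec (locRing q0) [set x | exists d s, q0 d /\ x = rfrac d s]) => /=.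
- by exists 0, (den1 q0); split => //; exact: pideal0.
- move=> _ _ [d [s [qd ->]]] [d' [s' [qd' ->]]]; rewrite rfracD.
  exists (sval s' * d + sval s * d'), (denM s s'); split => //.
  by apply: pidealD; apply: pidealM.
- move=> a _ [d [s [qd ->]]]; elim/rfrac_ind: a => b t.
  by rewrite rfracM; exists (b * d), (denM t s); split => //; exact: pidealM.
- move=> [d [s [qd]]]; rewrite -rfrac1 => /rfracP[u /= e].
  apply: (den_basic (denM u s)) => /=; move: e; rewrite mulr1 mul1r => ->.
  exact: pidealM.
- elim/rfrac_ind => a s; elim/rfrac_ind => b t [d [r [qd]]].
  rewrite rfracM => /rfracP[u /= e].
  have : q0 (sval u * sval r * (a * b)).
    by rewrite -mulrA e; apply: pidealM; exact: pidealM.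
  case/pideal_prime; first by move=> h; case: (den_basic (denM u r)).
  by case/pideal_prime => ?; [left; exists a, s|right; exists b, t].
Defined.

Lemma closed_ptP d s : closed_pt (rfrac d s) <-> q0 d.
Proof.
split; last by exists d, s.
move=> [d' [s' [qd' /rfracP[u /= e]]]].
have : q0 (sval u * sval s' * d) by rewrite -mulrA e; apply: pidealM; exact: pidealM.
by case/pideal_prime => // h; case: (den_basic (denM u s')).
Qed.

Lemma loc_closed_pt : loc_pt closed_pt = q0.
Proof. by apply: primeSpec_ext => a; exact: closed_ptP. Qed.

End LocalSpec.

(** * Intersections of charts on a separated scheme *)

Section Separated.
Variables (X P : scheme) (p1 p2 : rs_morphism P X).
Hypothesis sq : is_square p1 p2.
Variables (c1 c2 : chart X).

Definition box : opens P := capo (mpre p1 (copen c1)) (mpre p2 (copen c2)).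
Let R : comPzRingType := osec box.

Let box1 : box `<=` p1 @^-1` copen c1. Proof. by move=> y []. Qed.
Let box2 : box `<=` p2 @^-1` copen c2. Proof. by move=> y []. Qed.

Let phi1 : {rmorphism cring c1 -> R} := msharp box1 \o gl (cimm c1).
Let phi2 : {rmorphism cring c2 -> R} := msharp box2 \o gl (cimm c2).

Let g1 : rs_morphism (SpecS R) X := rs_comp (cmor c1) (spec_map phi1).
Let g2 : rs_morphism (SpecS R) X := rs_comp (cmor c2) (spec_map phi2).

Let chart_comp_local (c : chart X) (phi : {rmorphism cring c -> R}) :
  is_local (rs_comp (cmor c) (spec_map phi)).
Proof.
by apply: rs_comp_local; [exact: (open_immersion_local (cimm c))|exact: spec_map_local].
Qed.

(** Followed by a projection of P, a morphism to the box lands in a chart, so it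
    is determined by its effect on the functions on this chart. *)
Let box_chart (p : rs_morphism P X) (c : chart X) (boxc : box `<=` p @^-1` copen c)
    (B : comPzRingType) (u : rs_morphism (Spec B) P) (ev : {rmorphism R -> B}) :
  is_local p -> is_local u -> (forall z, box (u z)) ->
  (forall (W : opens (Spec B)) (Wu : W `<=` u @^-1` mpre p (copen c)) a,
     msharp Wu (msharp (@mpre_sub _ _ p (copen c)) (gl (cimm c) a)) =
     csec W (ev (msharp boxc (gl (cimm c) a)))) ->
  rs_eq (rs_comp p u) (rs_comp (cmor c) (spec_map (ev \o (msharp boxc \o gl (cimm c))))).
Proof.
move=> pl ul ub e; apply: (map_to_chart (fo := cimm c)).
- exact: rs_comp_local.
- by move=> z; exact: (boxc _ (ub z)).
- by move=> W WU a; exact: e.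
Qed.

(** In fact h is an isomorphism onto the box U_1 x U_2, which is affine; the
    three properties are what is needed of it. The universal property of P yields
    h from the functions on U_1 and U_2 pulled back to the box. It hits every
    point y of the box, at the prime of the functions which are not invertible at
    y, because the morphism from the spectrum of the local ring at y to P factors
    through h, by the uniqueness in the universal property. *)
Lemma box_affine : exists h : rs_morphism (Spec R) P,
  [/\ is_local h, forall z, box (h z) &
    forall y, box y -> exists z : Spec R, h z = y /\
      forall r : R, germ_unit y r <-> basic r z].
Proof.
have [p1l [p2l univ]] := sq.
have [h [hl e1 e2 _]] := univ (SpecS R) g1 g2 (@chart_comp_local c1 phi1) (@chart_comp_local c2 phi2).
have hb z : box (h z).
  have z1 : copen c1 (rs_comp p1 h z) by rewrite (e1.1 z); exact: (cimg_f (cimm c1)).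
  have z2 : copen c2 (rs_comp p2 h z) by rewrite (e2.1 z); exact: (cimg_f (cimm c2)).
  by split.
exists h; split => // y yb.
have [D [k [ko [q0 _ kq]]]] := schemeP y.
have kl := open_immersion_local ko.
have q0b : mpre k box q0 by rewrite /= kq.
pose evf (r : R) : locRing q0 := sval_at (msharp (@mpre_sub _ _ k box) r) (exist _ q0 q0b).
have evB : zmod_morphism evf.
  by move=> r s; rewrite /evf rmorphB.
have evM : monoid_morphism evf.
  by split=> [|r s]; rewrite /evf ?rmorph1 ?rmorphM.
pose evZ := GRing.isZmodMorphism.Build R (locRing q0) evf evB.
pose evMo := GRing.isMonoidMorphism.Build R (locRing q0) evf evM.
pose ev : {rmorphism R -> locRing q0} := HB.pack evf evZ evMo.
pose T := SpecS (locRing q0).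
pose ky : rs_morphism T P := rs_comp k (loc_pt q0).
pose he : rs_morphism T P := rs_comp h (spec_map ev).
have kyl : is_local ky by apply: rs_comp_local => //; exact: spec_map_local.
have hel : is_local he by apply: rs_comp_local => //; exact: spec_map_local.
have kyb z : box (ky z) by exact: (loc_pt_sub (O := mpre k box) q0b z).
have heb z : box (he z) by exact: hb.
have kyE (p : rs_morphism P X) (c : chart X) (boxc : box `<=` p @^-1` copen c) :
    is_local p -> rs_eq (rs_comp p ky)
      (rs_comp (cmor c) (spec_map (ev \o (msharp boxc \o gl (cimm c))))).
  move=> pl; apply: box_chart => // W Wu a.
  have TW : W `<=` ky @^-1` box by move=> z _; exact: kyb.
  have bc : box `<=` mpre p (copen c) by move=> z /boxc.
  have -> : msharp Wu (msharp (@mpre_sub _ _ p (copen c)) (gl (cimm c) a)) =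
      msharp TW (msharp boxc (gl (cimm c) a)).
    have := msharp_res (@mpre_sub _ _ p (copen c)) boxc (@subset_refl _ _) bc (gl (cimm c) a).
    by rewrite ores_id => ->; rewrite (msharp_res Wu TW bc (@subset_refl _ W)) ores_id.
  exact: (loc_pt_csec q0b).
have heE (p : rs_morphism P X) (c : chart X) (boxc : box `<=` p @^-1` copen c) :
    is_local p -> rs_eq (rs_comp p h) (rs_comp (cmor c) (spec_map (msharp boxc \o gl (cimm c)))) ->
    rs_eq (rs_comp p he)
      (rs_comp (cmor c) (spec_map (ev \o (msharp boxc \o gl (cimm c))))).
  move=> pl [ept esh]; apply: box_chart => // W Wu a.
  have U1 : mpre h (mpre p (copen c)) `<=` rs_comp p h @^-1` copen c by [].
  have U2 : mpre h (mpre p (copen c)) `<=`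
      rs_comp (cmor c) (spec_map (msharp boxc \o gl (cimm c))) @^-1` copen c.
    by move=> z zc; have : copen c (rs_comp p h z) := zc; rewrite ept.
  have := esh _ _ U1 U2 (gl (cimm c) a).
  rewrite (rs_compE U1 (@mpre_sub _ _ h (mpre p (copen c)))).
  rewrite (rs_compE U2 (U2 : _ `<=` spec_map _ @^-1` mpre (cmor c) (copen c))).
  rewrite glE spec_map_csec => eh.
  rewrite (rs_compE Wu (Wu : W `<=` spec_map ev @^-1` mpre h (mpre p (copen c)))).
  by rewrite eh spec_map_csec.
have [h' [_ _ _ uniq]] := univ T (rs_comp p1 ky) (rs_comp p2 ky)
  (rs_comp_local p1l kyl) (rs_comp_local p2l kyl).
have hky : rs_eq he ky.
  apply: (@rs_eq_trans _ _ _ h').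
    apply: uniq => //.
      exact: rs_eq_trans (heE p1 c1 box1 p1l e1) (rs_eq_sym (kyE p1 c1 box1 p1l)).
    exact: rs_eq_trans (heE p2 c2 box2 p2l e2) (rs_eq_sym (kyE p2 c2 box2 p2l)).
  by apply: rs_eq_sym; apply: uniq => //; exact: rs_eq_refl.
exists (spec_map ev (closed_pt q0)); split.
  have -> : h (spec_map ev (closed_pt q0)) = ky (closed_pt q0) by exact: hky.1.
  by rewrite -kq; exact: (congr1 k (loc_closed_pt q0)).
move=> r.
have [b [d [a [aq aO e]]]] := spec_sec_near (msharp (@mpre_sub _ _ k box) r : spec_sec _) q0b.
have [dq ed] := e (exist _ q0 q0b) aq.
rewrite -kq -(local_germ_unit (@mpre_sub _ _ k box) r kl q0b).
have -> : basic r (spec_map ev (closed_pt q0)) <-> basic b q0.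
  have e0 : (spec_map ev (closed_pt q0) : set R) r <-> q0 b.
    by rewrite -(closed_ptP b (Sub d dq : den q0)) -ed.
  by split => h1 h2; apply: h1; apply/e0.
exact: (spec_germ_unit ed).
Qed.

(** Through the diagonal the intersection of the two charts is a closed subset
    of the affine box. The functions on the box whose restriction lies in J form
    an ideal, contained in a prime p if J is proper. If p is on the diagonal the
    hypothesis at that point puts in J a power of a function outside of p;
    otherwise some function outside of p has empty unit locus on the diagonal. *)
Lemma inter_affine_like_of (Dg : rs_morphism X P) : is_local Dg ->
  rs_eq (rs_comp p1 Dg) (rs_id X) -> rs_eq (rs_comp p2 Dg) (rs_id X) ->
  closed_immersion Dg -> affine_like (capo (copen c1) (copen c2)).
Proof.
move=> Dl d1 d2 Dc J iJ loc.
have [h [hl hb hpt]] := box_affine.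
have WQ : capo (copen c1) (copen c2) `<=` Dg @^-1` box.
  move=> x [x1 x2]; split.
    by have := d1.1 x; rewrite /= => ->.
  by have := d2.1 x; rewrite /= => ->.
pose rho := msharp WQ.
apply: contrapT => J1.
have [x0 x0W] : exists x, capo (copen c1) (copen c2) x.
  apply: contrapT => /forallNP nW; apply: J1.
  have -> : 1 = 0 :> osec (capo (copen c1) (copen c2)).
    by apply: osec_sep => x Wx; case: (nW x).
  exact: ideal0 iJ.
have [||p [Jp _]] := @prime_avoiding R [set r | J (rho r)] 1.
- split => /=; first by rewrite rmorph0; exact: (ideal0 iJ).
    by move=> a b Ja Jb; rewrite rmorphD; exact: (idealD iJ).
  by move=> a b Jb; rewrite rmorphM; exact: (idealM iJ).
- by move=> k /=; rewrite expr1n rmorph1.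
have contra x : capo (copen c1) (copen c2) x ->
    (forall V : opens X, V x -> exists O : opens P, O (h p) /\
       forall x', capo (copen c1) (copen c2) x' -> O (Dg x') -> V x') -> False.
  move=> Wx nbh; have [V [Vx JV]] := loc x Wx.
  have [O [Op OV]] := nbh V Vx.
  have [r [rp rO]] := @basic_nbhd _ (mpre h O) p Op.
  have [|k Jk] := JV (rho r).
    move=> x' [Wx' /(local_germ_unit WQ r Dl Wx') g].
    have [z [zx zr]] := hpt _ (WQ _ Wx').
    by apply: (OV x' Wx'); rewrite -zx; apply: (rO z); exact/zr.
  by apply: (@basicX _ r k p rp); apply: Jp; rewrite /= rmorphXn.
have [[x _ xp]|nr] := pselect (range Dg (h p)).
  apply: (contra x).
    have [] := hb p; rewrite /= -xp.
    by have := d1.1 x; have := d2.1 x; rewrite /= => -> ->.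
  move=> V Vx; have [O VO] := ci_homeo Dc V; exists O; split.
    by move: Vx; rewrite VO /= xp.
  by move=> x' _ Ox'; rewrite VO.
apply: (contra x0) => // V _.
have oC : open (~` range Dg) by apply: closed_openC; exact: ci_closed.
exists (Opens oC); split => // x' _ /= []; by exists x'.
Qed.

End Separated.

Theorem separated_inter_affine_like (X : scheme) (c1 c2 : chart X) :
  is_separated X -> affine_like (capo (copen c1) (copen c2)).
Proof.
move=> [P [p1 [p2 [Dg [sq Dl d1 d2 Dc]]]]].
exact: (inter_affine_like_of sq Dl d1 d2 Dc).
Qed.

(** * A bounded double complex *)

Lemma antisymmetric_sum (V : zmodType) n (T : 'I_n -> 'I_n -> V) :
  (forall i, T i i = 0) -> (forall i j, T j i = - T i j) -> \sum_i \sum_j T i j = 0.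
Proof.
move=> T0 TN.
have split i : \sum_j T i j = \sum_(j : 'I_n | (j < i)%N) T i j + \sum_(j : 'I_n | (i < j)%N) T i j.
  rewrite (bigID (fun j : 'I_n => (j < i)%N)) /=; congr (_ + _).
  rewrite (bigD1 i) /= ?ltnn // T0 add0r; apply: eq_bigl => j.
  by rewrite -leqNgt ltn_neqAle andbC eq_sym.
rewrite (eq_bigr _ (fun i _ => split i)) big_split /=.
rewrite [X in _ + X](exchange_big_dep predT) //=.
rewrite -big_split big1 // => i _.
apply: (etrans (esym (big_split _ _ _ _ _))).
by rewrite big1 // => j _; rewrite /= [T j i]TN subrr.
Qed.

(** E is a diagram of complexes, with differential d, on the cube of subsets of
    {0, ..., n-1}: e is the map attached to an inclusion. In each degree the maps
    r_g back along the direction g are natural for e; they need not commute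
    with d. *)
Section Cochains.
Import mathcomp.boot.finset.
Local Open Scope set_scope.
Variables (R : comPzRingType) (n : nat).
Variable E : int -> {set 'I_n} -> lmodType R.
Variable d : forall m S, {linear E m S -> E (m + 1) S}.
Variable e : forall m S S', {linear E m S -> E m S'}.
Variable r : forall m g S, {linear E m (g |: S) -> E m S}.
Arguments d {m S}.
Arguments e {m} S S'.
Arguments r {m} g S.
Hypothesis dd : forall m S (x : E m S), d (d x) = 0.
Hypothesis e_id : forall m S (x : E m S), e S S x = x.
Hypothesis e_comp : forall m (S S' S'' : {set 'I_n}) (x : E m S),
  S \subset S' -> S' \subset S'' -> e S' S'' (e S S' x) = e S S'' x.
Hypothesis de : forall m (S S' : {set 'I_n}) (x : E m S), S \subset S' -> d (e S S' x) = e S S' (d x).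
Hypothesis re : forall m g (S S' : {set 'I_n}) (x : E m (g |: S)), S \subset S' ->
  r g S' (e (g |: S) (g |: S') x) = e S S' (r g S x).
Hypothesis sum_re : forall m S (x : E m S), \sum_g r g S (e S (g |: S) x) = x.
Hypothesis d_exact : forall m (S : {set 'I_n}) (x : E (m + 1) S), S != set0 -> d x = 0 ->
  exists y, d y = x.

Definition cochain m : Type := forall S, E m S.

(** The sign of the position of g among the elements of S. *)
Definition sg (g : 'I_n) (S : {set 'I_n}) : R := (-1) ^+ #|[set x in S | (x < g)%N]|.

Lemma sgU (b g : 'I_n) (S : {set 'I_n}) : g \notin S ->
  sg b (g |: S) = (-1) ^+ (g < b)%N * sg b S.
Proof.
move=> gS; rewrite /sg -exprD; congr (_ ^+ _).
have [gb|bg] := boolP (g < b)%N.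
  have -> : [set x in g |: S | (x < b)%N] = g |: [set x in S | (x < b)%N].
    by apply/setP => x; rewrite !inE andb_orl; case: eqP => [->|]; rewrite ?gb.
  by rewrite cardsU1 inE (negPf gS).
rewrite add0n; apply: eq_card => x; rewrite !inE andb_orl.
by case: eqP => [->|]; rewrite ?(negPf bg) ?(negPf gS).
Qed.

Lemma sgU1 (g : 'I_n) (S : {set 'I_n}) : g \notin S -> sg g (g |: S) = sg g S.
Proof. by move=> gS; rewrite sgU // ltnn mul1r. Qed.

Lemma sg_sq g S : sg g S * sg g S = 1.
Proof. by rewrite /sg -exprD addnn -mul2n exprM sqrrN expr1n expr1n. Qed.

Lemma sg_anti (b g : 'I_n) : b != g ->
  (-1) ^+ (g < b)%N = - (-1) ^+ (b < g)%N :> R.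
Proof.
move=> bg; have [| |/ord_inj gb] := ltngtP g b; last by rewrite gb eqxx in bg.
  by rewrite expr1 expr0.
by rewrite expr1 expr0 opprK.
Qed.

(** The Cech differential. *)
Definition delta m (s : cochain m) : cochain m :=
  fun S => \sum_(g in S) sg g S *: e (S :\ g) S (s (S :\ g)).

Definition homot m (s : cochain m) : cochain m :=
  fun S => \sum_(g | g \notin S) sg g S *: r g S (s (g |: S)).

Lemma deltaB m (s t : cochain m) S :
  delta (fun S => s S - t S) S = delta s S - delta t S.
Proof.
rewrite /delta -sumrB; apply: eq_bigr => g _.
by rewrite linearB scalerBr.
Qed.

Lemma delta_d m (s : cochain m) S : delta (fun S => d (s S)) S = d (delta s S).
Proof.
rewrite /delta linear_sum; apply: eq_bigr => g _.
by rewrite linearZ de // subD1set.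
Qed.

Lemma delta_delta m (s : cochain m) S : delta (delta s) S = 0.
Proof.
pose t g b := (sg g S * sg b (S :\ g)) *: e (S :\ g :\ b) S (s (S :\ g :\ b)).
transitivity (\sum_g \sum_b if [&& g \in S, b \in S & b != g] then t g b else 0).
  rewrite /delta big_mkcond; apply: eq_bigr => g _; case: ifP => gS; last first.
    by rewrite big1.
  rewrite linear_sum scaler_sumr big_mkcond; apply: eq_bigr => b _.
  rewrite !inE andbC /=; case: ifP => // bS; rewrite /t linearZ scalerA.
  by rewrite e_comp // subD1set.
apply: antisymmetric_sum => [g|g b]; first by rewrite eqxx !andbF.
rewrite andbCA eq_sym; case: ifP => [/and3P[gS bS bg]|]; last by rewrite oppr0.
rewrite /t; have -> : S :\ b :\ g = S :\ g :\ b by rewrite !setDDl setUC.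
rewrite -scaleNr; congr (_ *: _).
set T := S :\ g :\ b.
have gT : g \notin T by rewrite !inE eqxx !andbF.
have bT : b \notin T by rewrite !inE eqxx.
have Sg : S :\ g = b |: T by rewrite /T setD1K // !inE bg.
have Sb : S :\ b = g |: T.
  apply/setP => x; rewrite !inE; case: (eqVneq x g) => [->|xg] //=.
  by rewrite eq_sym bg gS.
have Sgb : S = g |: (b |: T) by rewrite -Sg setD1K.
have Sbg : S = b |: (g |: T) by rewrite -Sb setD1K.
clearbody T.
have -> : sg b S = (-1) ^+ (g < b)%N * sg b T.
  by rewrite Sbg sgU1 ?sgU // !inE negb_or bg.
have -> : sg g S = (-1) ^+ (b < g)%N * sg g T.
  by rewrite Sgb sgU1 ?sgU // !inE negb_or eq_sym bg.
rewrite Sb Sg !sgU1 // (sg_anti bg); ring.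
Qed.

(** The homotopy r_g of the direction g alone yields the endomorphism r_g e
    instead of the identity, and anticommutes with the other directions; the
    endomorphisms r_g e sum up to the identity. *)
Lemma homot_delta m (s : cochain m) S :
  homot (delta s) S + delta (homot s) S = s S.
Proof.
(* The terms x come from removing the index just added or the converse, the
   terms y from two distinct indices. *)
pose x g : E m S := r g S (e S (g |: S) (s S)).
pose y g b : E m S := (sg g S * sg b (g |: S)) *: r g S (e ((g |: S) :\ b) (g |: S) (s ((g |: S) :\ b))).
have -> : homot (delta s) S = \sum_(g | g \notin S) x g + \sum_(g | g \notin S) \sum_(b in S) y g b.
  rewrite -big_split; apply: eq_bigr => g gS /=.
  rewrite /delta big_setU1 //= linearD scalerDr; congr (_ + _).
    by rewrite linearZ scalerA sgU1 // sg_sq scale1r setU1K.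
  by rewrite linear_sum scaler_sumr; apply: eq_bigr => b bS; rewrite linearZ scalerA.
have -> : delta (homot s) S = \sum_(g in S) x g + \sum_(b in S) \sum_(g | g \notin S) (- y g b).
  rewrite -big_split; apply: eq_bigr => b bS /=.
  have bSb : b \notin S :\ b by rewrite !inE eqxx.
  have SbE : b |: (S :\ b) = S by rewrite setD1K.
  have sbS : sg b S = sg b (S :\ b) by rewrite -[in LHS]SbE sgU1.
  rewrite /homot (bigD1 b) //= linearD scalerDr; congr (_ + _).
    rewrite linearZ scalerA sbS sg_sq scale1r -re ?subD1set //.
    by rewrite SbE.
  rewrite linear_sum scaler_sumr; apply: eq_big => [g|g /andP[gSb gb]].
    by rewrite !inE; case: eqP => [->|]; rewrite ?bS ?andbT.
  have gS : g \notin S by move: gSb; rewrite !inE gb.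
  have bg : b != g by rewrite eq_sym.
  have gbE : (g |: S) :\ b = g |: (S :\ b).
    by apply/setP => z; rewrite !inE; case: eqP => // ->; rewrite (negPf bg).
  rewrite linearZ scalerA -re ?subD1set // /y gbE -scaleNr; congr (_ *: _).
  have -> : sg g S = (-1) ^+ (b < g)%N * sg g (S :\ b) by rewrite -[in LHS]SbE sgU.
  rewrite sgU // (sg_anti bg).
  transitivity ((-1) ^+ (b < g)%N * (-1) ^+ (b < g)%N * (sg b S * sg g (S :\ b))); last by ring.
  by rewrite -expr2 sqrr_sign mul1r.
rewrite addrACA; have -> : \sum_(b in S) \sum_(g | g \notin S) - y g b =
    - \sum_(g | g \notin S) \sum_(b in S) y g b.
  by rewrite exchange_big -sumrN; apply: eq_bigr => g _; rewrite sumrN.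
rewrite subrr addr0.
have -> : s S = \sum_(g in S) x g + \sum_(g | g \notin S) x g.
  by rewrite -[LHS]sum_re (bigID (mem S)).
exact: addrC.
Qed.

Definition filt m p (s : cochain m) := forall S : {set 'I_n}, (#|S| < p)%N -> s S = 0.

Lemma delta_filt m p (s : cochain m) : filt p s -> filt p.+1 (delta s).
Proof.
move=> sp S Sp; rewrite /delta big1 // => g gS.
by rewrite sp ?linear0 ?scaler0 //; move: Sp; rewrite (cardsD1 g S) gS.
Qed.

Lemma homot_filt m p (s : cochain m) : filt p.+1 s -> filt p (homot s).
Proof.
move=> sp S Sp; rewrite /homot big1 // => g gS.
by rewrite sp ?linear0 ?scaler0 // cardsU1 gS.
Qed.

(** Descending induction on p, there being no set with more than n elements.
    Columns over nonempty sets are exact, so s = d t'; then delta t' is again a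
    double cocycle, supported on p + 1 indices, hence delta t' = d u, and t' is
    corrected by d of the delta-primitive of u. *)
Lemma double_cocycle k p m (s : cochain (m + 1)) : (0 < p)%N -> (n < p + k)%N ->
  filt p s -> (forall S, d (s S) = 0) -> (forall S, delta s S = 0) ->
  exists t : cochain m, [/\ filt p t, forall S, d (t S) = s S & forall S, delta t S = 0].
Proof.
elim: k p m s => [|k IH] p m s p0 np sp ds es.
  exists (fun=> 0); split=> [//|S|S].
    rewrite linear0 sp //; move: np; rewrite addn0; apply: leq_ltn_trans.
    by rewrite -[X in (_ <= X)%N]card_ord max_card.
  by rewrite /delta big1 // => g _; rewrite linear0 scaler0.
have ht S : exists y, d y = s S /\ ((#|S| < p)%N -> y = 0).
  case: (ltnP #|S| p) => Sp; first by exists 0; rewrite linear0 sp.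
  have [|y ey] := @d_exact m S (s S) _ (ds S).
    by rewrite -card_gt0; exact: leq_trans Sp.
  by exists y.
pose t' S := sval (cid (ht S)).
have dt' S : d (t' S) = s S by rewrite /t'; case: cid => y [].
have t'p : filt p t' by move=> S; rewrite /t'; case: cid => y [].
have [m' em] : exists m', m = m' + 1 by exists (m - 1); rewrite subrK.
subst m.
have [|||||u [up du eu]] := IH p.+1 m' (delta t') => //.
- by rewrite addSnnS.
- exact: delta_filt.
- move=> S; rewrite -delta_d; have -> : (fun S => d (t' S)) = s by apply: functional_extensionality_dep.
  exact: es.
- exact: delta_delta.
pose w := homot u.
have dw S : delta w S = u S.
  rewrite -[RHS](homot_delta u S); suff -> : homot (delta u) S = 0 by rewrite add0r.
  by rewrite /homot big1 // => g _; rewrite eu linear0 scaler0.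
exists (fun S => t' S - d (w S)); split=> [S Sp|S|S].
- by rewrite /w t'p // (homot_filt up) // linear0 subr0.
- by rewrite linearB dd subr0.
by rewrite deltaB delta_d dw du subrr.
Qed.

(** With x placed at the empty set, delta x is a cocycle for delta and d,
    supported on nonempty sets, so it is d t with t a delta-cocycle; a delta-primitive of t has value at the
    empty set a d-primitive of x. *)
Theorem cube_exact m (x : E (m + 1) set0) : d x = 0 -> exists y, d y = x.
Proof.
move=> dx.
pose s0 : cochain (m + 1) := fun S => if S == set0 then e set0 S x else 0.
have s00 : s0 set0 = x by rewrite /s0 eqxx e_id.
have ds0 S : d (s0 S) = 0.
  by rewrite /s0; case: eqP => [->|_]; rewrite ?linear0 // e_id.
have [|||||t [tp dt et]] := @double_cocycle n 1 m (delta s0) => //.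
- by apply: delta_filt.
- move=> S; rewrite -delta_d; have -> : (fun S => d (s0 S)) = fun=> 0.
    by apply: functional_extensionality_dep.
  by rewrite /delta big1 // => g _; rewrite linear0 scaler0.
- exact: delta_delta.
pose w := homot t.
have dw S : delta w S = t S.
  rewrite -[RHS](homot_delta t S); suff -> : homot (delta t) S = 0 by rewrite add0r.
  by rewrite /homot big1 // => g _; rewrite et linear0 scaler0.
exists (w set0); rewrite -s00; apply/eqP; rewrite -subr_eq0; apply/eqP.
pose v : cochain (m + 1) := fun S => d (w S) - s0 S.
have v0 : delta (homot v) set0 = 0 by rewrite /delta big_pred0 // => g; rewrite inE.
apply: (etrans (esym (homot_delta v set0))).
rewrite v0 addr0 /homot big1 // => g _.
by rewrite deltaB delta_d dw dt subrr linear0 scaler0.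
Qed.

End Cochains.

(** * Homomorphisms between restrictions *)

Section RestHoms.
Variables (X : ringedSpace).
Implicit Types (F G : omod X) (U V W : opens X).

Lemma rest_scaleE W F U (a : osec U) (s : msec (rest W F) U) :
  a *: s = ores (@capoL _ U W) a *: (s : msec F (capo U W)).
Proof. by []. Qed.

Section RestHom.
Variables (W : opens X) (F G : omod X) (u : omod_hom F G).

Definition rest_hom_fun U (s : msec (rest W F) U) : msec (rest W G) U := u (capo U W) s.

Lemma rest_hom_linear U (a : osec U) (s t : msec (rest W F) U) :
  rest_hom_fun (a *: s + t) = a *: rest_hom_fun s + rest_hom_fun t.
Proof. exact: linearP. Qed.

Lemma rest_hom_res U V (VU : V `<=` U) (s : msec (rest W F) U) :
  rest_hom_fun (mres VU s) = mres VU (rest_hom_fun s).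
Proof. exact: (hres u). Qed.

Definition rest_hom : omod_hom (rest W F) (rest W G) := mkhom rest_hom_linear rest_hom_res.
End RestHom.

Section RestUnit.
Variables (W : opens X) (F : omod X).

Definition rest_unit_fun U (s : msec F U) : msec (rest W F) U := mres (@capoL _ U W) s.

Lemma rest_unit_linear U (a : osec U) (s t : msec F U) :
  rest_unit_fun (a *: s + t) = a *: rest_unit_fun s + rest_unit_fun t.
Proof. by rewrite /rest_unit_fun raddfD mresZ. Qed.

Lemma rest_unit_res U V (VU : V `<=` U) (s : msec F U) :
  rest_unit_fun (mres VU s) = mres VU (rest_unit_fun s).
Proof. by rewrite /rest_unit_fun /= /rest_res !mresE; exact: mres_irr. Qed.

Definition rest_unit : omod_hom F (rest W F) := mkhom rest_unit_linear rest_unit_res.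
End RestUnit.

Section RestSub.
Variables (W W' : opens X) (F : omod X).
Hypothesis WW : W' `<=` W.

Lemma capSr U : capo U W' `<=` capo U W. Proof. exact: capoS. Qed.

Definition rest_sub_fun U (s : msec (rest W F) U) : msec (rest W' F) U :=
  mres (@capSr U) (s : msec F (capo U W)).

Lemma rest_sub_linear U (a : osec U) (s t : msec (rest W F) U) :
  rest_sub_fun (a *: s + t) = a *: rest_sub_fun s + rest_sub_fun t.
Proof.
rewrite /rest_sub_fun raddfD rest_scaleE mresZ oresE rest_scaleE.
by rewrite (ores_irr _ (@capoL _ U W')).
Qed.

Lemma rest_sub_res U V (VU : V `<=` U) (s : msec (rest W F) U) :
  rest_sub_fun (mres VU s) = mres VU (rest_sub_fun s).
Proof. by rewrite /rest_sub_fun /= /rest_res !mresE; exact: mres_irr. Qed.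

Definition rest_sub : omod_hom (rest W F) (rest W' F) := mkhom rest_sub_linear rest_sub_res.
End RestSub.

(** The restriction of u to W starts from the restriction of F to the
    intersection of W and W1; W' is this open set, given by any formula. *)
Section RestRetraction.
Variables (W W1 W' : opens X) (F : omod X).
Hypothesis WW : capo W W1 `<=` W'.
Variable u : omod_hom (rest W1 F) F.

Lemma capAS U : capo (capo U W) W1 `<=` capo U W'.
Proof. by move=> x [[Ux Wx] W1x]; split => //; apply: WW. Qed.

Definition rest_retr_fun U (s : msec (rest W' F) U) : msec (rest W F) U :=
  u (capo U W) (mres (@capAS U) (s : msec F (capo U W'))).

Lemma rest_retr_linear U (a : osec U) (s t : msec (rest W' F) U) :
  rest_retr_fun (a *: s + t) = a *: rest_retr_fun s + rest_retr_fun t.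
Proof.
rewrite /rest_retr_fun raddfD rest_scaleE mresZ oresE.
rewrite (ores_irr _ (subset_trans (@capoL _ (capo U W) W1) (@capoL _ U W))) -oresE.
rewrite -[ores _ _ *: _](@rest_scaleE W1 F (capo U W) _ (mres (@capAS U) s)).
exact: (linearP (u (capo U W))).
Qed.

Lemma rest_retr_res U V (VU : V `<=` U) (s : msec (rest W' F) U) :
  rest_retr_fun (mres VU s) = mres VU (rest_retr_fun s).
Proof.
rewrite /rest_retr_fun; apply: (etrans _ (hres u (capSl VU) _)); congr (u _ _).
by rewrite /= /rest_res !mresE; exact: mres_irr.
Qed.

Definition rest_retr : omod_hom (rest W' F) (rest W F) := mkhom rest_retr_linear rest_retr_res.
End RestRetraction.

Lemma zero_hom_linear F G U (a : osec U) (s t : msec F U) :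
  (0 : msec G U) = a *: 0 + 0.
Proof. by rewrite scaler0 addr0. Qed.

Definition zero_hom F G : omod_hom F G.
Proof.
apply: (@mkhom X F G (fun U _ => 0)); first exact: zero_hom_linear.
by move=> U V VU s; rewrite raddf0.
Defined.

Definition id_hom F : omod_hom F F.
Proof. by apply: (@mkhom X F F (fun U s => s)). Defined.

Definition sum_hom (I : finType) F G (u : I -> omod_hom F G) : omod_hom F G.
Proof.
apply: (@mkhom X F G (fun U s => \sum_i u i U s)).
- move=> U a s t; rewrite scaler_sumr -big_split; apply: eq_bigr => i _.
  exact: linearP.
- by move=> U V VU s; rewrite raddf_sum; apply: eq_bigr => i _; exact: hres.
Defined.

Lemma opens_ext U V : (forall x, U x <-> V x) -> U = V.
Proof.
case: U => U oU; case: V => V oV /= e.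
have UV : U = V by apply/seteqP; split => x /e.
by subst V; f_equal; exact: Prop_irrelevance.
Qed.

Lemma mres_bij F U V (VU : V `<=` U) : U `<=` V ->
  bijective (mres VU : msec F U -> msec F V).
Proof.
move=> UV; exists (mres UV) => s; rewrite mresE.
  by rewrite (mres_irr _ (@subset_refl _ _)) mres_id.
by rewrite (mres_irr _ (@subset_refl _ _)) mres_id.
Qed.

(** For W inside U the restriction to W is a direct image from U. *)
Lemma rest_local_on U W F : W `<=` U -> forall V,
  bijective (mres (@capoL _ V U) : msec (rest W F) V -> msec (rest W F) (capo V U)).
Proof.
move=> WU V; apply: (@mres_bij F (capo V W) (capo (capo V U) W)) => x [Vx Wx].
by split => //; split => //; apply: WU.
Qed.

End RestHoms.

(** * Exactness over charts *)

Section Exactness.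
Variable X : scheme.

(** Near a point of the chart a cocycle is the quotient by a power of a of a
    section over the chart, which is a cocycle up to a power of a. *)
Lemma chart_exact_local (F G H : omod X) (u : omod_hom F G) (v : omod_hom G H) (c : chart X) :
  localizing G -> localizing H ->
  (forall s : msec G (copen c), v _ s = 0 -> exists t, u _ t = s) ->
  forall O (s : msec G O), v O s = 0 -> forall x, O x -> copen c x ->
  exists (V : opens X) (VO : V `<=` O) (t : msec F V), V x /\ u V t = mres VO s.
Proof.
move=> [_ ext] [tor _]; case: c => A f fo; rewrite /copen /= => ex O s vs x Ox xU.
have [q qx] := (cimgP fo x).1 xU; subst x.
have [a [aq aN]] := gl_basis fo (conj Ox (cimg_f fo q) : capo O (cimg fo) (f q)).
pose N := uloc (gl fo a).
have NO : N `<=` O by move=> y /aN[].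
have NU : N `<=` cimg fo by exact: uloc_sub.
have [||k [n en]] := ext (cimg fo) N NU (gl fo a) (mres NO s) => //.
have [||j ej] := tor (cimg fo) N NU (gl fo a) (v _ n) => //.
  by rewrite -hres en linearZZ hres vs raddf0 scaler0.
have [|t0 et0] := ex (gl fo a ^+ j *: n); first by rewrite linearZZ ej.
have [|w ew] := unit_on NU (a := gl fo a); first by [].
exists N, NO, (w ^+ (j + k) *: mres NU t0); split; first exact/uset_gl_f.
rewrite linearZZ hres et0 mresZ en !scalerA -rmorphM -exprD rmorphXn.
by rewrite -exprMn ew expr1n scale1r.
Qed.

Hypothesis nX : noeth_top X.
Hypothesis hsep : is_separated X.

Definition inter (l : seq (chart X)) : opens X :=
  foldr (fun c O => capo (copen c) O) (topO X) l.

Definition exact_over (C : complex X) (O : opens X) : Prop :=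
  forall n (s : msec (C (n + 1)) O), cdiff C (n + 1) O s = 0 ->
  exists t, cdiff C n O t = s.

(** By induction on l: the restriction of C to the intersection of the charts in
    l is exact over each chart, hence locally exact at the points of charts, hence
    exact over the intersection of two charts, which is affine. *)
Lemma acyclic_inter (C : complex X) : acyclic C ->
  forall l c, exact_over C (capo (copen c) (inter l)).
Proof.
move=> aC; have Cl n : localizing (C n) := qcoh_localizing nX (qcohP (C n)).
elim=> [|c' l IH] c n s ds.
  have E : capo (copen c) (inter [::]) = copen c by apply: opens_ext => x; split => [[]|].
  rewrite E in s ds *.
  apply: (affine_like_lift (@chart_affine_like X c)); [exact: (Cl _).2|exact: (Cl _).1|].
  move=> x Ux; have [V [VU [Vx [t et]]]] := aC n _ s ds x Ux.
  by exists V, VU, t.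
have E : capo (copen c) (inter (c' :: l)) = capo (capo (copen c) (copen c')) (inter l).
  by apply: opens_ext => x; split => [[? []]|[[]]].
rewrite E in s ds *.
pose RF m := rest (inter l) (C m).
have RFl m : localizing (RF m) by apply: rest_localizing.
pose Rd m : omod_hom (RF m) (RF (m + 1)) := rest_hom (inter l) (cdiff C m).
have [|t et] := @affine_like_lift _ (RF n) (RF (n + 1)) (Rd n) _ s
  (@separated_inter_affine_like X c c' hsep) (RFl _).2 (RFl _).1; last by exists t.
move=> x [xc xc'].
by apply: (@chart_exact_local _ _ _ (Rd n) (Rd (n + 1)) c) => //; exact: IH.
Qed.

End Exactness.

(** * Products of complexes are products in each degree *)

Section DegreewiseProduct.
Variable X : scheme.
Implicit Types U V : opens X.
Hypothesis nX : noeth_top X.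

Section AtDegree.
Variables (Q : qcoh X) (E : complex X).

Definition at_deg m (u : omod_hom Q (E m)) n : omod_hom Q (E n) :=
  match pselect (m = n) with
  | left e => eq_rect m (fun k => omod_hom Q (E k)) u n e
  | right _ => zero_hom Q (E n)
  end.

Lemma at_deg_id m u : @at_deg m u m = u.
Proof. by rewrite /at_deg; case: pselect => // e; rewrite (Prop_irrelevance e erefl). Qed.

Lemma at_deg_neq m u n : m <> n -> @at_deg m u n = zero_hom Q (E n).
Proof. by rewrite /at_deg; case: pselect. Qed.

End AtDegree.

Section Disk.
Variable Q : qcoh X.

(** The sum of two copies of Q. *)
Definition dbl : omod X := prodsh (fun _ : bool => qsheaf Q).

Lemma dbl_qcoh : is_qcoh dbl.
Proof.
apply: localizing_qcoh; apply: finite_prod_localizing => b.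
exact: (qcoh_localizing nX (qcohP Q)).
Qed.

Definition dblq : qcoh X := Qcoh dbl_qcoh.

Definition dbl_d_fun U (s : msec dbl U) : msec dbl U := fun b => if b then 0 else s true.

Lemma dbl_d_linear U (a : osec U) (s t : msec dbl U) :
  dbl_d_fun (a *: s + t) = a *: dbl_d_fun s + dbl_d_fun t.
Proof.
apply: dprodm_ext => -[] //=; apply: esym.
by apply: (etrans (congr1 (+%R^~ 0) (scaler0 _ a))); rewrite addr0.
Qed.

Lemma dbl_d_res U V (VU : V `<=` U) (s : msec dbl U) :
  dbl_d_fun (mres VU s) = mres VU (dbl_d_fun s).
Proof. by apply: dprodm_ext => -[] //=; apply: esym; exact: (raddf0 (mres VU)). Qed.

Definition dbl_d : omod_hom dblq dblq := mkhom dbl_d_linear dbl_d_res.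

(** The complex with two copies of Q in each degree, and with differential the
    identity from the first copy to the second one of the next degree. It is the
    sum of all shifts of the complex id : Q -> Q, so a map to a complex E is a
    family of maps from Q to the terms of E, in all degrees. *)
Definition disk : complex X.
Proof.
apply: (@Complex X (fun=> dblq) (fun=> dbl_d)) => n U m.
by apply: dprodm_ext => -[].
Defined.

Definition dbl_inj_fun U (s : msec Q U) : msec dbl U := fun b => if b then s else 0.

Section FromDisk.
Variables (E : complex X) (m : int) (u : omod_hom Q (E m)).

Definition disk_fun n U (s : msec dbl U) : msec (E n) U :=
  at_deg u n U (s true) + at_deg (hom_comp (cdiff E m) u) n U (s false).

Lemma disk_fun_linear n U (a : osec U) (s t : msec dbl U) :
  @disk_fun n U (a *: s + t) = a *: disk_fun n s + disk_fun n t.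
Proof.
rewrite /disk_fun scalerDr addrACA; congr (_ + _).
  exact: (linearP (at_deg u n U) a (s true) (t true)).
exact: (linearP (at_deg _ n U) a (s false) (t false)).
Qed.

Lemma disk_fun_res n U V (VU : V `<=` U) (s : msec dbl U) :
  disk_fun n (mres VU s) = mres VU (disk_fun n s).
Proof. by rewrite /disk_fun raddfD -!hres. Qed.

Definition disk_hom n : omod_hom dblq (E n) := mkhom (@disk_fun_linear n) (@disk_fun_res n).

Lemma disk_homE n U (s : msec dbl U) : disk_hom n U s =
  at_deg u n U (s true) + at_deg (hom_comp (cdiff E m) u) n U (s false).
Proof. by []. Qed.

Lemma disk_chain n : hom_eq (hom_comp (disk_hom (n + 1)) (cdiff disk n))
  (hom_comp (cdiff E n) (disk_hom n)).
Proof.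
move=> U s; rewrite /= -[LHS]/(disk_hom (n + 1) U (dbl_d_fun s)) !disk_homE /=.
have -> : at_deg u (n + 1) U 0 = 0 by exact: raddf0.
rewrite add0r linearD.
have -> : cdiff E n U (at_deg (hom_comp (cdiff E m) u) n U (s false)) = 0.
  have [e|ne] := pselect (m + 1 = n); last by rewrite at_deg_neq // linear0.
  by subst n; rewrite at_deg_id; exact: cdiff2.
rewrite addr0; have [e|ne] := pselect (m = n).
  by subst n; rewrite !at_deg_id.
rewrite at_deg_neq; last by move=> /addIr.
by rewrite at_deg_neq // linear0.
Qed.

Definition disk_map : chain_map disk E := ChainMap disk_chain.

Lemma disk_map_inj U (s : msec Q U) : disk_map m U (dbl_inj_fun s) = u U s.
Proof. by rewrite /= -[LHS]/(disk_hom m U _) disk_homE /= at_deg_id linear0 addr0. Qed.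

End FromDisk.

Lemma dbl_inj_linear U (a : osec U) (s t : msec Q U) :
  dbl_inj_fun (a *: s + t) = a *: dbl_inj_fun s + dbl_inj_fun t.
Proof.
apply: dprodm_ext => -[] //=; apply: esym.
by apply: (etrans (congr1 (+%R^~ 0) (scaler0 _ a))); rewrite addr0.
Qed.

Lemma dbl_inj_res U V (VU : V `<=` U) (s : msec Q U) :
  dbl_inj_fun (mres VU s) = mres VU (dbl_inj_fun s).
Proof. by apply: dprodm_ext => -[] //=; apply: esym; exact: (raddf0 (mres VU)). Qed.

Definition dbl_inj : omod_hom Q dblq := mkhom dbl_inj_linear dbl_inj_res.

End Disk.

(** A map Q -> P m is a map from the disk to P concentrated in degree m. *)
Lemma degreewise_product (I : Type) (C : I -> complex X) (P : complex X)
    (pr : forall i, chain_map P (C i)) : is_product pr ->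
  forall m, is_qprod (fun i => pr i m : omod_hom (P m) (C i m)).
Proof.
move=> hP m; split=> [Q q|Q u v uv].
  have [u [uE _]] := hP (disk Q) (fun i => disk_map (q i)).
  exists (hom_comp (u m) (dbl_inj Q)) => i U s.
  by apply: (etrans (uE i m U (dbl_inj_fun s))); exact: disk_map_inj.
have comp (w : omod_hom Q (P m)) i n : (forall V t, pr i m V (w V t) = pr i m V (u V t)) ->
    hom_eq (hom_comp (pr i n) (disk_map w n)) (disk_map (hom_comp (pr i m) u) n).
  move=> wu U s; rewrite /= -[disk_hom w n U s]/(disk_fun w n s) -[RHS]/(disk_fun _ n s).
  rewrite /disk_fun linearD; congr (_ + _).
    have [e|ne] := pselect (m = n); last by rewrite !at_deg_neq // linear0.
    by subst n; rewrite !at_deg_id wu.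
  have [e|ne] := pselect (m + 1 = n); last by rewrite !at_deg_neq // linear0.
  subst n; rewrite !at_deg_id /=.
  by apply: (etrans (cmap_diff (pr i) _)); rewrite /= wu.
have [z [_ zu]] := hP (disk Q) (fun i => disk_map (hom_comp (pr i m) u)).
move=> U s; rewrite -(disk_map_inj u s) -(disk_map_inj v s).
apply: (etrans (zu (disk_map u) _ m U _)); first by move=> i n; apply: comp.
by apply: esym; apply: zu => i n; apply: comp => V t; rewrite uv.
Qed.

End DegreewiseProduct.

(** * The Cech double complex of a product *)

Section Single.
Variables (R : comPzRingType) (I : finType) (M : I -> lmodType R).

(** The injection of M i into the product. *)
Definition single i (x : M i) : dprodm M := fun j =>
  match pselect (i = j) with
  | left e => eq_rect i (fun k => M k : Type) x j e
  | right _ => 0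
  end.

Lemma single_id i x : @single i x i = x.
Proof. by rewrite /single; case: pselect => // e; rewrite (Prop_irrelevance e erefl). Qed.

Lemma single_neq i x j : i <> j -> @single i x j = 0.
Proof. by rewrite /single; case: pselect. Qed.

Lemma single_linear i (a : R) (x y : M i) :
  single (a *: x + y) = a *: single x + single y.
Proof.
apply: dprodm_ext => j; change (single (a *: x + y) j = a *: single x j + single y j).
have [e|ne] := pselect (i = j); first by subst j; rewrite !single_id.
by rewrite !single_neq // scaler0 addr0.
Qed.

Lemma single_sum (x : dprodm M) : \sum_i single (x i) = x.
Proof.
apply: dprodm_ext => j.
have ev (s : seq I) (y : I -> dprodm M) : (\sum_(i <- s) y i) j = \sum_(i <- s) y i j.
  by elim: s => [|i s IH]; rewrite ?big_nil // !big_cons -IH.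
rewrite ev (bigD1 j) //= single_id big1 ?addr0 // => i ij.
by rewrite single_neq //; apply/eqP.
Qed.

End Single.

Section ProductOfAcyclic.
Import mathcomp.boot.finset.
Variable X : scheme.
Hypothesis nX : noeth_top X.
Hypothesis hsep : is_separated X.
Variables (n : nat) (c : 'I_n -> chart X).
Hypothesis ccov : forall x, exists i, copen (c i) x.
Implicit Types (U V W : opens X) (S : {set 'I_n}).

(** F embeds into the sum of its restrictions to the charts, which is
    quasi-coherent; by injectivity the identity of F extends to this sum. *)
Lemma injective_retract (F : qcoh X) : is_injective F ->
  exists rho : forall g, omod_hom (rest (copen (c g)) F) F,
  forall U (s : msec F U), \sum_g rho g U (rest_unit (copen (c g)) F U s) = s.
Proof.
move=> Finj; have Fl := qcoh_localizing nX (qcohP F).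
pose G g := rest (copen (c g)) F.
have Nq : is_qcoh (prodsh G).
  by apply: localizing_qcoh; apply: finite_prod_localizing => g; exact: rest_localizing.
pose jf U (s : msec F U) : msec (prodsh G) U := fun g => rest_unit (copen (c g)) F U s.
have jL U (a : osec U) (s t : msec F U) : jf U (a *: s + t) = a *: jf U s + jf U t.
  by apply: dprodm_ext => g; exact: (linearP (rest_unit (copen (c g)) F U)).
have jR U V (VU : V `<=` U) (s : msec F U) : jf V (mres VU s) = mres VU (jf U s).
  by apply: dprodm_ext => g; exact: (hres (rest_unit (copen (c g)) F)).
pose j : omod_hom F (Qcoh Nq) := mkhom jL jR.
have jinj U (s t : msec F U) : j U s = j U t -> s = t.
  move=> e; apply: omod_sep => x Ux; have [g gx] := ccov x.
  exists (capo U (copen (c g))), (@capoL _ _ _); split => //.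
  exact: (congr1 (fun z : msec (prodsh G) U => z g) e).
have [|h hE] := Finj F (Qcoh Nq) j (id_hom F).
  by move=> L u v uv U s; apply: jinj; exact: uv.
have sR g U V (VU : V `<=` U) (s : msec (G g) U) :
    single (M := fun g => msec (G g) V) (mres VU s) =
    mres VU (single (M := fun g => msec (G g) U) s : msec (prodsh G) U).
  apply: dprodm_ext => g'; rewrite -[RHS]/(mres VU (single _ g')).
  have [e|ne] := pselect (g = g'); first by subst g'; rewrite !single_id.
  by rewrite !single_neq // raddf0.
pose inj g : omod_hom (G g) (Qcoh Nq) :=
  @mkhom X (G g) (prodsh G) (fun U => @single _ _ (fun g => msec (G g) U) g)
    (fun U => @single_linear _ _ (fun g => msec (G g) U) g) (sR g).
exists (fun g => hom_comp h (inj g)) => U s.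
rewrite -[RHS](hE U s); rewrite /= -(linear_sum (h U)); congr (h U _).
exact: (single_sum (M := fun g => msec (G g) U) (jf U s)).
Qed.

Variables (I : Type) (C : I -> complex X).
Hypothesis hacyclic : forall i, acyclic (C i).
Hypothesis hinj : forall i (n : int), is_injective (C i n).
Variables (P : complex X) (pr : forall i, chain_map P (C i)).
Hypothesis hP : is_product pr.

Definition charts_inter S : opens X := inter [seq c g | g <- enum S].

Lemma charts_interP S x : charts_inter S x <-> forall g, g \in S -> copen (c g) x.
Proof.
have h (l : seq 'I_n) : inter [seq c g | g <- l] x <-> forall g, g \in l -> copen (c g) x.
  elim: l => [|g l IH]; first by split.
  split => [[gx /IH lx] g'|gl]; first by rewrite inE => /orP[/eqP->|/lx].
  by split; [apply: gl; rewrite mem_head|apply/IH => g' g'l; apply: gl; rewrite inE g'l orbT].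
by rewrite /charts_inter h; split => e g gS; apply: e; rewrite ?mem_enum // -mem_enum.
Qed.

Lemma charts_interS S S' : S \subset S' -> charts_inter S' `<=` charts_inter S.
Proof. by move=> /fintype.subsetP SS x /charts_interP h; apply/charts_interP => g /SS; exact: h. Qed.

Definition G S m i : omod X := rest (charts_inter S) (C i m).

Let Cl i m : localizing (C i m) := qcoh_localizing nX (qcohP (C i m)).

(** For S nonempty the product comes from any chart in S; the one that pick
    selects is used consistently in all degrees. For S empty the restrictions are
    the sheaves themselves, and their product is the term of P in degree m. *)
Lemma product_of_restrictions S m : exists (Pi : qcoh X) (pi : forall i, omod_hom Pi (G S m i)),
  is_qprod pi /\ forall g, [pick g in S] = Some g ->
    [/\ local_on (copen (c g)) Pi,
      forall z z' : msec Pi (copen (c g)), (forall i, pi i _ z = pi i _ z') -> z = z' &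
      forall x : forall i, msec (G S m i) (copen (c g)), exists z, forall i, pi i _ z = x i].
Proof.
case: pickP => [g gS|S0].
  have [|i|Pi [pi [h1 h2 h3 h4]]] := @chart_product X I nX _ _ (cimm (c g)) (G S m).
  - by move=> i; exact: rest_localizing.
  - by apply: rest_local_on => x /charts_interP; apply.
  by exists Pi, pi; split => // g' [<-].
have charts_inter0 x : charts_inter S x by apply/charts_interP => g; rewrite S0.
have ub i V : bijective (rest_unit (charts_inter S) (C i m) V).
  by apply: (@mres_bij _ (C i m) V (capo V (charts_inter S)) (@capoL _ V (charts_inter S))) => x Vx; split.
have [ex un] := degreewise_product nX hP m.
exists (P m), (fun i => hom_comp (rest_unit (charts_inter S) (C i m)) (pr i m)); split => //.
split=> [Q q|Q u v uv].
  have [u ue] := ex Q (fun i => hom_comp (hom_inv (ub i)) (q i)).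
  exists u => i U s; apply: (etrans (congr1 (rest_unit (charts_inter S) (C i m) U) (ue i U s))).
  exact: (hom_invK (ub i)).
apply: un => i U s; apply: (bij_inj (ub i U)); exact: uv.
Qed.

Definition Pi S m : qcoh X := sval (cid (product_of_restrictions S m)).
Definition pi S m : forall i, omod_hom (Pi S m) (G S m i) :=
  sval (cid (svalP (cid (product_of_restrictions S m)))).

Let piP S m : is_qprod (pi S m) /\ forall g, [pick g in S] = Some g ->
    [/\ local_on (copen (c g)) (Pi S m),
      forall z z' : msec (Pi S m) (copen (c g)), (forall i, pi S m i _ z = pi S m i _ z') -> z = z' &
      forall x : forall i, msec (G S m i) (copen (c g)), exists z, forall i, pi S m i _ z = x i].
Proof. exact: (svalP (cid (svalP (cid (product_of_restrictions S m))))). Qed.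

Lemma pi_uniq S m (Q : qcoh X) (u v : omod_hom Q (Pi S m)) :
  (forall i U s, pi S m i U (u U s) = pi S m i U (v U s)) -> forall U s, u U s = v U s.
Proof. exact: (qprod_uniq (piP S m).1). Qed.

Section InducedMap.
Variables (S S' : {set 'I_n}) (m m' : int) (phi : forall i, omod_hom (G S m i) (G S' m' i)).

Definition pmap : omod_hom (Pi S m) (Pi S' m') :=
  sval (cid (qprod_ex (piP S' m').1 (fun i => hom_comp (phi i) (pi S m i)))).

Lemma pmapE i U s : pi S' m' i U (pmap U s) = phi i U (pi S m i U s).
Proof. exact: (svalP (cid (qprod_ex (piP S' m').1 (fun i => hom_comp (phi i) (pi S m i))))). Qed.

End InducedMap.

Definition dP m S : omod_hom (Pi S m) (Pi S (m + 1)) :=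
  pmap (fun i => rest_hom (charts_inter S) (cdiff (C i) m)).

(** Total in S and S', so that no proof of an inclusion has to be carried
    along. *)
Definition eP m S S' : omod_hom (Pi S m) (Pi S' m) :=
  match pselect (charts_inter S' `<=` charts_inter S) with
  | left h => pmap (fun i => rest_sub (C i m) h)
  | right _ => zero_hom _ _
  end.

Let rho i m : forall g, omod_hom (rest (copen (c g)) (C i m)) (C i m) :=
  sval (cid (@injective_retract (C i m) (@hinj i m))).

Let rhoE i m U (s : msec (C i m) U) :
  \sum_g rho i m g U (rest_unit (copen (c g)) (C i m) U s) = s.
Proof. exact: (svalP (cid (@injective_retract (C i m) (@hinj i m)))). Qed.

Lemma charts_inter_cap g S : capo (charts_inter S) (copen (c g)) `<=` charts_inter (g |: S).
Proof.
by move=> x [/charts_interP Sx gx]; apply/charts_interP => g'; rewrite in_setU1 => /orP[/eqP->|/Sx].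
Qed.

Definition rP m g S : omod_hom (Pi (g |: S) m) (Pi S m) :=
  pmap (fun i => rest_retr (@charts_inter_cap g S) (rho i m g)).

Lemma ePE m S S' i U s (SS : S \subset S') : pi S' m i U (eP m S S' U s) =
  rest_sub (C i m) (charts_interS SS) U (pi S m i U s).
Proof.
rewrite /eP; case: pselect => [h|]; last by case; exact: charts_interS.
by rewrite pmapE (Prop_irrelevance h (charts_interS SS)).
Qed.

Lemma dPdP m S U s : dP (m + 1) S U (dP m S U s) = 0.
Proof.
apply: (@pi_uniq S _ _ (hom_comp (dP (m + 1) S) (dP m S)) (zero_hom _ _)) => i V t.
by rewrite /= !pmapE linear0; exact: cdiff2.
Qed.

Lemma eP_id m S U s : eP m S S U s = s.
Proof.
apply: (@pi_uniq S _ _ (eP m S S) (id_hom _)) => i V t.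
rewrite (ePE _ _ (subxx S)) /= -[mkhom _ _ _ _]/(rest_sub_fun _ _) /rest_sub_fun.
by rewrite (mres_irr _ (@subset_refl _ _)) mres_id.
Qed.

Lemma eP_comp m S S' S'' U s : S \subset S' -> S' \subset S'' ->
  eP m S' S'' U (eP m S S' U s) = eP m S S'' U s.
Proof.
move=> h1 h2; apply: (@pi_uniq S'' _ _ (hom_comp (eP m S' S'') (eP m S S')) (eP m S S'')) => i V t.
rewrite /= (ePE _ _ h2) (ePE _ _ h1) (ePE _ _ (fintype.subset_trans h1 h2)).
by rewrite /= -!/(rest_sub_fun _ _) /rest_sub_fun !mresE; exact: mres_irr.
Qed.

Lemma dP_eP m S S' U s : S \subset S' ->
  dP m S' U (eP m S S' U s) = eP (m + 1) S S' U (dP m S U s).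
Proof.
move=> h; apply: (@pi_uniq S' _ _ (hom_comp (dP m S') (eP m S S')) (hom_comp (eP (m + 1) S S') (dP m S))) => i V t.
rewrite /= pmapE !(ePE _ _ h) pmapE.
exact: (hres (cdiff (C i) m)).
Qed.

Lemma rP_eP m g S S' U s : S \subset S' ->
  rP m g S' U (eP m (g |: S) (g |: S') U s) = eP m S S' U (rP m g S U s).
Proof.
move=> h; have h' : g |: S \subset g |: S' by exact: finset.setUS.
apply: (@pi_uniq S' _ _ (hom_comp (rP m g S') (eP m (g |: S) (g |: S')))
  (hom_comp (eP m S S') (rP m g S))) => i V t.
rewrite /= pmapE (ePE _ _ h) (ePE _ _ h') pmapE.
rewrite [RHS]/= -[RHS]/(rest_sub_fun _ _) /rest_sub_fun [in RHS]/= [in RHS]/rest_retr_fun.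
rewrite -hres [LHS]/= -[LHS]/(rest_retr_fun _ _ _) /rest_retr_fun; congr (rho i m g _ _).
by rewrite /= /rest_sub_fun /rest_res !mresE; exact: mres_irr.
Qed.

Lemma sum_rP m S U s : \sum_g rP m g S U (eP m S (g |: S) U s) = s.
Proof.
apply: (@pi_uniq S _ _ (sum_hom (fun g => hom_comp (rP m g S) (eP m S (g |: S)))) (id_hom _)) => i V t.
rewrite /= linear_sum /=.
transitivity (\sum_g rho i m g (capo V (charts_inter S)) (rest_unit (copen (c g)) (C i m) _ (pi S m i V t))); last exact: rhoE.
apply: eq_bigr => g _.
rewrite pmapE (ePE _ _ (finset.subsetUr _ _)).
rewrite /= /rest_retr_fun; congr (rho i m g _ _).
apply: (etrans (@mresE _ (C i m) _ _ _ (@capSr _ _ _ (charts_interS (finset.subsetUr [set g] S)) V) _ (pi S m i V t))).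
exact: (@mres_irr _ (C i m)).
Qed.

(** Over the chart g in S, the sections of the products are the products of the
    sections over the intersections of charts, where the C i are exact. As Pi S is
    the direct image of its restriction to the chart g, its sections over c0 are
    those over the intersection with the chart g, and lift since it is affine. *)
Lemma column_exact (m : int) S (c0 : chart X) (s : msec (Pi S (m + 1)) (copen c0)) :
  S != set0 -> dP (m + 1) S _ s = 0 -> exists t, dP m S _ t = s.
Proof.
move=> /set0Pn[g0 g0S] ds.
have Pil k : localizing (Pi S k) := qcoh_localizing nX (qcohP (Pi S k)).
have [g gpick gS] : exists2 g, [pick g in S] = Some g & g \in S.
  by case: pickP => [g gS|/(_ g0)]; [exists g|rewrite g0S].
have prop k := (piP S k).2 g gpick.
have exU (z : msec (Pi S (m + 1)) (copen (c g))) : dP (m + 1) S _ z = 0 ->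
    exists t, dP m S _ t = z.
  move=> dz; have [[_ _ surj] [_ ji _]] := (prop m, prop (m + 1)).
  have hx i : exists t : msec (C i m) (capo (copen (c g)) (charts_inter S)),
      cdiff (C i) m _ t = pi S (m + 1) i _ z.
    apply: (@acyclic_inter X nX hsep (C i) (@hacyclic i) [seq c g | g <- enum S] (c g) m).
    have := congr1 (pi S (m + 1 + 1) i _) dz; rewrite pmapE linear0; exact.
  have [t et] := surj (fun i => sval (cid (hx i))).
  exists t; apply: ji => i; rewrite pmapE et.
  exact: (svalP (cid (hx i))).
pose O := capo (copen c0) (copen (c g)).
pose sO := mres (@capoL _ _ _ : O `<=` copen c0) s.
have dsO : dP (m + 1) S O sO = 0 by rewrite hres ds raddf0.
have [|t et] := @affine_like_lift X _ _ (dP m S) O sO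
    (@separated_inter_affine_like X c0 (c g) hsep) (Pil m).2 (Pil (m + 1)).1.
  move=> x [x0 xg].
  have [V [VO [t [Vx et]]]] := chart_exact_local (Pil (m + 1)) (Pil (m + 1 + 1)) exU dsO (conj x0 xg : O x) xg.
  by exists V, VO, t.
have [[lo _ _] [lo' _ _]] := (prop m, prop (m + 1)).
have [k _ kK] := lo (copen c0).
exists (k t); apply: (bij_inj (lo' (copen c0))).
by rewrite -hres kK et.
Qed.

Let rest_unit_bij i m V : bijective (rest_unit (charts_inter set0) (C i m) V).
Proof.
apply: (@mres_bij _ (C i m) V (capo V (charts_inter set0)) (@capoL _ V (charts_inter set0))) => x Vx.
by split => //; apply/charts_interP => g; rewrite inE.
Qed.

(** Apply the theorem on cubes to the sections over c0 of the Pi S; the vertex of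
    the empty set is the complex P up to isomorphism. *)
Theorem product_exact (m : int) (c0 : chart X) (s : msec (P (m + 1)) (copen c0)) :
  cdiff P (m + 1) _ s = 0 -> exists t, cdiff P m _ t = s.
Proof.
move=> ds; pose O := copen c0.
have ex0 (k : int) (x : msec (Pi set0 (k + 1)) O) : dP (k + 1) set0 O x = 0 ->
    exists y, dP k set0 O y = x.
  apply: (@cube_exact (osec O) n (fun m S => msec (Pi S m) O)
    (fun m S => hsec (dP m S) O) (fun m S S' => hsec (eP m S S') O)
    (fun m g S => hsec (rP m g S) O)).
  - by move=> *; exact: dPdP.
  - by move=> *; exact: eP_id.
  - by move=> *; exact: eP_comp.
  - by move=> *; exact: dP_eP.
  - by move=> *; exact: rP_eP.
  - by move=> *; exact: sum_rP.
  - by move=> *; exact: column_exact.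
have exa k := qprod_ex (piP set0 k).1
  (fun i => hom_comp (rest_unit (charts_inter set0) (C i k)) (pr i k)).
pose a k := sval (cid (exa k)).
have aE k i U z : pi set0 k i U (a k U z) = rest_unit (charts_inter set0) (C i k) U (pr i k U z).
  exact: (svalP (cid (exa k)) i U z).
have exb k := qprod_ex (degreewise_product nX hP k)
  (fun i => hom_comp (hom_inv (rest_unit_bij i k)) (pi set0 k i)).
pose b k := sval (cid (exb k)).
have bE k i U z : rest_unit (charts_inter set0) (C i k) U (pr i k U (b k U z)) = pi set0 k i U z.
  apply: (etrans (congr1 (rest_unit (charts_inter set0) (C i k) U) (svalP (cid (exb k)) i U z))).
  exact: (hom_invK (rest_unit_bij i k)).
have ab k U z : b k U (a k U z) = z.
  apply: (@qprod_uniq _ _ _ _ _ (degreewise_product nX hP k) _ (hom_comp (b k) (a k)) (id_hom _)) => i V w.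
  apply: (bij_inj (rest_unit_bij i k V)).
  exact: (etrans (bE k i V (a k V w)) (aE k i V w)).
have da k U z : dP k set0 U (a k U z) = a (k + 1) U (cdiff P k U z).
  apply: (@pi_uniq _ _ _ (hom_comp (dP k set0) (a k)) (hom_comp (a (k + 1)) (cdiff P k))) => i V w.
  apply: (etrans (pmapE _ _ _)); rewrite aE; apply: esym; apply: (etrans (aE _ _ _ _)).
  apply: (etrans (congr1 _ (cmap_diff (pr i) w))).
  exact: (esym (hres (cdiff (C i) k) _ _)).
have db k U z : cdiff P k U (b k U z) = b (k + 1) U (dP k set0 U z).
  apply: (@qprod_uniq _ _ _ _ _ (degreewise_product nX hP (k + 1)) _
    (hom_comp (cdiff P k) (b k)) (hom_comp (b (k + 1)) (dP k set0))) => i V w.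
  apply: (bij_inj (rest_unit_bij i (k + 1) V)).
  apply: esym; apply: (etrans (bE _ _ _ _)); rewrite pmapE -bE; apply: esym.
  apply: (etrans (congr1 _ (cmap_diff (pr i) (b k V w)))).
  exact: (esym (hres (cdiff (C i) k) _ _)).
have [|t et] := ex0 m (a (m + 1) O s); first by rewrite da ds linear0.
by exists (b m O t); rewrite db et ab.
Qed.

Theorem product_acyclic : acyclic P.
Proof.
have Pl m : localizing (P m) := qcoh_localizing nX (qcohP (P m)).
move=> m U s ds x Ux; have [g gx] := ccov x.
have [V [VU [t [Vx et]]]] := chart_exact_local (Pl (m + 1)) (Pl (m + 1 + 1))
  (@product_exact m (c g)) ds Ux gx.
by exists V, VU; split => //; exists t.
Qed.

End ProductOfAcyclic.

Theorem corollary1p2 (X : scheme) (hsep : is_separated X) (hnoeth : is_noetherian X)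
    (I : Type) (C : I -> complex X)
    (hacyclic : forall i, acyclic (C i))
    (hinj : forall i (n : int), is_injective (C i n))
    (P : complex X) (pr : forall i, chain_map P (C i))
    (hP : is_product pr) :
  acyclic P.
Proof.
have nX := noetherian_scheme hnoeth; have [n [c cov]] := finite_charts hnoeth.
exact: (product_acyclic nX hsep cov hacyclic hinj hP).
Qed.
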